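(* Let $n\ge2$ and $f\in L^1(S^n_+)$. Put $\Phi(\theta,t)=(1-t^2)^{-1/2}(V_+f)(\theta,t)$ for $(\theta,t)\in S^{n-1}\times(-1,1)$ and $\Phi(\theta,t)=0$ for $|t|\ge1$. Then $\Phi=R\psi$ for a unique $\psi\in L^1(\mathbb{R}^n)$ supported in $B_n$ (denoted $\psi=R^{-1}\Phi$), and \[ f(x',x_{n+1})=x_{n+1}\,(R^{-1}\Phi)(x')\qquad\text{for almost every }x=(x',x_{n+1})\in S^n_+ . \]
   Context: Points of $\mathbb{R}^{n+1}$ are written $x=(x',x_{n+1})$, $x'\in\mathbb{R}^n$. $S^n$ is the unit sphere in $\mathbb{R}^{n+1}$, $S^n_+=\{x\in S^n:x_{n+1}\ge0\}$, $B_n$ the closed unit ball of $\mathbb{R}^n$, $S^{n-1}=\partial B_n$. For $\theta\in S^{n-1}$, $t\in(-1,1)$, let $\tau(\theta,t)=\{x\in S^n:x'\cdot\theta=t\}$ and $(V_+f)(\theta,t)=\int_{S^n_+\cap\tau(\theta,t)}f(x)\,d_\tau\sigma(x)$, with $d_\tau\sigma$ the induced surface measure on $\tau(\theta,t)$. The hyperplane Radon transform is $(R\psi)(\theta,t)=\int_{\{x'\cdot\theta=t\}}\psi(x')\,d_{\theta,t}x'$ ($\theta\in S^{n-1}$, $t\in\mathbb{R}$), with $d_{\theta,t}x'$ Lebesgue measure on the hyperplane. *)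

(* Defs.v *)
From HB Require Import structures.
From mathcomp Require Import all_boot all_order all_algebra.
From mathcomp Require Import all_classical all_reals all_analysis.
Set Implicit Arguments. Unset Strict Implicit. Unset Printing Implicit Defensive.
Import Order.TTheory GRing.Theory Num.Theory.
Local Open Scope classical_set_scope.
Local Open Scope ring_scope.

(* Real types are not canonically pointed in this library version; we
   declare 0 as the (irrelevant) distinguished point, so that R^m is a
   pointedType (needed by [caratheodory_type]). *)
HB.instance Definition _ (R : realType) := isPointed.Build R 0%R.

Section euclid.
Variable R : realType.

Definition dotv (m : nat) (u v : 'rV[R]_m) : R := \sum_(i < m) u ord0 i * v ord0 i.
Definition enorm (m : nat) (u : 'rV[R]_m) : R := Num.sqrt (dotv u u).

Fixpoint ball_vol (k : nat) : R :=
  match k with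
  | 0%N => 1
  | 1%N => 2
  | (k'.+2) as k => 2 * pi / k%:R * ball_vol k'
  end.

Lemma ball_vol_ge0 k : 0 <= ball_vol k.
Proof.
suff H : forall k, 0 <= ball_vol k /\ 0 <= ball_vol k.+1 by case: (H k).
elim=> [|j [IH1 IH2]]; first by split; rewrite /= ?ler01 ?ler0n.
split=> //=; apply: mulr_ge0 => //.
by apply: divr_ge0; [apply: mulr_ge0 => //; exact: pi_ge0|].
Qed.

Local Open Scope ereal_scope.

(* Euclidean diameter of a set (in \bar R; -oo for the empty set). *)
Definition ediam (m : nat) (C : set 'rV[R]_m) : \bar R :=
  ereal_sup [set (enorm (x - y))%:E | x in C & y in C].

Definition hgauge (m s : nat) (C : set 'rV[R]_m) : \bar R :=
  if pselect (C = set0) then 0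
  else (ball_vol s)%:E * (ediam C * (2^-1)%:E) ^+ s.

Lemma hgauge0 m s : hgauge s (@set0 'rV[R]_m) = 0.
Proof. by rewrite /hgauge; case: pselect. Qed.

Lemma hgauge_ge0 m s (C : set 'rV[R]_m) : 0 <= hgauge s C.
Proof.
rewrite /hgauge; case: pselect => // CN.
have /set0P [x Cx] : C != set0 by apply/eqP.
apply: mule_ge0; first by rewrite lee_fin ball_vol_ge0.
apply: expe_ge0; apply: mule_ge0; last by rewrite lee_fin.
apply: (@le_trans _ _ (enorm (x - x))%:E); first by rewrite lee_fin sqrtr_ge0.
by apply: ereal_sup_ubound; exists x => //; exists x.
Qed.

Local Close Scope ereal_scope.

(* sets of Euclidean diameter <= delta form a semiring of sets (they are
   closed under intersections and differences); [cov_type m delta] is R^m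
   equipped with this semiring, used to form delta-covers. *)
Definition cov_type (m : nat) (delta : R) : Type := 'rV[R]_m.
Definition small_set (m : nat) (delta : R) (C : set 'rV[R]_m) : Prop :=
  forall x y, C x -> C y -> enorm (x - y) <= delta.

Section covtype.
Variables (m : nat) (delta : R).
HB.instance Definition _ := Pointed.copy (cov_type m delta) 'rV[R]_m.
Lemma small_set0 : small_set delta (@set0 'rV[R]_m).
Proof. by []. Qed.
Lemma small_setI : setI_closed (@small_set m delta).
Proof. by move=> A B HA _ x y [Ax _] [Ay _]; exact: HA. Qed.
Lemma small_setD : semi_setD_closed (@small_set m delta).
Proof.
apply: setD_semi_setD_closed => A B HA _ x y [Ax _] [Ay _]; exact: HA.
Qed.
HB.instance Definition _ := @isSemiRingOfSets.Build default_measure_display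
  (cov_type m delta) (@small_set m delta) small_set0 small_setI small_setD.
End covtype.

Local Open Scope ereal_scope.

(* delta-approximating Hausdorff measure, and s-dimensional Hausdorff outer
   measure on R^m (normalized so that H^m is Lebesgue measure on R^m) *)
Definition hausdorff_delta (m s : nat) (delta : R) (A : set 'rV[R]_m) : \bar R :=
  mu_ext (T := cov_type m delta) (@hgauge m s) A.

Definition hausdorff (m s : nat) (A : set 'rV[R]_m) : \bar R :=
  ereal_sup [set hausdorff_delta s delta A | delta in [set d : R | (0 < d)%R]].

Section hausdorff_outer.
Variables (m s : nat).
Let H := @hausdorff m s.

Let Hd_ge0 d A : 0 <= @hausdorff_delta m s d A.
Proof. exact: (@mu_ext_ge0 _ (cov_type m d) _ (@hgauge m s) (@hgauge_ge0 m s) A). Qed.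

Lemma hausdorff_ge0 A : 0 <= H A.
Proof.
apply: (@le_trans _ _ (@hausdorff_delta m s 1%R A)); first exact: Hd_ge0.
by apply: ereal_sup_ubound => /=; exists 1%R => //=; rewrite ltr01.
Qed.

Lemma hausdorff0 : H set0 = 0.
Proof.
apply/eqP; rewrite eq_le hausdorff_ge0 andbT.
apply: ub_ereal_sup => _ [d _ <-].
by rewrite /hausdorff_delta (@mu_ext0 _ (cov_type m d) _ _ (@hgauge0 m s) (@hgauge_ge0 m s)).
Qed.

Lemma le_hausdorff : {homo H : A B / A `<=` B >-> A <= B}.
Proof.
move=> A B AB; apply: ub_ereal_sup => _ [d d0 <-].
apply: (@le_trans _ _ (@hausdorff_delta m s d B)).
  exact: (@le_mu_ext _ (cov_type m d) _ (@hgauge m s)).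
by apply: ereal_sup_ubound => /=; exists d.
Qed.

Lemma hausdorff_sigma_subadditive : sigma_subadditive H.
Proof.
move=> F; apply: ub_ereal_sup => _ [d d0 <-].
apply: (@le_trans _ _ (\sum_(i <oo) @hausdorff_delta m s d (F i))).
  exact: (@mu_ext_sigma_subadditive _ (cov_type m d) _ _ (@hgauge_ge0 m s)).
apply: lee_nneseries => [i _ _|i _]; first exact: Hd_ge0.
by apply: ereal_sup_ubound => /=; exists d.
Qed.

HB.instance Definition _ := isOuterMeasure.Build R 'rV[R]_m H
  hausdorff0 hausdorff_ge0 le_hausdorff hausdorff_sigma_subadditive.

End hausdorff_outer.

Definition hausdorff_om (m s : nat) : {outer_measure set 'rV[R]_m -> \bar R} :=
  @hausdorff m s.

Definition HM (m s : nat)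
  : {measure set (caratheodory_type (hausdorff_om m s)) -> \bar R} :=
  (hausdorff_om m s : set (caratheodory_type (hausdorff_om m s)) -> \bar R).

End euclid.

Arguments HM {R} m s.

Section geometry.
Variable R : realType.
Local Open Scope ereal_scope.

(* A point x of R^(n+1) is written x = (x', x_(n+1)) with x' = lsubmx x in
   R^n and x_(n+1) = xlast x. *)
Definition xlast (n : nat) (x : 'rV[R]_(n + 1)) : R := rsubmx x ord0 ord0.

Definition hemisphere (n : nat) : set 'rV[R]_(n + 1) :=
  [set x | enorm x = 1%R /\ (0 <= xlast x)%R].

Definition unit_ball (n : nat) : set 'rV[R]_n := [set x | (enorm x <= 1)%R].

Definition tau (n : nat) (theta : 'rV[R]_n) (t : R) : set 'rV[R]_(n + 1) :=
  [set x | enorm x = 1%R /\ dotv (lsubmx x) theta = t].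

(* (V_+ f)(theta, t): integral over S^n_+ /\ tau(theta,t) w.r.t. the induced
   (n-1)-dimensional surface measure, i.e. (n-1)-dimensional Hausdorff
   measure of R^(n+1). *)
Definition Vplus (n : nat) (f : 'rV[R]_(n + 1) -> R) (theta : 'rV[R]_n) (t : R)
  : \bar R :=
  \int[HM (n + 1) n.-1]_(x in @hemisphere n `&` tau theta t) (f x)%:E.

Definition Phi (n : nat) (f : 'rV[R]_(n + 1) -> R) (theta : 'rV[R]_n) (t : R)
  : \bar R :=
  if (`|t| < 1)%R then ((Num.sqrt (1 - t ^+ 2))^-1)%:E * Vplus f theta t
  else 0.

Definition hyperplane (n : nat) (theta : 'rV[R]_n) (t : R) : set 'rV[R]_n :=
  [set x | dotv x theta = t].

(* hyperplane Radon transform, integrating w.r.t. (n-1)-dimensional Lebesgue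
   (= Hausdorff) measure on the hyperplane *)
Definition radon (n : nat) (psi : 'rV[R]_n -> R) (theta : 'rV[R]_n) (t : R)
  : \bar R :=
  \int[HM n n.-1]_(x in hyperplane theta t) (psi x)%:E.

End geometry.

Arguments hemisphere {R} n.
Arguments unit_ball {R n}.

(* Main.v *)
Require Import Defs.
From HB Require Import structures.
From mathcomp Require Import all_boot all_order all_algebra.
From mathcomp Require Import all_classical all_reals all_analysis.
From mathcomp Require Import measurable_realfun ring lra zify.
Import Order.TTheory GRing.Theory Num.Theory numFieldNormedType.Exports.
Set Implicit Arguments. Unset Strict Implicit. Unset Printing Implicit Defensive.
Local Open Scope classical_set_scope.
Local Open Scope ring_scope.

(* Above x' in the open unit ball lies the single point x = (x', sqrt (1 - |x'|^2)) of the
   open upper hemisphere, whose surface element is dx' / x_(n+1).  So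
   psi(x') = f(x) / x_(n+1) is integrable.  The slice x' . theta = t of the hemisphere is
   similar, with ratio s = sqrt (1 - t^2), to the hemisphere of R^n; its surface element
   over the (n-1)-dimensional disc of radius s is s dx' / x_(n+1), which gives
   V_+ f = s R psi, i.e. Phi = R psi.  (For almost every t the slice does not see
   a null set where f was changed to make it Borel, by Fubini on the projection.)

   The area formula is obtained by comparing, near each a, the lifting x' |-> x with a linear
   map that stretches one direction by 1 / sqrt (1 - |a|^2): the ratio of distances is
   within 1 + e, hence so is, up to a power, that of Hausdorff measures.

   Uniqueness: if R g = 0 then, integrating over the hyperplanes orthogonal to xi, the Laplace
   transform of g vanishes at every xi.  For g supported in the unit ball, this persists when
   g is multiplied by polynomials in the functions exp (x_i), then by their bounded
   pointwise limits; these include the indicators of all Borel sets, so g = 0 a.e. *)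

(** * Euclidean norm and Hausdorff measures *)

(** Two features of the definitions shape the proof. The integrals are taken against Hausdorff
    measures on Caratheodory sigma-algebras, which are badly adapted to preimages and products.
    Hence all computations are done on Borel sets, after [f] has been replaced by a Borel [F] equal
    to it off a Borel null set. For [F] the identity with the Radon transform holds at every [t];
    going back to [f] costs, for each [theta], a null set of [t]. Moreover Fubini requires the
    k-dimensional Hausdorff measure to be a product measure up to a factor. Computing that factor
    would call for the isodiametric inequality. Instead, both measures are translation invariant,
    hence proportional, and only the positivity and finiteness of the factor are proved: it cancels
    in the area formula, and in the uniqueness argument it multiplies both sides. The slice identity
    itself uses only similarities and the area formula one dimension lower. Real exponentials can
    replace characters in the uniqueness argument because they are bounded on the unit ball. *)

Section euclidean.
Variable R : realType.
Implicit Types m : nat.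

Lemma dotvC m (u v : 'rV[R]_m) : dotv u v = dotv v u.
Proof. by rewrite /dotv; apply: eq_bigr => i _; rewrite mulrC. Qed.

Lemma dotvDl m (u v w : 'rV[R]_m) : dotv (u + v) w = dotv u w + dotv v w.
Proof.
by rewrite /dotv -big_split; apply: eq_bigr => i _; rewrite !mxE mulrDl.
Qed.

Lemma dotvZl m a (u v : 'rV[R]_m) : dotv (a *: u) v = a * dotv u v.
Proof. by rewrite /dotv mulr_sumr; apply: eq_bigr => i _; rewrite !mxE mulrA. Qed.

Lemma dotvNl m (u v : 'rV[R]_m) : dotv (- u) v = - dotv u v.
Proof. by rewrite -scaleN1r dotvZl mulN1r. Qed.

Lemma dotvBl m (u v w : 'rV[R]_m) : dotv (u - v) w = dotv u w - dotv v w.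
Proof. by rewrite dotvDl dotvNl. Qed.

Lemma dotvDr m (u v w : 'rV[R]_m) : dotv w (u + v) = dotv w u + dotv w v.
Proof. by rewrite dotvC dotvDl !(dotvC w). Qed.

Lemma dotvZr m a (u v : 'rV[R]_m) : dotv u (a *: v) = a * dotv u v.
Proof. by rewrite dotvC dotvZl dotvC. Qed.

Lemma dotvNr m (u v : 'rV[R]_m) : dotv u (- v) = - dotv u v.
Proof. by rewrite dotvC dotvNl dotvC. Qed.

Lemma dotvBr m (u v w : 'rV[R]_m) : dotv w (u - v) = dotv w u - dotv w v.
Proof. by rewrite dotvDr dotvNr. Qed.

Lemma dotv0r m (u : 'rV[R]_m) : dotv u 0 = 0.
Proof. by rewrite -(scale0r 0) dotvZr mul0r. Qed.

Lemma dotvv_ge0 m (u : 'rV[R]_m) : 0 <= dotv u u.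
Proof. by apply: sumr_ge0 => i _; rewrite -expr2 sqr_ge0. Qed.

Lemma enorm_ge0 m (u : 'rV[R]_m) : 0 <= enorm u.
Proof. exact: sqrtr_ge0. Qed.

Lemma sqr_enorm m (u : 'rV[R]_m) : enorm u ^+ 2 = dotv u u.
Proof. by rewrite sqr_sqrtr// dotvv_ge0. Qed.

Lemma enorm_eqP m (u : 'rV[R]_m) a : 0 <= a -> dotv u u = a ^+ 2 -> enorm u = a.
Proof. by move=> a0 e; rewrite /enorm e sqrtr_sqr ger0_norm. Qed.

Lemma enorm1P m (u : 'rV[R]_m) : enorm u = 1 <-> dotv u u = 1.
Proof. by rewrite -sqr_enorm; split=> [->|h]; rewrite ?expr1n//; apply: enorm_eqP; rewrite // -sqr_enorm h expr1n. Qed.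

Lemma eq_enorm m m' (u : 'rV[R]_m) (v : 'rV[R]_m') :
  dotv u u = dotv v v -> enorm u = enorm v.
Proof. by rewrite /enorm => ->. Qed.

Lemma enorm0_eq0 m (u : 'rV[R]_m) : enorm u = 0 -> u = 0.
Proof.
move=> u0; have : dotv u u = 0 by rewrite -sqr_enorm u0 expr0n.
move=> /eqP; rewrite /dotv psumr_eq0 => [|i _]; last by rewrite -expr2 sqr_ge0.
move=> /allP h; apply/rowP => i; rewrite mxE.
by have /implyP/(_ isT) := h i (mem_index_enum _); rewrite mulf_eq0 orbb => /eqP.
Qed.

Lemma enorm0 m : enorm (0 : 'rV[R]_m) = 0.
Proof. by rewrite /enorm dotv0r sqrtr0. Qed.

Lemma enormZ m a (u : 'rV[R]_m) : enorm (a *: u) = `|a| * enorm u.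
Proof.
apply: enorm_eqP; first by rewrite mulr_ge0// enorm_ge0.
by rewrite dotvZl dotvZr exprMn sqr_enorm real_normK ?num_real// mulrA.
Qed.

Lemma enormN m (u : 'rV[R]_m) : enorm (- u) = enorm u.
Proof. by rewrite -scaleN1r enormZ normrN normr1 mul1r. Qed.

Lemma enormBC m (u v : 'rV[R]_m) : enorm (u - v) = enorm (v - u).
Proof. by rewrite -opprB enormN. Qed.

Lemma dotv_le m (u v : 'rV[R]_m) : dotv u v <= enorm u * enorm v.
Proof.
have [u0|u0] := eqVneq (enorm u) 0.
  by rewrite u0 mul0r (enorm0_eq0 u0) dotvC dotv0r.
have [v0|v0] := eqVneq (enorm v) 0.
  by rewrite v0 mulr0 (enorm0_eq0 v0) dotv0r.
have {}u0 : 0 < enorm u by rewrite lt_def u0 enorm_ge0.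
have {}v0 : 0 < enorm v by rewrite lt_def v0 enorm_ge0.
(* Expanded, this square is [2 |u| |v| (|u| |v| - u . v)]. *)
have := dotvv_ge0 (enorm v *: u - enorm u *: v).
rewrite !(dotvBl, dotvBr, dotvZl, dotvZr) -!sqr_enorm (dotvC v u) => h.
rewrite -subr_ge0 -(pmulr_rge0 _ (mulr_gt0 u0 v0)); nra.
Qed.

Lemma norm_dotv_le m (u v : 'rV[R]_m) : `|dotv u v| <= enorm u * enorm v.
Proof.
rewrite ler_norml dotv_le andbT lerNl -dotvNl.
by rewrite (le_trans (dotv_le _ _))// enormN.
Qed.

Lemma ler_enormD m (u v : 'rV[R]_m) : enorm (u + v) <= enorm u + enorm v.
Proof.
rewrite -(@ler_pXn2r _ 2) ?nnegrE ?addr_ge0 ?enorm_ge0// sqr_enorm.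
rewrite dotvDl !dotvDr (dotvC v u) sqrrD !sqr_enorm.
have := dotv_le u v; lra.
Qed.

Lemma ler_enormB m (u v w : 'rV[R]_m) : enorm (u - w) <= enorm (u - v) + enorm (v - w).
Proof. by rewrite (le_trans _ (ler_enormD _ _))// addrA subrK. Qed.

Lemma coord_le_enorm m (u : 'rV[R]_m) i : `|u ord0 i| <= enorm u.
Proof.
rewrite -(@ler_pXn2r _ 2) ?nnegrE ?enorm_ge0// sqr_enorm real_normK ?num_real//.
rewrite /dotv (bigD1 i)//= -expr2 lerDl; apply: sumr_ge0 => j _.
by rewrite -expr2 sqr_ge0.
Qed.

Lemma enorm_le_sum m (u : 'rV[R]_m) : enorm u <= \sum_i `|u ord0 i|.
Proof.
have s0 (P : pred 'I_m) : 0 <= \sum_(i | P i) `|u ord0 i| by exact: sumr_ge0.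
rewrite -(@ler_pXn2r _ 2) ?nnegrE ?enorm_ge0// sqr_enorm expr2 mulr_suml.
apply: ler_sum => i _; rewrite (le_trans (ler_norm _))// normrM.
by rewrite ler_wpM2l// (bigD1 i)//= lerDl s0.
Qed.

End euclidean.

(** * Diameter and gauge of a set *)

Section diameter.
Variable R : realType.
Local Open Scope ereal_scope.

Lemma ediam_ub m (C : set 'rV[R]_m) x y : C x -> C y -> (enorm (x - y))%:E <= ediam C.
Proof. by move=> Cx Cy; apply: ereal_sup_ubound; exists x => //; exists y. Qed.

Lemma ediam_le m (C : set 'rV[R]_m) M :
  (forall x y, C x -> C y -> (enorm (x - y))%:E <= M) -> ediam C <= M.
Proof. by move=> h; apply: ge_ereal_sup => _ [x Cx] [y Cy] <-; exact: h. Qed.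

Lemma ediam_ge0 m (C : set 'rV[R]_m) x : C x -> 0 <= ediam C.
Proof.
by move=> Cx; rewrite (le_trans _ (ediam_ub Cx Cx))// lee_fin enorm_ge0.
Qed.

Lemma lee_expe2 (x y : \bar R) s : 0 <= x -> x <= y -> x ^+ s <= y ^+ s.
Proof.
move=> x0 xy; elim: s => [|s ih]; first by rewrite !expe0.
by rewrite !expeS lee_pmul// expe_ge0.
Qed.

Lemma expeMl (a : R) (y : \bar R) s : (a%:E * y) ^+ s = (a ^+ s)%:E * y ^+ s.
Proof.
elim: s => [|s ih]; first by rewrite !expe0 mule1.
by rewrite !expeS ih exprS EFinM muleACA.
Qed.

Lemma hgauge_neq0 m s (C : set 'rV[R]_m) x : C x ->
  hgauge s C = (ball_vol R s)%:E * (ediam C * (2^-1)%:E) ^+ s.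
Proof.
by move=> Cx; rewrite /hgauge; case: pselect => // C0; rewrite C0 in Cx.
Qed.

Lemma le_hgauge m m' s (c : R) (C : set 'rV[R]_m) (C' : set 'rV[R]_m') :
  (0 <= c)%R -> (C' !=set0 -> C !=set0) -> ediam C' <= c%:E * ediam C ->
  hgauge s C' <= (c ^+ s)%:E * hgauge s C.
Proof.
move=> c0 CC' d.
have [->|/set0P [x C'x]] := eqVneq C' set0.
  by rewrite hgauge0 mule_ge0 ?hgauge_ge0// lee_fin exprn_ge0.
have [y Cy] : C !=set0 by apply: CC'; exists x.
rewrite (hgauge_neq0 _ C'x) (hgauge_neq0 _ Cy) muleCA lee_wpmul2l//.
  by rewrite lee_fin ball_vol_ge0.
rewrite -expeMl muleA; apply: lee_expe2.
  by rewrite mule_ge0 ?lee_fin// (ediam_ge0 C'x).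
by rewrite lee_wpmul2r.
Qed.

Lemma subset_hgauge m s (C C' : set 'rV[R]_m) : C' `<=` C -> hgauge s C' <= hgauge s C.
Proof.
move=> CC'; have := @le_hgauge m m s 1 C C'; rewrite expr1n !mul1e; apply => //.
  by move=> [x /CC']; exists x.
by apply: ediam_le => x y /CC' Cx /CC' Cy; exact: ediam_ub.
Qed.

End diameter.

(** * Hausdorff measures: coverings, Lipschitz maps, separated sets *)

Section hausdorff_cover.
Variable R : realType.
Local Open Scope ereal_scope.

Lemma hausdorff_delta_le_cover m s d (A : set 'rV[R]_m) F :
  (forall k, small_set d (F k)) -> A `<=` \bigcup_k F k ->
  hausdorff_delta s d A <= \sum_(k <oo) hgauge s (F k).
Proof. by move=> dF AF; apply: ereal_inf_lbound; exists F. Qed.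

Lemma le_hausdorff_delta m s d (A : set 'rV[R]_m) x :
  (forall F, (forall k, small_set d (F k)) -> A `<=` \bigcup_k F k ->
    x <= \sum_(k <oo) hgauge s (F k)) -> x <= hausdorff_delta s d A.
Proof. by move=> h; apply: le_ereal_inf_tmp => _ [F [dF AF]] <-; exact: h. Qed.

Lemma hausdorff_delta_le m s d (A : set 'rV[R]_m) :
  (0 < d)%R -> hausdorff_delta s d A <= hausdorff s A.
Proof. by move=> d0; apply: ereal_sup_ubound; exists d. Qed.

Lemma hausdorff_le m s (A : set 'rV[R]_m) x :
  (forall d, (0 < d)%R -> hausdorff_delta s d A <= x) -> hausdorff s A <= x.
Proof. by move=> h; apply: ge_ereal_sup => _ [d d0] <-; exact: h. Qed.

Lemma hausdorff_delta_ge0 m s d (A : set 'rV[R]_m) : 0 <= hausdorff_delta s d A.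
Proof.
apply: le_hausdorff_delta => F _ _; apply: nneseries_ge0 => k _ _.
exact: hgauge_ge0.
Qed.

Lemma hausdorff_delta_anti m s d d' (A : set 'rV[R]_m) : (d <= d')%R ->
  hausdorff_delta s d' A <= hausdorff_delta s d A.
Proof.
move=> dd'; apply: le_hausdorff_delta => F dF AF.
apply: hausdorff_delta_le_cover => // k x y Fx Fy.
by rewrite (le_trans _ dd')//; exact: dF Fx Fy.
Qed.

(** [T] acts on sets, not on points, so that coverings can be carried along a relation such as g(x)
    to f(x) without inverting [g]. *)
Lemma hausdorff_le_transport m m' s (c : R) (A : set 'rV[R]_m) (A' : set 'rV[R]_m')
    (T : set 'rV[R]_m -> set 'rV[R]_m') :
  (0 < c)%R ->
  (forall d', (0 < d')%R -> exists2 d : R, (0 < d)%R &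
     forall C, small_set d C -> small_set d' (T C)) ->
  (forall C, hgauge s (T C) <= c%:E * hgauge s C) ->
  (forall F : nat -> set 'rV[R]_m, A `<=` \bigcup_k F k -> A' `<=` \bigcup_k T (F k)) ->
  hausdorff s A' <= c%:E * hausdorff s A.
Proof.
move=> c0 Td Tg TA; apply: hausdorff_le => d' d'0.
have [d d0 dT] := Td _ d'0.
apply: (@le_trans _ _ (c%:E * hausdorff_delta s d A)); last first.
  by rewrite lee_wpmul2l ?lee_fin ?(ltW c0)// hausdorff_delta_le.
rewrite -lee_pdivrMl//; apply: le_hausdorff_delta => F dF AF.
rewrite lee_pdivrMl// -nneseriesZl//; last by move=> *; exact: hgauge_ge0.
apply: (@le_trans _ _ (\sum_(k <oo) hgauge s (T (F k)))).
  by apply: hausdorff_delta_le_cover (TA _ AF) => k; exact: dT.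
by apply: lee_nneseries => [k _ _|k _]; [exact: hgauge_ge0|exact: Tg].
Qed.

(** The relation g(x) to f(x) is an L-Lipschitz map on g(A). Keeping two maps on a common domain
    allows two parametrizations of different surfaces to be compared directly, in either
    direction. *)
Lemma hausdorff_compare p m m' s (L : R) (f : 'rV[R]_p -> 'rV[R]_m)
    (g : 'rV[R]_p -> 'rV[R]_m') (A : set 'rV[R]_p) :
  (0 < L)%R ->
  (forall x y, A x -> A y -> (enorm (f x - f y) <= L * enorm (g x - g y))%R) ->
  hausdorff s (f @` A) <= (L ^+ s)%:E * hausdorff s (g @` A).
Proof.
move=> L0 fg; apply: (@hausdorff_le_transport _ _ _ _ _ _ (fun C => f @` (g @^-1` C `&` A))).
- by rewrite exprn_gt0.
- move=> d' d'0; exists (d' / L)%R; first by rewrite divr_gt0.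
  move=> C dC _ _ [x [Cx Ax] <-] [y [Cy Ay] <-].
  by rewrite (le_trans (fg _ _ Ax Ay))// mulrC -ler_pdivlMr// dC.
- move=> C; apply: le_hgauge (ltW L0) _ _; first by move=> [_ [x [Cx _]] _]; exists (g x).
  apply: ediam_le => _ _ [x [Cx Ax] <-] [y [Cy Ay] <-].
  apply: (@le_trans _ _ (L%:E * (enorm (g x - g y))%:E)).
    by rewrite -EFinM lee_fin fg.
  by rewrite lee_wpmul2l ?lee_fin ?(ltW L0)// ediam_ub.
- move=> F AF _ [x Ax <-]; have [k _ Fkx] := AF (g x) (ex_intro2 _ _ x Ax erefl).
  by exists k => //; exists x.
Qed.

Lemma hausdorff_lipschitz m m' s (L : R) (g : 'rV[R]_m -> 'rV[R]_m') (A : set 'rV[R]_m) :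
  (0 < L)%R ->
  (forall x y, A x -> A y -> (enorm (g x - g y) <= L * enorm (x - y))%R) ->
  hausdorff s (g @` A) <= (L ^+ s)%:E * hausdorff s A.
Proof. by move=> L0 gL; rewrite -[X in _ * hausdorff s X]image_id; exact: hausdorff_compare. Qed.

Lemma hausdorff_delta_subset m s d (A B : set 'rV[R]_m) :
  A `<=` B -> hausdorff_delta s d A <= hausdorff_delta s d B.
Proof.
move=> AB; apply: le_hausdorff_delta => F dF BF.
by apply: hausdorff_delta_le_cover => //; exact: subset_trans BF.
Qed.

(* A set of diameter at most d < e cannot meet both A and B. *)
Lemma hausdorff_delta_metric m s (d e : R) (A B : set 'rV[R]_m) : (d < e)%R ->
  (forall x y, A x -> B y -> (e <= enorm (x - y))%R) ->
  hausdorff_delta s d A + hausdorff_delta s d B <= hausdorff_delta s d (A `|` B).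
Proof.
move=> de AB; apply: le_hausdorff_delta => F dF ABF.
(* [G X k] is [F k] if this set meets [X], and empty otherwise. So a covering of the union splits
   into coverings of [A] and [B] that share no nonempty member. *)
pose G (X : set 'rV[R]_m) k := [set x | F k x /\ (F k `&` X) !=set0].
have GF X k : G X k `<=` F k by move=> x [].
have dG X : hausdorff_delta s d X <= \sum_(k <oo) hgauge s (G X k) \/ ~ X `<=` \bigcup_k F k.
  have [XF|] := pselect (X `<=` \bigcup_k F k); [left|by right].
  apply: hausdorff_delta_le_cover => [k x y /GF Fx /GF Fy|x Xx]; first exact: dF Fx Fy.
  by have [k _ Fkx] := XF _ Xx; exists k => //; split => //; exists x.
have dGA : hausdorff_delta s d A <= \sum_(k <oo) hgauge s (G A k).
  by case: (dG A) => // -[]; apply: subset_trans ABF; exact: subsetUl.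
have dGB : hausdorff_delta s d B <= \sum_(k <oo) hgauge s (G B k).
  by case: (dG B) => // -[]; apply: subset_trans ABF; exact: subsetUr.
rewrite (le_trans (leeD dGA dGB))// -nneseriesD; try by move=> *; exact: hgauge_ge0.
apply: lee_nneseries => [k _ _|k _]; first by rewrite adde_ge0 ?hgauge_ge0.
have [[x [Fx Ax]]|FA] := pselect ((F k `&` A) !=set0).
  rewrite [X in _ + hgauge s X](_ : _ = set0) ?hgauge0 ?adde0 ?subset_hgauge//.
  rewrite -subset0 => z [Fz [y [Fy By]]].
  have := dF k _ _ Fx Fy; rewrite leNgt => /negP; apply.
  by rewrite (lt_le_trans de)// AB.
rewrite [X in hgauge s X + _](_ : _ = set0) ?hgauge0 ?add0e ?subset_hgauge//.
by rewrite -subset0 => z [Fz /FA].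
Qed.

Lemma hausdorff_metric m s (e : R) (A B : set 'rV[R]_m) : (0 < e)%R ->
  (forall x y, A x -> B y -> (e <= enorm (x - y))%R) ->
  hausdorff s A + hausdorff s B <= hausdorff s (A `|` B).
Proof.
move=> e0 AB; set X := hausdorff s (A `|` B).
have dX (d1 d2 : R) : (0 < d1)%R -> (0 < d2)%R ->
    hausdorff_delta s d1 A + hausdorff_delta s d2 B <= X.
  move=> d10 d20; pose d := Num.min (Num.min d1 d2) (e / 2)%R.
  have d0 : (0 < d)%R by rewrite !lt_min d10 d20 divr_gt0.
  have de : (d < e)%R by rewrite /d gt_min; apply/orP; right; rewrite gtr_pMr// invf_lt1// ltr1n.
  rewrite (le_trans _ (hausdorff_delta_le s (A `|` B) d0))//.
  rewrite (le_trans _ (hausdorff_delta_metric s de AB))// leeD//.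
    by apply: hausdorff_delta_anti; rewrite /d !ge_min lexx.
  by apply: hausdorff_delta_anti; rewrite /d !ge_min lexx !orbT.
have [->|Xfin] := eqVneq X +oo; first by rewrite leey.
have X0 : 0 <= X by rewrite /X hausdorff_ge0.
have {}Xfin : X \is a fin_num by rewrite ge0_fin_numE// ltey.
have Afin : hausdorff s A \is a fin_num.
  rewrite ge0_fin_numE ?hausdorff_ge0//; rewrite fin_numE in Xfin.
  by rewrite (@le_lt_trans _ _ X) ?ltey; [|apply: le_hausdorff; exact: subsetUl|case/andP: Xfin].
(* The two suprema are taken one after the other, with independent scales [d1] and [d2], by moving
   the other summand across the inequality; finiteness is used for these subtractions. *)
rewrite addeC -leeBrDr//; apply: hausdorff_le => d2 d20.
rewrite leeBrDr// addeC -leeBrDr; last first.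
  rewrite ge0_fin_numE ?hausdorff_delta_ge0//.
  rewrite (@le_lt_trans _ _ X) ?ltey_eq ?Xfin//.
  by rewrite (le_trans _ (dX d2 d2 d20 d20))// leeDr// hausdorff_delta_ge0.
apply: hausdorff_le => d1 d10; rewrite leeBrDr; first exact: dX.
rewrite ge0_fin_numE ?hausdorff_delta_ge0//.
rewrite (@le_lt_trans _ _ X) ?ltey_eq ?Xfin//.
by rewrite (le_trans _ (dX d2 d2 d20 d20))// leeDr// hausdorff_delta_ge0.
Qed.

End hausdorff_cover.

(** * Caratheodory measurability for metric outer measures *)

Section caratheodory_sublevel.
Variables (R : realType) (m s : nat) (phi : 'rV[R]_m -> R).
Hypothesis phi_lip : forall x y, `|phi x - phi y| <= enorm (x - y).
Local Open Scope ereal_scope.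
Local Notation H := (@hausdorff R m s).

Let sepH (E1 E2 : set 'rV[R]_m) (a b : R) : (a < b)%R ->
  E1 `<=` [set x | (phi x <= a)%R] -> E2 `<=` [set x | (b <= phi x)%R] ->
  H E1 + H E2 <= H (E1 `|` E2).
Proof.
move=> ab E1a E2b; apply: (@hausdorff_metric _ _ _ (b - a)%R); first by rewrite subr_gt0.
move=> x y /E1a xa /E2b yb; rewrite enormBC (le_trans _ (phi_lip _ _))//.
by rewrite (le_trans _ (ler_norm _))// lerB.
Qed.

Let ring_sum (E : set 'rV[R]_m) (lo hi : nat -> R) N :
  (forall j, lo j <= hi j)%R -> (forall j, hi j < lo j.+1)%R ->
  \sum_(j < N) H (E `&` [set x | (lo j < phi x <= hi j)%R]) <= H E.
Proof.
move=> lohi hilo; case: N => [|N]; first by rewrite big_ord0 hausdorff_ge0.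
apply: (@le_trans _ _ (H (E `&` [set x | (phi x <= hi N)%R]))); last first.
  exact: le_hausdorff.
elim: N => [|N ih].
  by rewrite big_ord1; apply: le_hausdorff => x [Ex /andP[]].
rewrite big_ord_recr/= (le_trans (leeD2r _ ih))//.
rewrite (le_trans (sepH (hilo N) _ _))//.
- by move=> x [_ /andP[/ltW]].
- apply: le_hausdorff => x [[Ex xN]|[Ex /andP[]//]]; split => //=.
  by rewrite (le_trans xN)// (le_trans _ (lohi _))// ltW.
Qed.

(** Caratheodory's criterion. The part of [E] where [phi <= r k] is at positive distance from the
    part outside [A], so additivity holds for these two. What is missed of [A] lies in the rings of
    index at least [k]; their measures are summable, with sum at most twice that of [E], so the
    missing part tends to 0. *)
Lemma caratheodory_sublevel (a : R) :
  caratheodory_measurable (hausdorff_om R m s) [set x | (phi x < a)%R].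
Proof.
move=> E; apply/eqP; rewrite eq_le; apply/andP; split.
  exact: (le_outer_measureIC (hausdorff_om R m s)).
set A := [set x | _]; change (H (E `&` A) + H (E `&` ~` A) <= H E).
have [->|HE] := eqVneq (H E) +oo; first by rewrite leey.
have {}HE : H E \is a fin_num by rewrite ge0_fin_numE ?hausdorff_ge0// ltey.
pose r k : R := (a - k.+1%:R^-1)%R.
have ra k : (r k < a)%R by rewrite /r ltrBlDr ltrDl invr_gt0.
have rS k : (r k < r k.+1)%R.
  by rewrite /r ltrD2l ltrN2 ltf_pV2 ?posrE// ltr_nat.
pose Rg k := E `&` [set x | (r k < phi x <= r k.+1)%R].
(* Rings whose indices have the same parity are at positive distance. *)
have Rg2 b n : \sum_(j < n) H (Rg (j.*2 + b)%N) <= H E.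
  apply: (@ring_sum E (fun j => r (j.*2 + b)%N) (fun j => r (j.*2 + b).+1)) => j.
    exact/ltW/rS.
  by rewrite doubleS !addSn rS.
have Rgsum n : \sum_(k < n) H (Rg k) <= H E + H E.
  apply: (@le_trans _ _ (\sum_(k < n.*2) H (Rg k))).
    rewrite -!(big_mkord xpredT (fun k => H (Rg k))).
    apply: (@lee_sum_nneg_natr _ (fun k => H (Rg k)) xpredT 0%N) => [k _ _|].
      exact: hausdorff_ge0.
    by rewrite -addnn leq_addr.
  apply: (@le_trans _ _ (\sum_(j < n) H (Rg (j.*2 + 0)%N) + \sum_(j < n) H (Rg (j.*2 + 1)%N))).
    elim: n => [|n ih]; first by rewrite !big_ord0 adde0.
    rewrite doubleS !big_ord_recr/= addn0 addn1 addeACA -[leLHS]addeA.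
    exact: leeD2r.
  by rewrite leeD.
have tail : \sum_(k <= j <oo) H (Rg j) @[k --> \oo] --> 0.
  apply: nneseries_tail_cvg => [|k _]; last exact: hausdorff_ge0.
  apply: (@le_lt_trans _ _ (H E + H E)); last by rewrite ltey_eq fin_numD HE.
  apply: lime_le; first by apply: is_cvg_nneseries => *; exact: hausdorff_ge0.
  by apply: nearW => n; rewrite big_mkord.
have step k : H (E `&` A) + H (E `&` ~` A) <= H E + \sum_(k <= j <oo) H (Rg j).
  have EA : H (E `&` A) <= H (E `&` [set x | (phi x <= r k)%R]) + \sum_(k <= j <oo) H (Rg j).
    apply: (@le_trans _ _ (H ((E `&` [set x | (phi x <= r k)%R]) `|` \bigcup_(n in ~` `I_k) Rg n))); last first.
      apply: (le_trans (outer_measureU2 (hausdorff_om R m s) _ _)); rewrite leeD2l//.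
      exact: (outer_measure_sigma_subadditive_tail (hausdorff_om R m s)).
    apply: le_hausdorff => x [Ex xa].
    have [xk|kx] := leP (phi x) (r k); [by left|right].
    have [j xj] : exists j, (phi x <= r j)%R.
      have [j /ltW xj] := ltr_add_invr xa.
      by exists j; rewrite /r lerBrDr.
    have [i xi imin] := ex_minnP (ex_intro (fun j => phi x <= r j)%R j xj).
    have ik : (k < i)%N.
      rewrite ltnNge; apply/negP => ik; move: kx; rewrite ltNge => /negP; apply.
      rewrite (le_trans xi)// -(subnKC ik); elim: (k - i)%N => [|l ih]; first by rewrite addn0.
      by rewrite (le_trans ih)// addnS ltW.
    case: i xi imin ik => // i xi imin ik; exists i => /=; first by apply/negP; rewrite -leqNgt.
    by split => //=; rewrite xi andbT ltNge; apply/negP => /imin; rewrite ltnn.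
  rewrite (le_trans (leeD2r _ EA))// addeAC leeD2r//.
  rewrite (le_trans (sepH (ra k) _ _))//.
  - by move=> x [_ /negP]; rewrite -leNgt.
  - by apply: le_hausdorff => x [[]|[]].
have cv : (H E + \sum_(k <= j <oo) H (Rg j)) @[k --> \oo] --> H E + 0.
  by apply: cvgeD => //; [rewrite fin_num_adde_defr|exact: cvg_cst].
rewrite adde0 in cv; rewrite -[leRHS](cvg_lim _ cv)//.
by apply: lime_ge; [apply/cvg_ex; exists (H E)|exact: nearW].
Qed.

End caratheodory_sublevel.

(* The Borel sets of R^m, generated by the half-spaces x_i < a; the measure
   HM m s lives on the larger Caratheodory sigma-algebra. *)
Definition halfspaces (R : realType) m : set (set 'rV[R]_m) :=
  [set A | exists (i : 'I_m) (a : R), A = [set x : 'rV[R]_m | x ord0 i < a]].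
Notation borelV R m := (g_sigma_algebraType (@halfspaces R m)).

Section borel_row_vectors.
Variable R : realType.

Lemma measurable_coord m (i : 'I_m) :
  measurable_fun [set: borelV R m] (fun x : borelV R m => x ord0 i).
Proof.
apply: (measurability _ (RGenInftyO.measurableE R)).
move=> _ [_ [a ->] <-]; rewrite setTI; apply: sub_sigma_algebra.
by exists i, a; apply/seteqP; split => x /=; rewrite in_itv.
Qed.

Lemma measurable_rowP d (T : measurableType d) m (f : T -> 'rV[R]_m) :
  (forall i, measurable_fun setT (fun t => f t ord0 i)) ->
  measurable_fun setT (f : T -> borelV R m).
Proof.
move=> mf; apply: (@measurability _ _ T (borelV R m) setT f (@halfspaces R m) erefl).
move=> _ [_ [i [a ->]] <-]; rewrite setTI.
have := mf i measurableT `]-oo, a[%classic (measurable_itv _); rewrite setTI.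
by congr measurable; apply/seteqP; split => x /=; rewrite in_itv.
Qed.

Lemma measurable_coord_comp d (T : measurableType d) m (f : T -> 'rV[R]_m) i :
  measurable_fun setT (f : T -> borelV R m) -> measurable_fun setT (fun t => f t ord0 i).
Proof. by move=> mf; apply: (measurableT_comp (measurable_coord i) mf). Qed.

Lemma measurable_dotv d (T : measurableType d) m (f g : T -> 'rV[R]_m) :
  measurable_fun setT (f : T -> borelV R m) ->
  measurable_fun setT (g : T -> borelV R m) ->
  measurable_fun setT (fun t => dotv (f t) (g t)).
Proof.
move=> mf mg; apply: measurable_sum => i.
by apply: measurable_funM; exact: measurable_coord_comp.
Qed.

Lemma measurable_enorm d (T : measurableType d) m (f : T -> 'rV[R]_m) :
  measurable_fun setT (f : T -> borelV R m) -> measurable_fun setT (fun t => enorm (f t)).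
Proof.
move=> mf; apply: (@measurableT_comp _ _ _ _ _ _ (@Num.sqrt R)).
  by apply: continuous_measurable_fun; exact: sqrt_continuous.
exact: measurable_dotv.
Qed.

Lemma measurable_rowD d (T : measurableType d) m (f g : T -> 'rV[R]_m) :
  measurable_fun setT (f : T -> borelV R m) ->
  measurable_fun setT (g : T -> borelV R m) ->
  measurable_fun setT ((fun t => f t + g t) : T -> borelV R m).
Proof.
move=> mf mg; apply: measurable_rowP => i.
under eq_fun do rewrite mxE.
by apply: measurable_funD; exact: measurable_coord_comp.
Qed.

Lemma measurable_rowZ d (T : measurableType d) m (a : T -> R) (f : T -> 'rV[R]_m) :
  measurable_fun setT a -> measurable_fun setT (f : T -> borelV R m) ->
  measurable_fun setT ((fun t => a t *: f t) : T -> borelV R m).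
Proof.
move=> ma mf; apply: measurable_rowP => i.
under eq_fun do rewrite mxE.
by apply: measurable_funM => //; exact: measurable_coord_comp.
Qed.

Lemma measurable_rowB d (T : measurableType d) m (f g : T -> 'rV[R]_m) :
  measurable_fun setT (f : T -> borelV R m) ->
  measurable_fun setT (g : T -> borelV R m) ->
  measurable_fun setT ((fun t => f t - g t) : T -> borelV R m).
Proof.
move=> mf mg; apply: measurable_rowD => //.
under eq_fun do rewrite -scaleN1r.
by apply: measurable_rowZ.
Qed.

Lemma measurable_le_fun d (T : measurableType d) (f g : T -> R) :
  measurable_fun setT f -> measurable_fun setT g -> measurable [set t | f t <= g t].
Proof.
move=> mf mg; have := @measurable_fun_ler _ _ _ _ _ _ mf mg measurableT [set true] I.
by rewrite setTI.
Qed.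

Lemma measurable_lt_fun d (T : measurableType d) (f g : T -> R) :
  measurable_fun setT f -> measurable_fun setT g -> measurable [set t | f t < g t].
Proof.
move=> mf mg; have := @measurable_fun_ltr _ _ _ _ _ _ mf mg measurableT [set true] I.
by rewrite setTI.
Qed.

Lemma measurable_eq_fun d (T : measurableType d) (f g : T -> R) :
  measurable_fun setT f -> measurable_fun setT g -> measurable [set t | f t = g t].
Proof.
move=> mf mg.
rewrite (_ : [set t | _] = [set t | f t <= g t] `&` [set t | g t <= f t]).
  by apply: measurableI; exact: measurable_le_fun.
apply/seteqP; split => t /= [].
  by move=> ->; split.
by move=> h1 h2; apply/le_anti/andP.
Qed.

Lemma countable_bigcap_measurable d (T : measurableType d) (I : countType)
    (P : set I) (F : I -> set T) :
  (forall i, P i -> measurable (F i)) -> measurable (\bigcap_(i in P) F i).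
Proof.
move=> mF; rewrite -[X in measurable X]setCK setC_bigcap; apply: measurableC.
rewrite bigcup_mkcond; apply: countable_bigcupT_measurable => // i.
by case: ifPn => // /[!inE] Pi; apply: measurableC; exact: mF.
Qed.

Lemma rat_row_dense m (z : 'rV[R]_m) e :
  0 < e -> exists q : 'rV[rat]_m, enorm (z - map_mx ratr q) < e.
Proof.
(* Dividing by [m.+1] makes the sum of [m] terms strictly smaller than [e], and remains meaningful
   for [m = 0]. *)
move=> e0; pose e' := e / m.+1%:R.
have e'0 : 0 < e' by rewrite divr_gt0.
have q i : exists q : rat, ratr q \in `]z ord0 i - e', z ord0 i + e'[.
  by apply: rat_in_itvoo; rewrite ltrBlDr -addrA ltrDl addr_gt0.
pose Q := \row_i projT1 (cid (q i)); exists Q.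
rewrite (le_lt_trans (enorm_le_sum _))//.
apply: (@le_lt_trans _ _ (\sum_(i < m) e')).
  apply: ler_sum => i _; rewrite !mxE; have := projT2 (cid (q i)).
  rewrite in_itv/= => /andP[h1 h2]; rewrite ler_norml; lra.
rewrite sumr_const card_ord -mulr_natl /e' mulrCA gtr_pMr//.
by rewrite ltr_pdivrMr// mul1r ltr_nat.
Qed.

Lemma caratheodory_borel m s (A : set (borelV R m)) : measurable A ->
  (hausdorff_om R m s).-cara.-measurable A.
Proof.
move=> mA; suff : <<s @halfspaces R m >> `<=` (hausdorff_om R m s).-cara.-measurable by exact.
apply: smallest_sub; first exact: sigma_algebra_measurable.
move=> _ [i [a ->]]; apply: caratheodory_sublevel => x y.
by have := coord_le_enorm (x - y) i; rewrite !mxE.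
Qed.

End borel_row_vectors.

Section borel_hausdorff.
Variables (R : realType) (m s : nat).

(** The same set function as [HM m s], on the Borel sigma-algebra, where pushforwards along Borel
    maps and product measures can be formed. *)
Definition hausB : set (borelV R m) -> \bar R := @hausdorff R m s.

Let hausB0 : hausB set0 = 0%E. Proof. exact: hausdorff0. Qed.

Let hausB_ge0 A : (0 <= hausB A)%E. Proof. exact: hausdorff_ge0. Qed.

Let hausB_sigma_additive : semi_sigma_additive hausB.
Proof.
move=> F mF tF mUF; apply: (@measure_semi_sigma_additive _ _ _ (HM m s) F) => //.
  by move=> i; exact: caratheodory_borel.
exact: caratheodory_borel.
Qed.

HB.instance Definition _ := isMeasure.Build _ _ _ hausB
  hausB0 hausB_ge0 hausB_sigma_additive.

End borel_hausdorff.
Arguments hausB {R} m s.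

(** This includes differences of infinities, since a positive real factor preserves infinite values.
    As a signed integral is the difference of two nonnegative ones, the change of variables formulas
    then need no integrability. *)
Lemma gt0_muleBr (R : realType) (c : R) (x y : \bar R) : 0 < c ->
  (c%:E * (x - y) = c%:E * x - c%:E * y)%E.
Proof.
move=> c0; case: x y => [x||] [y||] //=; rewrite -?EFinM -?EFinB -?EFinN.
all: rewrite ?(gt0_muley,gt0_muleNy) ?lte_fin//=.
by rewrite mulrBr.
Qed.

(** * Change of variables between proportional measures *)

Section transfer.
Context d1 d2 (X : measurableType d1) (Y : measurableType d2) (R : realType).
Variables (phi : X -> Y) (mu : {measure set X -> \bar R}) (nu : {measure set Y -> \bar R}).
Variables (c : R) (D : set Y).
Hypotheses (mphi : measurable_fun [set: X] phi) (mD : measurable D) (c0 : 0 <= c).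
Local Open Scope ereal_scope.
Hypothesis numu : forall A, measurable A -> A `<=` D -> nu A = c%:E * mu (phi @^-1` A).

Lemma ge0_integral_transfer (f : Y -> \bar R) :
  measurable_fun D f -> (forall y, D y -> 0 <= f y) ->
  \int[nu]_(y in D) f y = c%:E * \int[mu]_(x in phi @^-1` D) f (phi x).
Proof.
move=> mf f0.
have f0' : {in D, forall y, 0 <= f y} by move=> x /[!inE]; exact: f0.
have <- := @ge0_integral_pushforward _ _ X Y R phi mphi mu D f mD mf f0'.
rewrite -[c]/((NngNum c0)%:num)%R -ge0_integral_mscale//.
by apply: eq_measure_integral => A mA AD; rewrite numu.
Qed.

Lemma integral_transfer (f : Y -> \bar R) : (0 < c)%R -> measurable_fun D f ->
  \int[nu]_(y in D) f y = c%:E * \int[mu]_(x in phi @^-1` D) f (phi x).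
Proof.
move=> cp mf; rewrite (integralE nu) (integralE mu).
rewrite !ge0_integral_transfer//; try exact: measurable_funepos; try exact: measurable_funeneg.
rewrite [RHS]gt0_muleBr//; congr (_ * _ - _ * _); apply: eq_integral => x _.
  by rewrite !funeposE.
by rewrite !funenegE.
Qed.

End transfer.

Section hausdorff_borel_integral.
Variables (R : realType) (m s : nat).
Local Open Scope ereal_scope.
Local Notation mT := (caratheodory_type (hausdorff_om R m s)).

Lemma measurable_fun_cara (D : set 'rV[R]_m) d (T : measurableType d) (g : 'rV[R]_m -> T) :
  measurable_fun (D : set (borelV R m)) (g : borelV R m -> T) ->
  measurable (D : set (borelV R m)) ->
  measurable_fun (D : set mT) (g : mT -> T).
Proof. by move=> mg mD _ Y mY; apply: caratheodory_borel; exact: mg. Qed.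

Lemma measurable_id_cara : measurable_fun [set: mT] (id : mT -> borelV R m).
Proof. by move=> _ Y mY; rewrite setTI; exact: caratheodory_borel. Qed.

Lemma integral_HM (D : set (borelV R m)) (g : borelV R m -> \bar R) :
  measurable D -> measurable_fun D g ->
  \int[HM m s]_(x in D) g x = \int[hausB m s]_(x in D) g x.
Proof.
move=> mD mg.
have H A : measurable A -> A `<=` D -> hausB m s A = 1%:E * HM m s (id @^-1` A).
  by move=> _ _; rewrite mul1e.
have := @integral_transfer _ _ mT (borelV R m) R id (HM m s) (hausB m s) 1 D
  measurable_id_cara mD ler01 H g ltr01 mg.
by rewrite mul1e => /esym.
Qed.

Lemma integrable_HM (D : set (borelV R m)) (g : borelV R m -> \bar R) :
  measurable D -> measurable_fun D g ->
  (HM m s).-integrable D g <-> (hausB m s).-integrable D g.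
Proof.
move=> mD mg.
have mag : measurable_fun D (fun x => `|g x|) by exact: measurableT_comp.
split=> /integrableP[_ h]; apply/integrableP; split => //.
- by rewrite -integral_HM.
- exact: measurable_fun_cara.
- by rewrite integral_HM.
Qed.

End hausdorff_borel_integral.

(** * Borel regularity and Borel modifications *)

Section borel_regularity.
Variable R : realType.
Local Open Scope ereal_scope.

(* Intersection of the rational closed balls containing C: a Borel superset
   of C with the same diameter. *)
Definition ball_hull m (C : set 'rV[R]_m) : set 'rV[R]_m :=
  \bigcap_(qr in [set qr : 'rV[rat]_m * rat |
      forall c, C c -> (enorm (c - map_mx ratr qr.1) <= ratr qr.2)%R])
    [set x : 'rV[R]_m | (enorm (x - map_mx ratr qr.1) <= ratr qr.2)%R].

Lemma measurable_ball_hull m (C : set 'rV[R]_m) :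
  measurable (ball_hull C : set (borelV R m)).
Proof.
apply: countable_bigcap_measurable => qr _; apply: measurable_le_fun => //.
by apply: measurable_enorm; apply: measurable_rowB => //; exact: measurable_id.
Qed.

Lemma sub_ball_hull m (C : set 'rV[R]_m) : C `<=` ball_hull C.
Proof. by move=> x Cx qr; apply. Qed.

Lemma ball_hull0 m : ball_hull (@set0 'rV[R]_m) = set0.
Proof.
rewrite -subset0 => x /(_ (0, -1)%R) /=.
rewrite rmorphN rmorph1 => h; have := enorm_ge0 (x - map_mx ratr 0).
by rewrite leNgt (le_lt_trans (h _))// ?ltrN10.
Qed.

Lemma ball_hull_le m (C : set 'rV[R]_m) z M x : (forall c, C c -> (enorm (c - z) <= M)%R) ->
  ball_hull C x -> (enorm (x - z) <= M)%R.
Proof.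
move=> CM hx; apply/ler_addgt0Pr => e e0; pose d := (e / 3)%R.
have d0 : (0 < d)%R by rewrite divr_gt0.
have [q qz] := rat_row_dense z d0.
have [r] : exists r : rat, ratr r \in `](M + d)%R, (M + d + d)%R[.
  by apply: rat_in_itvoo; rewrite ltrDl.
rewrite in_itv/= => /andP[r1 r2].
have : (enorm (x - map_mx ratr q) <= ratr r)%R.
  apply: (hx (q, r)) => c Cc /=; rewrite (le_trans (ler_enormB _ z _))//.
  by rewrite (le_trans _ (ltW r1))// lerD ?CM// ltW.
have := ler_enormB x (map_mx ratr q) z; rewrite enormBC in qz.
have : e = (d + d + d)%R by rewrite /d; lra.
by move=> *; lra.
Qed.

Lemma ball_hull_small m (C : set 'rV[R]_m) d : small_set d C -> small_set d (ball_hull C).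
Proof.
move=> dC x y hx hy; rewrite enormBC; apply: ball_hull_le hy => c Cc.
by rewrite enormBC; apply: ball_hull_le hx => c' Cc'; exact: dC.
Qed.

Lemma hgauge_ball_hull m s (C : set 'rV[R]_m) d : small_set d C ->
  hgauge s (ball_hull C) <= hgauge s C.
Proof.
move=> dC; have := @le_hgauge R m m s 1 C (ball_hull C); rewrite expr1n !mul1e; apply => //.
  move=> [x hx]; apply/set0P/eqP => C0; rewrite C0 ball_hull0 in hx.
  exact: hx.
have [->|/set0P[c0 Cc0]] := eqVneq C set0; first by rewrite ball_hull0.
have : ediam C \is a fin_num.
  rewrite ge0_fin_numE ?(ediam_ge0 Cc0)// (@le_lt_trans _ _ d%:E) ?ltry//.
  by apply: ediam_le => x y Cx Cy; rewrite lee_fin dC.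
move=> fC; apply: ediam_le => x y hx hy; rewrite -(fineK fC) lee_fin.
apply: (@ball_hull_small _ C) => // u v Cu Cv.
by rewrite -lee_fin (fineK fC) ediam_ub.
Qed.

Lemma hausdorff_delta_approx m s d (A : set 'rV[R]_m) (e : R) :
  (0 < d)%R -> (0 < e)%R -> hausdorff s A \is a fin_num ->
  exists B, [/\ measurable (B : set (borelV R m)), A `<=` B &
    hausdorff_delta s d B <= hausdorff s A + e%:E].
Proof.
move=> d0 e0 Afin; have hd : hausdorff_delta s d A \is a fin_num.
  rewrite ge0_fin_numE ?hausdorff_delta_ge0// (le_lt_trans (hausdorff_delta_le s A d0))//.
  by rewrite ltey_eq Afin.
have [_ [F [dF AF] <-] Fe] := lb_ereal_inf_adherent e0 hd.
exists (\bigcup_k ball_hull (F k)); split.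
- by apply: bigcup_measurable => k _; exact: measurable_ball_hull.
- by apply: (subset_trans AF) => x [k _ Fx]; exists k => //; exact: sub_ball_hull.
apply: (@le_trans _ _ (\sum_(k <oo) hgauge s (F k))).
  apply: (@le_trans _ _ (\sum_(k <oo) hgauge s (ball_hull (F k)))).
    by apply: hausdorff_delta_le_cover => // k; apply: ball_hull_small; exact: dF.
  apply: lee_nneseries => [k _ _|k _]; first exact: hgauge_ge0.
  by apply: hgauge_ball_hull; exact: dF.
by rewrite (le_trans (ltW Fe))// leeD2r// hausdorff_delta_le.
Qed.

(** Replacing the members of a covering by their [ball_hull] makes the union Borel without raising
    the gauges. Near-optimal coverings at the scales 1/(k+1) give Borel supersets, and their
    intersection has the right measure at every scale. *)
Lemma borel_hull m s (A : set 'rV[R]_m) : exists B,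
  [/\ measurable (B : set (borelV R m)), A `<=` B & hausdorff s B = hausdorff s A].
Proof.
suff [B [mB AB BA]] : exists B, [/\ measurable (B : set (borelV R m)), A `<=` B &
    hausdorff s B <= hausdorff s A].
  by exists B; split => //; apply/le_anti; rewrite BA le_hausdorff.
have [Afin|] := boolP (hausdorff s A \is a fin_num); last first.
  rewrite ge0_fin_numE ?hausdorff_ge0// -leNgt leye_eq => /eqP ->.
  by exists setT; split => //; rewrite leey.
have k0 k : (0 < k.+1%:R^-1 :> R)%R by rewrite invr_gt0.
have h k := @hausdorff_delta_approx m s _ A _ (k0 k) (k0 k) Afin.
pose B k := projT1 (cid (h k)).
have BP k := projT2 (cid (h k)).
exists (\bigcap_k B k); split.
- by apply: bigcapT_measurable => k; case: (BP k).
- by move=> x Ax k _; have [_ + _] := BP k; apply.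
apply: hausdorff_le => d d0; apply/lee_addgt0Pr => e e0.
have [k kd] : exists k, (k.+1%:R^-1 < Num.min d e)%R.
  have [] := @ltr_add_invr R 0 (Num.min d e); first by rewrite lt_min d0.
  by move=> k; rewrite add0r; exists k.
move: kd; rewrite lt_min => /andP[kd ke].
apply: (@le_trans _ _ (hausdorff_delta s k.+1%:R^-1 (B k))).
  apply: (le_trans (hausdorff_delta_anti _ _ (ltW kd))).
  by apply: hausdorff_delta_subset; exact: bigcap_inf.
have [_ _ /le_trans] := BP k; apply; rewrite leeD2l// lee_fin; exact: ltW.
Qed.

End borel_regularity.

Section borel_modification.
Variables (R : realType) (m s : nat).
Local Open Scope ereal_scope.
Local Notation mT := (caratheodory_type (hausdorff_om R m s)).

Lemma hausdorff_setD_null (A B : set 'rV[R]_m) : measurable (A : set mT) ->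
  measurable (B : set mT) -> A `<=` B -> hausdorff s A \is a fin_num ->
  hausdorff s B = hausdorff s A -> hausdorff s (B `\` A) = 0.
Proof.
move=> mA mB AB fA BA.
have h : HM m s (B `\` A) = HM m s B - HM m s (B `&` A).
  by apply: measureD => //; rewrite /HM/= BA ltey_eq fA.
have : hausdorff s (B `\` A) = hausdorff s B - hausdorff s (B `&` A) by exact: h.
by rewrite (setIidr AB) BA subee.
Qed.

(* Borel hulls of the superlevel sets at rational levels define F. *)
Let level_hull (D : set 'rV[R]_m) (f : 'rV[R]_m -> R) (q : R) :
  measurable (D : set mT) -> (forall x, D x -> 0 <= f x)%R ->
  (HM m s).-integrable (D : set mT) (EFin \o f) -> (0 < q)%R ->
  exists B, [/\ measurable (B : set (borelV R m)),
    D `&` [set x | (q <= f x)%R] `<=` B &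
    hausdorff s (B `\` (D `&` [set x | (q <= f x)%R])) = 0].
Proof.
move=> mD f0 intf q0; set A := D `&` _.
have [B [mB AB BA]] := borel_hull s A.
exists B; split => //.
have mf := measurable_int _ intf.
have mA : measurable (A : set mT).
  rewrite /A (_ : [set x | _] = [set x | q%:E <= (EFin \o f) x]).
    exact: emeasurable_fun_c_infty.
  by apply/seteqP; split => x /=; rewrite lee_fin.
(* Markov's inequality. Without finiteness, equality of the measures of [A] and its hull would not
   make the excess null. *)
have fA : hausdorff s A \is a fin_num.
  rewrite ge0_fin_numE ?hausdorff_ge0//.
  have /integrableP[_] := intf => /(le_lt_trans _) h.
  have : q%:E * HM m s A < +oo.
    apply: h; rewrite -[X in X * _]/(id q%:E).
    rewrite (_ : A = D `&` [set x | q%:E <= `|(EFin \o f) x|]); last first.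
      apply/seteqP; split => x [Dx] /=; rewrite lee_fin ger0_norm ?f0//.
    by apply: (@le_integral_comp_abse _ mT R (HM m s) D mD (EFin \o f) q id).
  have := hausdorff_ge0 s A; rewrite /HM/=; case: hausdorff => [r|//|//] _; rewrite ?ltry//.
  by rewrite gt0_muley ?lte_fin// ltxx.
apply: hausdorff_setD_null => //; exact: caratheodory_borel.
Qed.

(** A nonnegative function is the supremum of the positive rational levels below it. Replacing the
    superlevel sets by Borel hulls makes this supremum Borel, and changes it only on the countable
    union [N] of the excesses. *)
Let ge0_borel_modification (D : set 'rV[R]_m) (f : 'rV[R]_m -> R) :
  measurable (D : set mT) -> (forall x, D x -> 0 <= f x)%R ->
  (HM m s).-integrable (D : set mT) (EFin \o f) ->
  exists (F : 'rV[R]_m -> R) N, [/\ measurable_fun setT (F : borelV R m -> R),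
    hausdorff s N = 0 & forall x, D x -> ~ N x -> F x = f x].
Proof.
move=> mD f0 intf.
(* An index that encodes no rational gets level 0. Levels that are not positive contribute the value
   0 to the supremum, which settles the points where [f] vanishes. *)
pose q k : R := ratr (odflt 0%R (unpickle k : option rat)).
pose A k := D `&` [set x | (q k <= f x)%R].
have hB k : exists B, (0 < q k)%R -> [/\ measurable (B : set (borelV R m)), A k `<=` B &
    hausdorff s (B `\` A k) = 0].
  have [qk|] := ltP 0%R (q k); last by exists set0.
  by have [B hB] := level_hull mD f0 intf qk; exists B.
pose B k := projT1 (cid (hB k)).
have BP k := projT2 (cid (hB k)).
pose h k x := if (0 < q k)%R then (q k * \1_(B k) x)%:E else 0.
pose N := \bigcup_k (if (0 < q k)%R then B k `\` A k else set0).
have mh k : measurable_fun setT (h k : borelV R m -> \bar R).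
  have [qk|qk] := boolP (0 < q k)%R; last by rewrite /h (negbTE qk).
  rewrite /h qk; apply/measurable_EFinP.
  apply: measurable_funM => //; apply: measurable_indic; by case: (BP k qk).
exists (fun x => fine (ereal_sup (range (h ^~ x)))), N; split.
- apply: measurableT_comp => //.
  have := @measurable_fun_esups _ _ _ _ _ mh 0%N.
  apply: eq_measurable_fun => x _; congr ereal_sup.
  by apply/seteqP; split => _ [k _ <-]; exists k.
- apply/eqP; rewrite eq_le hausdorff_ge0 andbT.
  apply: le_trans; first exact: (@hausdorff_sigma_subadditive R m s).
  rewrite eseries0// => k _ _.
  by case: ifPn => [qk|_]; [case: (BP k qk)|exact: hausdorff0].
move=> x Dx Nx.
rewrite (_ : ereal_sup _ = (f x)%:E)//; apply/le_anti/andP; split.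
  apply: ge_ereal_sup => _ [k _ <-]; rewrite /h; case: ifPn => [qk|_]; last first.
    by rewrite lee_fin f0.
  rewrite lee_fin indicE; have [/set_mem Bx|] := boolP (x \in B k); last first.
    by rewrite mulr0 f0.
  rewrite mulr1; apply: contrapT => qf; apply: Nx; exists k => //.
  by rewrite qk; split => // -[].
have hk k : (0 < q k)%R -> (q k <= f x)%R -> (q k)%:E <= ereal_sup (range (h ^~ x)).
  move=> qk kf; apply: ereal_sup_ubound; exists k => //; rewrite /h qk indicE mem_set ?mulr1//.
  by have [_ + _] := BP k qk; apply.
have [f0'|fx0] := eqVneq (f x) 0%R.
  apply: (@le_trans _ _ (h (pickle (0%R : rat)) x)); last by apply: ereal_sup_ubound; eexists.
  by rewrite /h /q pickleK/= rmorph0 ltxx f0'.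
have {}fx0 : (0 < f x)%R by rewrite lt_def fx0 f0.
apply/lee_subgt0Pr => e e0.
have [r] : exists r : rat, ratr r \in `](Num.max 0 (f x - e))%R, (f x)[.
  by apply: rat_in_itvoo; rewrite gt_max fx0 ltrBlDr ltrDl.
rewrite in_itv/= gt_max => /andP[/andP[r0 r1] r2].
have qr : q (pickle r) = ratr r by rewrite /q pickleK.
apply: (@le_trans _ _ (ratr r)%:E); first by rewrite -EFinB lee_fin ltW.
by rewrite -qr; apply: hk; rewrite qr// ltW.
Qed.

Lemma funrneg_ge0_pointwise (T : Type) (g : T -> R) x : (0 <= g^\-%R x)%R.
Proof. by rewrite -funrposN funrpos_ge0. Qed.

Lemma borel_modification (D : set 'rV[R]_m) (f : 'rV[R]_m -> R) :
  measurable (D : set mT) -> (HM m s).-integrable (D : set mT) (EFin \o f) ->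
  exists (F : 'rV[R]_m -> R) N, [/\ measurable_fun setT (F : borelV R m -> R),
    measurable (N : set (borelV R m)), hausdorff s N = 0 &
    forall x, D x -> ~ N x -> F x = f x].
Proof.
move=> mD intf.
have intp : (HM m s).-integrable (D : set mT) (EFin \o f^\+%R).
  exact: (@integrable_funrpos _ mT).
have intn : (HM m s).-integrable (D : set mT) (EFin \o f^\-%R).
  rewrite -funrposN; apply: (@integrable_funrpos _ mT) => //.
  rewrite (_ : EFin \o _ = (\- (EFin \o f))%E); last exact/funext.
  exact: (@integrableN _ mT).
have [F1 [N1 [mF1 N10 F1f]]] := ge0_borel_modification mD (fun x _ => funrpos_ge0 f x) intp.
have [F2 [N2 [mF2 N20 F2f]]] := ge0_borel_modification mD (fun x _ => funrneg_ge0_pointwise f x) intn.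
have [N [mN NN N0]] := borel_hull s (N1 `|` N2).
exists (F1 \- F2)%R, N; split => //.
- exact: measurable_funB.
- rewrite N0; apply/eqP; rewrite eq_le hausdorff_ge0 andbT.
  by rewrite (le_trans (outer_measureU2 (hausdorff_om R m s) _ _))// /= N10 N20 adde0.
move=> x Dx Nx; rewrite /= F1f//; last by move=> N1x; apply: Nx; apply: NN; left.
rewrite F2f//; last by move=> N2x; apply: Nx; apply: NN; right.
by rewrite -[in RHS](funrposBneg f).
Qed.

End borel_modification.

(** * Lebesgue measure and slicing *)

Section cube_volume.
Variable R : realType.
Local Open Scope ereal_scope.

Lemma ball_vol_gt0 k : (0 < ball_vol R k)%R.
Proof.
suff H : (0 < ball_vol R k)%R /\ (0 < ball_vol R k.+1)%R by case: H.
elim: k => [|j [IH1 IH2]]; first by split; rewrite /= ?ltr01 ?ltr0n.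
split=> //=; apply: mulr_gt0 => //.
by apply: divr_gt0; [apply: mulr_gt0 => //; exact: pi_gt0|].
Qed.

Lemma hgauge_le m s (C : set 'rV[R]_m) r : (0 <= r)%R ->
  (forall x y, C x -> C y -> (enorm (x - y) <= r)%R) ->
  hgauge s C <= (ball_vol R s * (r / 2) ^+ s)%:E.
Proof.
move=> r0 Cr; have [->|/set0P[x Cx]] := eqVneq C set0.
  by rewrite hgauge0 lee_fin mulr_ge0 ?ball_vol_ge0// exprn_ge0// divr_ge0.
rewrite (hgauge_neq0 _ Cx) EFinM lee_wpmul2l ?lee_fin ?ball_vol_ge0// EFin_expe EFinM.
apply: lee_expe2; first by rewrite mule_ge0 ?lee_fin// (ediam_ge0 Cx).
by rewrite lee_wpmul2r ?lee_fin//; apply: ediam_le => u v Cu Cv; rewrite lee_fin Cr.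
Qed.

Lemma hausdorff_delta_le_fin (I : finType) m s d (A : set 'rV[R]_m) (F : I -> set 'rV[R]_m) :
  (forall i, small_set d (F i)) -> A `<=` \bigcup_i F i ->
  hausdorff_delta s d A <= \sum_i hgauge s (F i).
Proof.
move=> dF AF; pose G k := nth set0 (map F (enum I)) k.
have dG k : small_set d (G k).
  rewrite /G; have [kI|kI] := ltnP k (size (enum I)); last first.
    by move=> x y; rewrite nth_default; [case|rewrite size_map].
  case E : (enum I) kI => [//|i0 l] kI; rewrite -E in kI *.
  by rewrite (nth_map i0).
apply: (@le_trans _ _ (\sum_(k <oo) hgauge s (G k))).
  apply: hausdorff_delta_le_cover dG _ => x /AF[i _ Fi].
  exists (index i (enum I)) => //.
  by rewrite /G (nth_map i) ?nth_index ?index_mem ?mem_enum.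
rewrite (nneseries_split 0%N (size (enum I))) => [|k _]; last exact: hgauge_ge0.
rewrite add0n [X in _ + X]eseries0 => [|k kI _]; last first.
  by rewrite /G nth_default ?hgauge0// size_map.
rewrite adde0 -(size_map F) -(big_nth set0 xpredT (hgauge s)) big_map.
by rewrite big_enum.
Qed.

Definition cube m (r : R) : set 'rV[R]_m := [set x | forall i, (`|x ord0 i| <= r)%R].

Definition unit_cube m : set 'rV[R]_m := [set x | forall i, (0 <= x ord0 i <= 1)%R].

(** The cube is cut into (k+1)^m cubes of side 1/(k+1), whose diameters are crudely at most m/(k+1):
    the resulting bound on the total gauge does not depend on [k]. *)
Lemma hausdorff_unit_cube_lty m : hausdorff m (@unit_cube m) < +oo.
Proof.
apply: (@le_lt_trans _ _ (ball_vol R m * (m%:R / 2) ^+ m)%:E); last exact: ltry.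
apply: hausdorff_le => d d0.
have [k kd] : exists k, (m%:R / k.+1%:R < d :> R)%R.
  exists (Num.truncn (m%:R / d)); rewrite ltr_pdivrMr// -ltr_pdivrMl//.
  rewrite mulrC; have /truncn_itv/andP[] // : (0 <= m%:R / d)%R.
  by rewrite divr_ge0// ltW.
pose C (v : {ffun 'I_m -> 'I_k.+1}) := [set x : 'rV[R]_m |
   forall i, ((v i)%:R / k.+1%:R <= x ord0 i <= (v i).+1%:R / k.+1%:R)%R].
have Cd v x y : C v x -> C v y -> (enorm (x - y) <= m%:R / k.+1%:R)%R.
  move=> Cx Cy; rewrite (le_trans (enorm_le_sum _))//.
  apply: (@le_trans _ _ (\sum_(i < m) k.+1%:R^-1)%R); last first.
    by rewrite sumr_const card_ord mulr_natl.
  apply: ler_sum => i _; rewrite !mxE; have /andP[] := Cx i; have /andP[] := Cy i.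
  have e : ((v i).+1%:R = (v i)%:R + 1 :> R)%R by rewrite natr1.
  have aux (a c u w : R) : (a <= u -> u <= a + c -> a <= w -> w <= a + c -> `|u - w| <= c)%R.
    by rewrite ler_norml; lra.
  rewrite e mulrDl mul1r => h1 h2 h3 h4; exact: (aux _ _ _ _ h3 h4 h1 h2).
rewrite (@le_trans _ _ (\sum_v hgauge m (C v)))//.
  apply: hausdorff_delta_le_fin => [v x y Cx Cy|x Qx].
    by rewrite (le_trans (Cd _ _ _ Cx Cy))// ltW.
  have h i : exists j : 'I_k.+1, (j%:R / k.+1%:R <= x ord0 i <= j.+1%:R / k.+1%:R)%R.
    have /andP[x0 x1] := Qx i.
    have xk0 : (0 <= x ord0 i * k.+1%:R)%R by rewrite mulr_ge0.
    have /andP[t1 t2] := truncn_itv xk0.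
    have [tk|tk] := ltnP (Num.truncn (x ord0 i * k.+1%:R)) k.+1.
      by exists (Ordinal tk); rewrite /= ler_pdivrMr// ler_pdivlMr// t1 ltW.
    (* The integer part exceeds [k] only at the right end point, which belongs to the last cell. *)
    have x1' : x ord0 i = 1%R.
      apply/le_anti; rewrite x1/= -(@ler_pM2r _ k.+1%:R)// mul1r.
      by rewrite (le_trans _ t1)// ler_nat.
    exists ord_max; rewrite x1' /= ler_pdivrMr// mul1r divff ?lexx ?andbT//.
    by rewrite ler_nat.
  by exists [ffun i => projT1 (cid (h i))] => // i; rewrite ffunE; exact: projT2 (cid (h i)).
apply: (@le_trans _ _ (\sum_(v : {ffun 'I_m -> 'I_k.+1})
    (ball_vol R m * (m%:R / k.+1%:R / 2) ^+ m)%:E)).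
  by apply: lee_sum => v _; apply: hgauge_le (Cd v); rewrite divr_ge0.
rewrite sumEFin sumr_const card_ffun !card_ord lee_fin -[leLHS]mulr_natl natrX mulrCA.
rewrite ler_wpM2l ?ball_vol_ge0// -exprMn.
by rewrite mulrA mulrCA divff// mulr1.
Qed.

Lemma hausdorff_image_scale m (a : R) (v : 'rV[R]_m) (A : set 'rV[R]_m) : (0 < a)%R ->
  hausdorff m [set (a *: x + v)%R | x in A] <= (a ^+ m)%:E * hausdorff m A.
Proof.
move=> a0; apply: hausdorff_lipschitz => // x y _ _.
by rewrite opprD addrACA subrr addr0 -scalerBr enormZ gtr0_norm.
Qed.

Lemma hausdorff_cube_le m (r : R) : (0 < r)%R ->
  hausdorff m (@cube m r) <= ((2 * r) ^+ m)%:E * hausdorff m (@unit_cube m).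
Proof.
move=> r0; have r20 : (0 < 2 * r)%R by rewrite mulr_gt0.
apply: le_trans (hausdorff_image_scale (const_mx (- r)%R) _ r20).
apply: le_hausdorff => x Cx; exists ((2 * r)^-1 *: (x + const_mx r))%R.
  move=> i; rewrite !mxE mulrC; have := Cx i; rewrite ler_norml => /andP[h1 h2].
  apply/andP; split; first by apply: divr_ge0; lra.
  by rewrite ler_pdivrMr//; lra.
rewrite scalerA divff ?gt_eqF// scale1r -addrA -[RHS]addr0; congr (_ + _)%R.
by apply/rowP => i; rewrite !mxE subrr.
Qed.

Lemma hausdorff_translate m s (v : 'rV[R]_m) (A : set 'rV[R]_m) :
  hausdorff s [set (x + v)%R | x in A] = hausdorff s A.
Proof.
have h u (B : set 'rV[R]_m) : hausdorff s [set (x + u)%R | x in B] <= hausdorff s B.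
  have := @hausdorff_lipschitz R m m s 1 (fun x => x + u)%R B ltr01.
  rewrite expr1n mul1e; apply => x y _ _.
  by rewrite opprD addrACA subrr addr0 mul1r.
apply/le_anti; rewrite h/=; apply: le_trans (h (- v)%R _).
by apply: le_hausdorff => x Ax; exists (x + v)%R; [exists x|rewrite addrK].
Qed.

End cube_volume.

Section volume.
Variable R : realType.
Local Open Scope ereal_scope.

Definition vol m : set (borelV R m) -> \bar R := hausB m m.

HB.instance Definition _ m := Measure.on (@vol m).

Lemma measurable_cube m r : measurable (@cube R m r : set (borelV R m)).
Proof.
rewrite (_ : cube _ = \bigcap_(i in @setT 'I_m) [set x : 'rV[R]_m | (`|x ord0 i| <= r)%R]).
  apply: countable_bigcap_measurable => i _; apply: measurable_le_fun => //.
  by apply: measurableT_comp => //; exact: measurable_coord.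
by apply/seteqP; split => [x Cx i _|x Cx i]; [exact: Cx|exact: (Cx i)].
Qed.

Lemma measurable_unit_cube m : measurable (@unit_cube R m : set (borelV R m)).
Proof.
rewrite (_ : @unit_cube R m = \bigcap_(i in @setT 'I_m)
  ([set x : 'rV[R]_m | (0 <= x ord0 i)%R] `&` [set x : 'rV[R]_m | (x ord0 i <= 1)%R])).
  apply: countable_bigcap_measurable => i _; apply: measurableI; apply: measurable_le_fun => //;
  exact: measurable_coord.
apply/seteqP; split => [x Cx i _|x Cx i]; first by have /andP[] := Cx i.
by have [] := Cx i I => /= -> ->.
Qed.

Lemma vol_cube_lty m r : vol (@cube R m r) < +oo.
Proof.
apply: (@le_lt_trans _ _ (hausdorff m (@cube R m (Num.max r 1%R)))).
  by apply: le_hausdorff => x Cx i; rewrite le_max Cx.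
apply: (le_lt_trans (@hausdorff_cube_le R m (Num.max r 1%R) _)).
  by rewrite lt_max ltr01 orbT.
have := hausdorff_unit_cube_lty R m; have := hausdorff_ge0 m (@unit_cube R m).
by case: hausdorff => // x _ _; rewrite -EFinM ltry.
Qed.

Lemma bigcup_cube m : \bigcup_k @cube R m k%:R = setT.
Proof.
rewrite -subTset => x _; exists (Num.truncn (enorm x)).+1 => // i.
rewrite (le_trans (coord_le_enorm _ _))//.
by have /truncn_itv/andP[_ /ltW] := enorm_ge0 x.
Qed.

Let vol_sigma_finite m : sigma_finite setT (@vol m).
Proof.
exists (fun k => @cube R m k%:R); first by rewrite bigcup_cube.
by move=> k; split; [exact: measurable_cube|exact: vol_cube_lty].
Qed.

HB.instance Definition _ m := @Measure_isSigmaFinite.Build _ _ _ (@vol m) (@vol_sigma_finite m).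

Lemma preimage_image_translate m (v : 'rV[R]_m) (A : set 'rV[R]_m) :
  (fun x => x + v)%R @^-1` A = [set (x - v)%R | x in A].
Proof.
by apply/seteqP; split => [x Ax|_ [x Ax <-]]; [exists (x + v)%R => //; rewrite addrK|rewrite /= subrK].
Qed.

Lemma vol_translate m (v : 'rV[R]_m) (A : set (borelV R m)) :
  vol ((fun x => x + v)%R @^-1` A) = vol A.
Proof. by rewrite preimage_image_translate; exact: hausdorff_translate. Qed.

Lemma lebesgue_translate (v : R) (A : set R) : measurable A ->
  lebesgue_measure ((fun x => x + v)%R @^-1` A) = lebesgue_measure A.
Proof.
move=> mA; have mf : measurable_fun setT (fun x : R => (x + v)%R) by exact: measurable_funD.
have := @lebesgue_measure_unique R (pushforward lebesgue_measure
  ((fun x : R => (x + v)%R) : measurableTypeR R -> measurableTypeR R)).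
move=> /(_ mf _ A mA) -> // _ [[a b] _ <-]; rewrite /pushforward.
rewrite [X in _ = lebesgue_measure X](_ : _ = `](a - v)%R, (b - v)%R]%classic).
  rewrite !lebesgue_measure_itv/= !lte_fin ltrD2r; case: ifPn => // _.
  by rewrite -!EFinB opprB addrA subrK.
by apply/seteqP; split => x /=; rewrite !in_itv/= ltrBlDr lerBrDr.
Qed.

Lemma tonelli_set d1 d2 (T1 : measurableType d1) (T2 : measurableType d2)
    (mu : {sigma_finite_measure set T1 -> \bar R})
    (nu : {sigma_finite_measure set T2 -> \bar R}) (E : set (T1 * T2)) :
  measurable E ->
  \int[mu]_x nu [set y | E (x, y)] = \int[nu]_y mu [set x | E (x, y)].
Proof.
move=> mE.
have mE1 x : measurable [set y | E (x, y)].
  by rewrite -[X in measurable X]setTI; exact: (measurable_fun_pair2 x (@measurable_id _ _ _)).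
have mE2 y : measurable [set x | E (x, y)].
  by rewrite -[X in measurable X]setTI; exact: (measurable_fun_pair1 y (@measurable_id _ _ _)).
have := @fubini_tonelli _ _ T1 T2 R mu nu (EFin \o \1_E).
have mf : measurable_fun setT (EFin \o \1_E : T1 * T2 -> \bar R).
  by apply/measurable_EFinP; exact: measurable_indic.
move=> /(_ mf (fun _ => ltac:(by rewrite lee_fin))).
under eq_integral => x _.
  rewrite (_ : (fun y => _) = (fun y => (\1_[set y | E (x, y)] y)%:E)); last first.
    by apply/funext => y; rewrite /= !indicE; congr ((_ : bool)%:R%:E); apply/asboolP/asboolP.
  rewrite integral_indic// setIT; over.
move=> ->; apply: eq_integral => y _.
rewrite (_ : (fun x => _) = (fun x => (\1_[set x | E (x, y)] x)%:E)); last first.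
  by apply/funext => x; rewrite /= !indicE.
by rewrite integral_indic// setIT.
Qed.

(* Both sides are the integral of 1_A(x) 1_B(x + y) dmu(x) dnu(y), integrated
   in the two possible orders. *)
Lemma haar_exchange m (mu nu : {sigma_finite_measure set (borelV R m) -> \bar R})
    (A B : set (borelV R m)) :
  (forall (v : 'rV[R]_m) (C : set (borelV R m)), measurable C ->
     mu ((fun x : 'rV[R]_m => x + v)%R @^-1` C) = mu C) ->
  (forall (v : 'rV[R]_m) (C : set (borelV R m)), measurable C ->
     nu ((fun x : 'rV[R]_m => x + v)%R @^-1` C) = nu C) ->
  measurable A -> measurable B ->
  nu B * mu A = nu ((fun x : 'rV[R]_m => - x)%R @^-1` A) * mu B.
Proof.
move=> tmu tnu mA mB.
have mD : measurable_fun [set: borelV R m * borelV R m]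
    (fun p => (p.1 + p.2)%R : borelV R m).
  by apply: measurable_rowD; [exact: measurable_fst|exact: measurable_snd].
have mS : measurable_fun [set: borelV R m * borelV R m]
    (fun p => (p.1 - p.2)%R : borelV R m).
  by apply: measurable_rowB; [exact: measurable_fst|exact: measurable_snd].
have mN : measurable_fun [set: borelV R m] (fun x => (- x)%R : borelV R m).
  have := @measurable_rowB R _ (borelV R m) m (fun=> 0%R) id (measurable_cst _) (@measurable_id _ _ _).
  by under eq_fun do rewrite sub0r.
have mT v : measurable_fun [set: borelV R m] (fun x => (x + v)%R : borelV R m).
  by apply: measurable_rowD => //; exact: measurable_id.
have mpre d (T : measurableType d) d' (T' : measurableType d') (g : T -> T') (C : set T') :
   measurable_fun setT g -> measurable C -> measurable (g @^-1` C).
  by move=> mg mC; rewrite -[X in measurable X]setTI; exact: mg.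
have intc (rho : {measure set (borelV R m) -> \bar R}) (C : set (borelV R m)) c : measurable C ->
    \int[rho]_x (if x \in C then c else 0) = c * rho C.
  by move=> mC; rewrite -integral_mkcond integral_cst.
pose E1 := [set p : borelV R m * borelV R m | A p.1 /\ B (p.1 + p.2)%R].
pose E2 := [set p : borelV R m * borelV R m | A (p.1 - p.2)%R /\ B p.1].
have mE1 : measurable E1.
  have h1 := mpre _ _ _ _ _ _ (@measurable_fst _ _ (borelV R m) (borelV R m)) mA.
  exact: (measurableI _ _ h1 (mpre _ _ _ _ _ _ mD mB)).
have mE2 : measurable E2.
  have h1 := mpre _ _ _ _ _ _ (@measurable_fst _ _ (borelV R m) (borelV R m)) mB.
  exact: (measurableI _ _ (mpre _ _ _ _ _ _ mS mA) h1).
have <- : \int[mu]_x nu [set y | E1 (x, y)] = nu B * mu A.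
  rewrite -intc//; apply: eq_integral => x _; case: ifPn => [/set_mem Ax|/negP xA].
    rewrite -(tnu x B mB); congr (nu _); apply/seteqP; split => y /=.
      by rewrite /E1/= addrC => -[].
    by rewrite /E1/= addrC.
  rewrite [X in nu X](_ : _ = set0) ?measure0//.
  by rewrite -subset0 => y [] /= /mem_set.
have <- : \int[mu]_x nu [set y | E2 (x, y)] = nu ((fun x : 'rV[R]_m => - x)%R @^-1` A) * mu B.
  rewrite -intc//; apply: eq_integral => x _; case: ifPn => [/set_mem Bx|/negP xB].
    rewrite -[RHS](tnu (- x)%R)//; last exact: (mpre _ _ _ _ _ _ mN mA).
    congr (nu _); apply/seteqP; split => y /=.
      by rewrite /E2/= opprB => -[].
    by rewrite /E2/= opprB.
  rewrite [X in nu X](_ : _ = set0) ?measure0//.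
  by rewrite -subset0 => y [] /= _ /mem_set.
(* In the other order of integration, the sections of [E1] and [E2] at [y] are translates of each
   other by [y], so [mu] gives them the same mass. *)
rewrite !tonelli_set//; apply: eq_integral => y _.
rewrite -(tmu y [set x | E2 (x, y)]).
  by congr (mu _); apply/seteqP; split => x; rewrite /E1 /E2/= addrK.
exact: (measurableI _ _ (mpre _ _ _ _ _ _ (mT (- y)%R) mA) mB).
Qed.

End volume.

(** * The product of Lebesgue measure and Hausdorff volume *)

Section row_cons.
Variable R : realType.

Definition consv k (t : R) (y : 'rV[R]_k) : 'rV[R]_(1 + k) := row_mx (const_mx t) y.

Lemma consv0E k t (y : 'rV[R]_k) : consv t y ord0 (lshift k ord0) = t.
Proof. by rewrite /consv row_mxEl mxE. Qed.

Lemma consvSE k t (y : 'rV[R]_k) i : consv t y ord0 (rshift 1 i) = y ord0 i.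
Proof. by rewrite /consv row_mxEr. Qed.

Lemma consv_eta k (x : 'rV[R]_(1 + k)) : consv (x ord0 (lshift k ord0)) (rsubmx x) = x.
Proof.
rewrite -[RHS](hsubmxK x); congr row_mx; apply/rowP => i.
by rewrite !mxE (ord1 i).
Qed.

Lemma dotv_consv k t t' (y y' : 'rV[R]_k) :
  dotv (consv t y) (consv t' y') = t * t' + dotv y y'.
Proof.
rewrite /dotv big_split_ord/= big_ord1; congr (_ + _).
  by rewrite /consv !row_mxEl !mxE.
by apply: eq_bigr => i _; rewrite !consvSE.
Qed.

Lemma consvD k t t' (y y' : 'rV[R]_k) : consv t y + consv t' y' = consv (t + t') (y + y').
Proof. by rewrite /consv add_row_mx; congr row_mx; apply/rowP => i; rewrite !mxE. Qed.

Lemma consvZ k a t (y : 'rV[R]_k) : a *: consv t y = consv (a * t) (a *: y).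
Proof. by rewrite /consv scale_row_mx; congr row_mx; apply/rowP => i; rewrite !mxE. Qed.

Lemma measurable_consv k :
  measurable_fun [set: measurableTypeR R * borelV R k]
    ((fun p => consv p.1 p.2) : _ -> borelV R (1 + k)).
Proof.
apply: measurable_rowP => i; case: (split_ordP i) => j ->.
  under eq_fun do rewrite /consv row_mxEl mxE.
  exact: measurable_fst.
under eq_fun do rewrite consvSE.
by apply: measurable_coord_comp; exact: measurable_snd.
Qed.

End row_cons.

Section product_volume.
Variable R : realType.
Local Open Scope ereal_scope.
Local Notation leb := (@lebesgue_measure R).

Definition prod_vol k (A : set (borelV R (1 + k))) : \bar R :=
  \int[leb]_t vol [set y | A (consv t y)].

Let prod_vol_pushforward k : @prod_vol k = pushforward (leb \x @vol R k)
    ((fun p => consv p.1 p.2) : measurableTypeR R * borelV R k -> borelV R (1 + k)).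
Proof.
apply/funext => A; rewrite /prod_vol /pushforward /product_measure1.
apply: eq_integral => t _ /=; congr vol.
by apply/seteqP; split => y; rewrite /xsection /= inE.
Qed.

Let prod_vol0 k : @prod_vol k set0 = 0.
Proof. by rewrite prod_vol_pushforward /pushforward preimage_set0 measure0. Qed.

Let prod_vol_ge0 k A : 0 <= @prod_vol k A.
Proof. by apply: integral_ge0. Qed.

Let prod_vol_sigma_additive k : semi_sigma_additive (@prod_vol k).
Proof.
rewrite prod_vol_pushforward.
have := @measure_semi_sigma_additive _ _ _ (pushforward (leb \x @vol R k)
  ((fun p => consv p.1 p.2) : measurableTypeR R * borelV R k -> borelV R (1 + k))).
by apply; exact: measurable_consv.
Qed.

HB.instance Definition _ k := isMeasure.Build _ _ _ (@prod_vol k)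
  (@prod_vol0 k) (@prod_vol_ge0 k) (@prod_vol_sigma_additive k).

Lemma prod_volE k A : @prod_vol k A = (leb \x @vol R k) ((fun p => consv p.1 p.2) @^-1` A).
Proof. by rewrite prod_vol_pushforward. Qed.

Lemma prod_volX k (I : set R) (B : set (borelV R k)) : measurable I ->
  prod_vol [set x : 'rV[R]_(1 + k) | I (x ord0 (lshift k ord0)) /\ B (rsubmx x)] =
  vol B * leb I.
Proof.
move=> mI; transitivity (\int[leb]_(t in I) cst (vol B) t); last by rewrite integral_cst.
rewrite [RHS]integral_mkcond; apply: eq_integral => t _; rewrite patchE; case: ifPn => [/set_mem It|/negP It].
  by congr vol; apply/seteqP; split => y /=; rewrite consv0E row_mxKr => //; case.
rewrite (_ : [set y | _] = set0) ?measure0//.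
by rewrite -subset0 => y /=; rewrite consv0E => -[] /mem_set.
Qed.

Lemma cubeE k r : @cube R (1 + k) r =
  [set x : 'rV[R]_(1 + k) | `[(- r)%R, r]%classic (x ord0 (lshift k ord0)) /\ @cube R k r (rsubmx x)].
Proof.
apply/seteqP; split => x; rewrite /= in_itv/= -ler_norml.
  by move=> Cx; split => // i; rewrite mxE.
by move=> [x0 xS] i; case: (split_ordP i) => j ->; rewrite ?ord1//; have := xS j; rewrite mxE.
Qed.

Lemma unit_cubeE k : @unit_cube R (1 + k) =
  [set x : 'rV[R]_(1 + k) | `[0%R, 1%R]%classic (x ord0 (lshift k ord0)) /\ @unit_cube R k (rsubmx x)].
Proof.
apply/seteqP; split => x; rewrite /= in_itv/=.
  by move=> Cx; split => // i; rewrite mxE.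
by move=> [x0 xS] i; case: (split_ordP i) => j ->; rewrite ?ord1//; have := xS j; rewrite mxE.
Qed.

Let leb_itv (a b : R) : (a <= b)%R -> leb `[a, b]%classic = (b - a)%:E.
Proof.
rewrite le_eqVlt lebesgue_measure_itv/= lte_fin => /predU1P[->|->//].
by rewrite ltxx subrr.
Qed.

Lemma prod_vol_cube k r : (0 <= r)%R ->
  prod_vol (@cube R (1 + k) r) = vol (@cube R k r) * (2 * r)%:E.
Proof.
move=> r0; rewrite cubeE prod_volX//.
by rewrite leb_itv ?ge0_cp// opprK mulr_natl mulr2n.
Qed.

Lemma prod_vol_unit_cube k : prod_vol (@unit_cube R (1 + k)) = vol (@unit_cube R k).
Proof.
rewrite unit_cubeE prod_volX//.
by rewrite leb_itv// subr0 mule1.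
Qed.

Let prod_vol_sigma_finite k : sigma_finite setT (@prod_vol k).
Proof.
exists (fun j => @cube R (1 + k) j%:R); first by rewrite bigcup_cube.
move=> j; split; first exact: measurable_cube.
rewrite prod_vol_cube//; have := vol_cube_lty k (j%:R : R); have : 0 <= vol (@cube R k j%:R) by exact: hausdorff_ge0.
by case: (vol _) => // x _ _; rewrite -EFinM ltry.
Qed.

HB.instance Definition _ k := @Measure_isSigmaFinite.Build _ _ _ (@prod_vol k)
  (@prod_vol_sigma_finite k).

Let measurable_preim k (A : set (borelV R (1 + k))) : measurable A ->
  measurable ((fun p => consv p.1 p.2) @^-1` A : set (measurableTypeR R * borelV R k)).
Proof. by move=> mA; rewrite -[X in measurable X]setTI; exact: measurable_consv. Qed.

Lemma prod_vol_translate k (v : 'rV[R]_(1 + k)) (A : set (borelV R (1 + k))) : measurable A ->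
  prod_vol ((fun x : 'rV[R]_(1 + k) => x + v)%R @^-1` A) = prod_vol A.
Proof.
move=> mA; rewrite -(consv_eta v); move: (v ord0 _) (rsubmx v) => a w.
rewrite /prod_vol.
under eq_integral => t _.
  rewrite (_ : [set y | _] = (fun y => y + w)%R @^-1` [set y | A (consv (t + a) y)]); last first.
    by apply/seteqP; split => y /=; rewrite consvD.
  rewrite vol_translate; over.
have mA' := measurable_preim mA.
have mB : measurable [set p : measurableTypeR R * borelV R k | A (consv (p.1 + a) p.2)].
  have mg : measurable_fun setT ((fun p => (p.1 + a, p.2)%R) :
      measurableTypeR R * borelV R k -> measurableTypeR R * borelV R k).
    apply: measurable_fun_pair; last exact: measurable_snd.
    by apply: measurable_funD => //; exact: measurable_fst.
  by have := mg measurableT _ mA'; rewrite setTI.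
(* The invariance of [vol] has absorbed the shift of [y]. Exchanging the integrals brings Lebesgue
   measure inside, where its invariance absorbs the shift of [t]. *)
rewrite (@tonelli_set _ _ _ (measurableTypeR R) (borelV R k) leb (@vol R k)
  [set p | A (consv (p.1 + a) p.2)] mB).
rewrite (@tonelli_set _ _ _ (measurableTypeR R) (borelV R k) leb (@vol R k)
  [set p | A (consv p.1 p.2)] mA').
apply: eq_integral => y _; rewrite -[RHS](lebesgue_translate a)//.
have := measurable_fun_pair1 y (@measurable_id _ (measurableTypeR R * borelV R k)%type setT) measurableT mA'.
by rewrite setTI.
Qed.

End product_volume.

Section hausdorff_bilipschitz.
Variable R : realType.
Local Open Scope ereal_scope.

Lemma hausdorff_colipschitz m m' s (L : R) (g : 'rV[R]_m -> 'rV[R]_m') (A : set 'rV[R]_m) :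
  (0 < L)%R ->
  (forall x y, A x -> A y -> (enorm (x - y) <= L * enorm (g x - g y))%R) ->
  hausdorff s A <= (L ^+ s)%:E * hausdorff s (g @` A).
Proof. by move=> L0 gL; rewrite -[X in hausdorff s X]image_id; exact: hausdorff_compare. Qed.

Lemma hausdorff_similarity m m' s (a : R) (g : 'rV[R]_m -> 'rV[R]_m') (A : set 'rV[R]_m) :
  (0 < a)%R -> (forall x y, enorm (g x - g y) = a * enorm (x - y))%R ->
  hausdorff s (g @` A) = (a ^+ s)%:E * hausdorff s A.
Proof.
move=> a0 ga; apply/le_anti/andP; split.
  by apply: hausdorff_lipschitz => // x y _ _; rewrite ga.
rewrite -lee_pdivlMl ?exprn_gt0// -exprVn; apply: hausdorff_colipschitz.
  by rewrite invr_gt0.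
by move=> x y _ _; rewrite ga mulKf ?gt_eqF.
Qed.

End hausdorff_bilipschitz.

(** * Proportionality of Hausdorff volume and the product measure *)

Section volume_is_product.
Variable R : realType.
Local Open Scope ereal_scope.

Lemma vol_opp m (A : set (borelV R m)) : vol ((fun x : 'rV[R]_m => - x)%R @^-1` A) = vol A.
Proof.
rewrite (_ : _ @^-1` _ = (fun x : 'rV[R]_m => - x)%R @` A).
  rewrite /vol /hausB (@hausdorff_similarity _ _ _ _ 1) ?ltr01 ?expr1n ?mul1e//.
  by move=> x y; rewrite mul1r opprK addrC enormBC.
by apply/seteqP; split => [x Ax|_ [x Ax <-]]; [exists (- x)%R => //; rewrite opprK|rewrite /= opprK].
Qed.

(** Uniqueness of translation invariant measures, tested against the unit cube. The reflection of
    [A] that appears in [haar_exchange] disappears because x to -x is an isometry. *)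
Lemma vol_prod_exchange k (A : set (borelV R (1 + k))) : measurable A ->
  vol (@unit_cube R (1 + k)) * prod_vol A = vol A * vol (@unit_cube R k).
Proof.
move=> mA; transitivity (vol ((fun x : 'rV[R]_(1 + k) => - x)%R @^-1` A) *
    prod_vol (@unit_cube R (1 + k))); last by rewrite vol_opp prod_vol_unit_cube.
apply: (@haar_exchange R (1 + k) (@prod_vol R k) (@vol R (1 + k))) => //.
- by move=> v C mC; exact: prod_vol_translate.
- by move=> v C mC; exact: vol_translate.
- exact: measurable_unit_cube.
Qed.

Lemma vol_unit_cube_fin k : vol (@unit_cube R k) \is a fin_num.
Proof. by rewrite ge0_fin_numE; [exact: hausdorff_unit_cube_lty|exact: hausdorff_ge0]. Qed.

(* A set of diameter r lies in a cube of side 2r, whose product volume is, by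
   induction on the dimension, at most a constant times its gauge r^(1+k). *)
Lemma vol_unit_cube_gt0 k : 0 < vol (@unit_cube R k).
Proof.
elim: k => [|k ih].
  (* In dimension 0 every nonempty set has gauge 1, and a covering of the one-point space has a
     nonempty member. *)
  apply: (@lt_le_trans _ _ 1); first by rewrite lte01.
  apply: le_trans (hausdorff_delta_le _ _ ltr01).
  apply: le_hausdorff_delta => F dF QF.
  have [i _ Fi] : (\bigcup_i F i) 0%R by apply: QF => -[].
  apply: (@le_trans _ _ (hgauge 0 (F i))).
    by rewrite (hgauge_neq0 _ Fi) expe0 mule1.
  rewrite (@nneseriesD1 _ (fun j => hgauge 0 (F j)) i xpredT)//; last first.
    by move=> *; exact: hgauge_ge0.
  by rewrite leeDl// nneseries_ge0// => *; exact: hgauge_ge0.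
set V := fine (vol (@unit_cube R k)).
have VE : vol (@unit_cube R k) = V%:E by rewrite fineK// vol_unit_cube_fin.
have V0 : (0 < V)%R by rewrite -lte_fin -VE.
pose b := ball_vol R (1 + k); have b0 : (0 < b)%R by exact: ball_vol_gt0.
(* The cube of side 2r has product volume at most (2r)^(1+k) V, and a set of diameter r has gauge b
   (r/2)^(1+k); [K] is the ratio of the two. *)
pose K := (4 ^+ (1 + k) * V / b)%R.
have K0 : (0 < K)%R by rewrite divr_gt0// mulr_gt0// exprn_gt0.
have box C : small_set 1 C -> exists D, [/\ measurable (D : set (borelV R (1 + k))), C `<=` D &
    prod_vol D <= K%:E * hgauge (1 + k) C].
  move=> dC; have [->|/set0P[c Cc]] := eqVneq C set0.
    by exists set0; split => //; rewrite measure0 hgauge0 mule0.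
  have fC : ediam C \is a fin_num.
    rewrite ge0_fin_numE ?(ediam_ge0 Cc)// (@le_lt_trans _ _ 1%:E) ?ltry//.
    by apply: ediam_le => x y Cx Cy; rewrite lee_fin dC.
  pose r := fine (ediam C).
  have rE : ediam C = r%:E by rewrite fineK.
  have r0 : (0 <= r)%R by rewrite -lee_fin -rE (ediam_ge0 Cc).
  have mD : measurable ((fun x : 'rV[R]_(1 + k) => x + - c)%R @^-1` cube r : set (borelV R (1 + k))).
    rewrite -[X in measurable X]setTI; have mT := @measurableT _ (borelV R (1 + k)).
    have mg : measurable_fun [set: borelV R (1 + k)] ((fun x => x + - c)%R : _ -> borelV R (1 + k)).
      by apply: measurable_rowD => //; exact: measurable_id.
    by apply: mg => //; exact: measurable_cube.
  exists ((fun x : 'rV[R]_(1 + k) => x + - c)%R @^-1` cube r); split => //.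
    move=> x Cx i; rewrite (le_trans (coord_le_enorm _ _))//.
    by rewrite -lee_fin -rE ediam_ub.
  rewrite prod_vol_translate ?prod_vol_cube//; last exact: measurable_cube.
  rewrite (hgauge_neq0 _ Cc) rE -EFinM -EFin_expe -!EFinM.
  have -> : (K * (b * (r / 2) ^+ (1 + k)) = V * (2 * r) ^+ k * (2 * r))%R.
    rewrite -[RHS]mulrA -exprSr /K mulrA divfK ?gt_eqF// mulrAC -exprMn mulrC.
    by congr (_ * _ ^+ _)%R; field.
  move: r0; rewrite le_eqVlt => /predU1P[<-|r0]; first by rewrite !mulr0 mule0.
  rewrite [leRHS]EFinM lee_wpmul2r ?lee_fin ?mulr_ge0 ?(ltW r0)//.
  by rewrite (le_trans (hausdorff_cube_le _ r0))// EFinM muleC lee_wpmul2r ?lee_fin ?exprn_ge0 ?mulr_ge0 ?(ltW r0)// -VE.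
have : V%:E <= K%:E * vol (@unit_cube R (1 + k)).
  rewrite -VE -prod_vol_unit_cube -lee_pdivrMl//.
  apply: le_trans (hausdorff_delta_le _ _ ltr01).
  apply: le_hausdorff_delta => F dF QF; rewrite lee_pdivrMl//.
  pose D i := projT1 (cid (box _ (dF i))).
  have DP i := projT2 (cid (box _ (dF i))).
  rewrite -nneseriesZl => [|i _]; last exact: hgauge_ge0.
  apply: (@le_trans _ _ (\sum_(i <oo) prod_vol (D i))).
    apply: (@measure_sigma_subadditive _ _ _ (@prod_vol R k)).
    - by move=> i; case: (DP i).
    - exact: measurable_unit_cube.
    - by apply: (subset_trans QF) => x [i _ Fx]; exists i => //; have [_ + _] := DP i; apply.
  by apply: lee_nneseries => [i _ _|i _]; [exact: measure_ge0|case: (DP i)].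
have : 0 <= vol (@unit_cube R (1 + k)) by exact: hausdorff_ge0.
rewrite le_eqVlt => /predU1P[<-|//]; rewrite mule0 lee_fin leNgt V0//.
Qed.

(* Its value is 1 (isodiametric inequality), but only its positivity matters. *)
Definition slice_const k : R := fine (vol (@unit_cube R (1 + k))) / fine (vol (@unit_cube R k)).

Lemma slice_const_gt0 k : (0 < slice_const k)%R.
Proof. by rewrite divr_gt0// fine_gt0// vol_unit_cube_gt0 ltey_eq vol_unit_cube_fin. Qed.

Lemma vol_prod k (A : set (borelV R (1 + k))) : measurable A ->
  vol A = (slice_const k)%:E * prod_vol A.
Proof.
move=> mA; have := vol_prod_exchange mA.
have f1 := vol_unit_cube_fin (1 + k); have f2 := vol_unit_cube_fin k.
rewrite -(fineK f1) -(fineK f2) => e.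
have g2 : (0 < fine (vol (@unit_cube R k)))%R.
  by rewrite fine_gt0// vol_unit_cube_gt0 ltey_eq f2.
rewrite /slice_const EFinM -muleA muleCA e muleCA -EFinM mulVf ?gt_eqF//.
by rewrite mule1.
Qed.

End volume_is_product.

(** * Reflections and orthonormal coordinates *)

Section reflection.
Variable R : realType.

(* The identity when w = 0, since then x / 0 = 0. *)
Definition reflect m (w x : 'rV[R]_m) : 'rV[R]_m := x - (2 * dotv w x / dotv w w) *: w.

Lemma reflect_dotv m (w x y : 'rV[R]_m) : dotv (reflect w x) (reflect w y) = dotv x y.
Proof.
rewrite /reflect !(dotvBl, dotvBr, dotvZl, dotvZr) (dotvC x w).
have [->|w0] := eqVneq (dotv w w) 0; first by rewrite invr0 !(mulr0, mul0r, subr0).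
by field.
Qed.

Lemma reflectB m (w x y : 'rV[R]_m) : reflect w x - reflect w y = reflect w (x - y).
Proof.
rewrite /reflect dotvBr mulrBr mulrBl.
move: (2 * dotv w x / dotv w w) (2 * dotv w y / dotv w w) => a b.
by apply/rowP => i; rewrite !mxE; ring.
Qed.

Lemma reflectK m (w : 'rV[R]_m) : involutive (reflect w).
Proof.
move=> x; rewrite /reflect dotvBr dotvZr.
have [w0|w0] := eqVneq (dotv w w) 0; first by rewrite w0 invr0 !mulr0 !scale0r !subr0.
have -> : 2 * (dotv w x - 2 * dotv w x / dotv w w * dotv w w) / dotv w w =
   - (2 * dotv w x / dotv w w) by field.
by rewrite scaleNr opprK subrK.
Qed.

Lemma enorm_reflectB m (w x y : 'rV[R]_m) : enorm (reflect w x - reflect w y) = enorm (x - y).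
Proof. by rewrite reflectB; apply: eq_enorm; rewrite reflect_dotv. Qed.

(** For vectors of equal length, the hyperplane orthogonal to u - v bisects them. If [u = v] the
    reflection degenerates to the identity, and the statement survives. This provides an isometry
    taking one unit vector to another without building an orthonormal basis. *)
Lemma reflect_swap m (u v : 'rV[R]_m) : dotv u u = dotv v v -> reflect (u - v) u = v.
Proof.
move=> uv; have ww : dotv (u - v) (u - v) = 2 * (dotv u u - dotv u v).
  by rewrite !(dotvBl, dotvBr) -uv (dotvC v u); ring.
rewrite /reflect ww dotvBl (dotvC v u).
have [w0|w0] := eqVneq (dotv u u - dotv u v) 0.
  have : enorm (u - v) = 0 by rewrite /enorm ww w0 mulr0 sqrtr0.
  move=> /enorm0_eq0 uv0; rewrite uv0 scaler0 subr0.
  by apply/eqP; rewrite -subr_eq0 uv0.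
have -> : 2 * (dotv u u - dotv u v) / (2 * (dotv u u - dotv u v)) = 1 by field.
by rewrite scale1r opprB addrC subrK.
Qed.

Lemma measurable_reflect m (w : 'rV[R]_m) :
  measurable_fun [set: borelV R m] (reflect w : borelV R m -> borelV R m).
Proof.
apply: measurable_rowB; first exact: measurable_id.
apply: measurable_rowZ => //; apply: measurable_funM => //; apply: measurable_funM => //.
by apply: measurable_dotv => //; exact: measurable_id.
Qed.

Lemma vol_reflect m (w : 'rV[R]_m) (A : set (borelV R m)) : vol (reflect w @^-1` A) = vol A.
Proof.
rewrite (_ : _ @^-1` _ = reflect w @` A).
  rewrite /vol /hausB (@hausdorff_similarity _ _ _ _ 1) ?ltr01 ?expr1n ?mul1e//.
  by move=> x y; rewrite mul1r enorm_reflectB.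
apply/seteqP; split => [x Ax|_ [x Ax <-]]; last by rewrite /= reflectK.
by exists (reflect w x) => //; rewrite reflectK.
Qed.

Definition basis1 k : 'rV[R]_(1 + k) := consv 1 0.

Lemma dotv_basis1 k t (y : 'rV[R]_k) : dotv (consv t y) (basis1 k) = t.
Proof. by rewrite dotv_consv mulr1 dotv0r addr0. Qed.

Lemma dotv_basis11 k : dotv (basis1 k) (basis1 k) = 1.
Proof. by rewrite dotv_basis1. Qed.

(* Orthonormal coordinates (t, y) of R^(1+k) in which t = x . theta when
   theta is a unit vector. *)
Definition chart k (theta : 'rV[R]_(1 + k)) t (y : 'rV[R]_k) : 'rV[R]_(1 + k) :=
  reflect (basis1 k - theta) (consv t y).

Lemma chart_dotv k theta t t' (y y' : 'rV[R]_k) :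
  dotv (chart theta t y) (chart theta t' y') = t * t' + dotv y y'.
Proof. by rewrite reflect_dotv dotv_consv. Qed.

Lemma chart_theta k theta t (y : 'rV[R]_k) : enorm theta = 1 ->
  dotv (chart theta t y) theta = t.
Proof.
move=> th1; have thth : dotv (basis1 k) (basis1 k) = dotv theta theta.
  by rewrite dotv_basis11 -sqr_enorm th1 expr1n.
rewrite -[X in dotv _ X](reflect_swap thth) reflect_dotv.
exact: dotv_basis1.
Qed.

Lemma chartB k theta t t' (y y' : 'rV[R]_k) :
  chart theta t y - chart theta t' y' = chart theta (t - t') (y - y').
Proof.
rewrite /chart reflectB; congr reflect.
by rewrite -scaleN1r consvZ consvD mulN1r scaleN1r.
Qed.

Lemma chart_surj k theta (x : 'rV[R]_(1 + k)) : enorm theta = 1 ->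
  exists y, x = chart theta (dotv x theta) y.
Proof.
move=> th1; pose z := reflect (basis1 k - theta) x.
have E : x = chart theta (z ord0 (lshift k ord0)) (rsubmx z).
  by rewrite /chart consv_eta reflectK.
exists (rsubmx z); rewrite {1}E; congr chart.
by rewrite [in RHS]E chart_theta.
Qed.

Lemma measurable_chart k theta :
  measurable_fun [set: measurableTypeR R * borelV R k]
    ((fun p => chart theta p.1 p.2) : _ -> borelV R (1 + k)).
Proof. exact: (measurableT_comp (measurable_reflect _) (@measurable_consv R k)). Qed.

Lemma measurable_chart2 k theta t :
  measurable_fun [set: borelV R k] ((fun y => chart theta t y) : _ -> borelV R (1 + k)).
Proof. exact: (measurable_fun_pair2 t (measurable_chart theta)). Qed.

End reflection.

(** * Fubini along an arbitrary direction *)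

Section slicing.
Variable R : realType.
Local Open Scope ereal_scope.
Local Notation leb := (@lebesgue_measure R).

Lemma vol_chart k theta (A : set (borelV R (1 + k))) : measurable A ->
  vol A = (slice_const R k)%:E * (leb \x @vol R k) ((fun p => chart theta p.1 p.2) @^-1` A).
Proof.
move=> mA; rewrite -(vol_reflect (basis1 R k - theta)%R) vol_prod ?prod_volE//.
by rewrite -[X in measurable X]setTI; exact: measurable_reflect.
Qed.

Lemma ge0_integral_chart k theta (h : borelV R (1 + k) -> \bar R) :
  measurable_fun setT h -> (forall x, 0 <= h x) ->
  \int[@vol R (1 + k)]_x h x =
  (slice_const R k)%:E * \int[leb]_t \int[@vol R k]_y h (chart theta t y).
Proof.
move=> mh h0.
have c0 : (0 <= slice_const R k)%R by exact/ltW/slice_const_gt0.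
rewrite (@ge0_integral_transfer _ _ (measurableTypeR R * borelV R k)%type (borelV R (1 + k)) R
  (fun p => chart theta p.1 p.2) (leb \x @vol R k) (@vol R (1 + k)) _ setT
  (measurable_chart theta) measurableT c0)//; last first.
  by move=> A mA _; exact: vol_chart.
congr (_ * _); rewrite preimage_setT fubini_tonelli1//.
exact: (measurableT_comp mh (measurable_chart theta)).
Qed.

Lemma integrable_chart k theta (h : borelV R (1 + k) -> \bar R) :
  measurable_fun setT h -> (@vol R (1 + k)).-integrable setT h ->
  (leb \x @vol R k).-integrable setT (fun p => h (chart theta p.1 p.2)).
Proof.
move=> mh /integrableP[_ hoo]; apply/integrableP; split.
  exact: (measurableT_comp mh (measurable_chart theta)).
move: hoo; rewrite (ge0_integral_chart theta)//; last exact: measurableT_comp.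
rewrite fubini_tonelli1//; last first.
  by apply: measurableT_comp => //; exact: (measurableT_comp mh (measurable_chart theta)).
have := slice_const_gt0 R k; rewrite -lte_fin.
set I := (X in _ -> _ * X < +oo -> _) => c0.
have : 0 <= I by apply: integral_ge0 => t _; apply: integral_ge0.
rewrite /fubini_F -/I; case: I => //; first by move=> r _ _; exact: ltry.
by rewrite gt0_muley.
Qed.

Lemma integral_chart k theta (h : borelV R (1 + k) -> \bar R) :
  measurable_fun setT h -> (@vol R (1 + k)).-integrable setT h ->
  \int[@vol R (1 + k)]_x h x =
  (slice_const R k)%:E * \int[leb]_t \int[@vol R k]_y h (chart theta t y).
Proof.
move=> mh ih; have c0 := slice_const_gt0 R k.
rewrite (@integral_transfer _ _ (measurableTypeR R * borelV R k)%type (borelV R (1 + k)) R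
  (fun p => chart theta p.1 p.2) (leb \x @vol R k) (@vol R (1 + k)) _ setT
  (measurable_chart theta) measurableT (ltW c0) _ h c0)//; last first.
  by move=> A mA _; exact: vol_chart.
congr (_ * _); rewrite preimage_setT -integral12_prod_meas1//.
exact: integrable_chart.
Qed.

(** Fubini applied to a Borel hull of [N], since [N] itself need not be Borel. *)
Lemma ae_slice_null k theta (N : set 'rV[R]_(1 + k)) : hausdorff (1 + k) N = 0 ->
  {ae leb, forall t, hausdorff k [set y | N (chart theta t y)] = 0}.
Proof.
have [B [mB NB BN]] := borel_hull (1 + k) N; rewrite -BN => B0.
have := vol_chart theta mB; rewrite /vol /hausB B0 => /esym/eqP.
rewrite mule_eq0 eqe gt_eqF ?slice_const_gt0//= => /eqP.
set E := _ @^-1` B => E0.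
have mE : measurable (E : set (measurableTypeR R * borelV R k)).
  by rewrite -[X in measurable X]setTI; exact: measurable_chart.
have mF : measurable_fun setT (@vol R k \o xsection E) by exact: measurable_fun_xsection.
have : \int[leb]_t `|(@vol R k \o xsection E) t| = 0.
  by rewrite -[RHS]E0; apply: eq_integral => t _; rewrite gee0_abs.
move=> /(iffLR (ae_eq_integral_abs leb measurableT mF)); apply: filterS => t /(_ I) /= Et.
apply/eqP; rewrite eq_le hausdorff_ge0 andbT -Et.
by apply: le_hausdorff => y Ny; rewrite /xsection/= inE; exact: NB.
Qed.

Lemma lebesgue_scale (c : R) (A : set R) : (0 < c)%R -> measurable A ->
  leb A = c%:E * leb ((fun x => c * x)%R @^-1` A).
Proof.
move=> c0 mA; have mf : measurable_fun setT (fun x : R => (c * x)%R) by exact: measurable_funM.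
have := @lebesgue_measure_unique R (mscale (NngNum (ltW c0)) (pushforward lebesgue_measure
  ((fun x : R => (c * x)%R) : measurableTypeR R -> measurableTypeR R))).
move=> /(_ mf _ A mA) -> // _ [[a b] _ <-]; change (leb `]a, b]%classic = c%:E * leb ((fun x => c * x)%R @^-1` `]a, b]%classic)).
rewrite (_ : _ @^-1` _ = `](a / c)%R, (b / c)%R]%classic).
  rewrite !lebesgue_measure_itv/= !lte_fin ltr_pM2r ?invr_gt0//.
  case: ifPn => _; last by rewrite mule0.
  by rewrite -!EFinB -EFinM -mulrBl mulrC divfK ?gt_eqF.
by apply/seteqP; split => x /=; rewrite !in_itv/= ltr_pdivrMr// ler_pdivlMr// mulrC.
Qed.

Definition stretch k (c : R) (x : 'rV[R]_(1 + k)) : 'rV[R]_(1 + k) :=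
  consv (c * x ord0 (lshift k ord0)) (rsubmx x).

Lemma measurable_stretch k (c : R) :
  measurable_fun [set: borelV R (1 + k)] (@stretch k c : _ -> borelV R (1 + k)).
Proof.
have mg : measurable_fun setT ((fun x => (c * x ord0 (lshift k ord0), rsubmx x)%R) :
    borelV R (1 + k) -> measurableTypeR R * borelV R k).
  apply: measurable_fun_pair.
    by apply: measurable_funM => //; exact: measurable_coord.
  by apply: measurable_rowP => i; under eq_fun do rewrite mxE; exact: measurable_coord.
exact: (measurableT_comp (@measurable_consv R k) mg).
Qed.

(** A stretch in one direction is not a similarity, so Hausdorff scaling does not give the factor.
    In the product description it acts on the Lebesgue factor alone, and [slice_const] cancels. *)
Lemma vol_stretch k (c : R) (A : set (borelV R (1 + k))) : (0 < c)%R -> measurable A ->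
  vol A = c%:E * vol (stretch c @^-1` A).
Proof.
move=> c0 mA.
have ms := @measurable_stretch k c.
have mc : measurable_fun setT ((fun p => (c * p.1, p.2)%R) :
      measurableTypeR R * borelV R k -> measurableTypeR R * borelV R k).
  apply: measurable_fun_pair; last exact: measurable_snd.
  by apply: measurable_funM => //; exact: measurable_fst.
have mA' : measurable (stretch c @^-1` A : set (borelV R (1 + k))).
  by rewrite -[X in measurable X]setTI; exact: ms.
have mE : measurable ((fun p => consv p.1 p.2) @^-1` A : set (measurableTypeR R * borelV R k)).
  by rewrite -[X in measurable X]setTI; exact: measurable_consv.
have mE' : measurable ((fun p => consv (c * p.1)%R p.2) @^-1` A : set (measurableTypeR R * borelV R k)).
  by have := mc measurableT _ mE; rewrite setTI.
rewrite !vol_prod// muleCA; congr (_ * _); rewrite /prod_vol.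
rewrite (@tonelli_set _ _ _ (measurableTypeR R) (borelV R k) leb (@vol R k) _ mE).
under [in RHS]eq_integral => t _.
  rewrite (_ : [set y | _] = [set y | A (consv (c * t)%R y)]); last first.
    by apply/seteqP; split => y; rewrite /= /stretch consv0E row_mxKr.
  over.
rewrite (@tonelli_set _ _ _ (measurableTypeR R) (borelV R k) leb (@vol R k) _ mE').
have msec (y : borelV R k) : measurable ((fun t => consv t y) @^-1` A : set (measurableTypeR R)).
  have := measurable_fun_pair1 y (@measurable_id _ (measurableTypeR R * borelV R k)%type setT) measurableT mE.
  by rewrite setTI.
rewrite -ge0_integralZl//; last 2 first.
- rewrite (_ : (fun y => _) = leb \o ysection ((fun p => consv (c * p.1)%R p.2) @^-1` A)).
    exact: measurable_fun_ysection.
  by apply/funext => y /=; congr leb; apply/seteqP; split => t; rewrite /ysection/= inE.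
- by rewrite lee_fin ltW.
by apply: eq_integral => y _; exact: lebesgue_scale (msec y).
Qed.

End slicing.

(** * The area formula for the upper hemisphere *)

Section local_comparison.
Variables (R : realType) (m : nat).
Local Open Scope ereal_scope.
Variables mu nu : {measure set (borelV R m) -> \bar R}.
Variables (D : set (borelV R m)) (h h' : borelV R m -> \bar R).
Hypotheses (mD : measurable D) (mh : measurable_fun setT h) (mh' : measurable_fun setT h').
Hypotheses (h0 : forall x, 0 <= h x) (h'0 : forall x, 0 <= h' x).

Let cell_le (A : set (borelV R m)) (K : R) : measurable A -> (0 <= K)%R ->
  (forall B, measurable B -> B `<=` A -> nu B <= K%:E * mu B) ->
  (forall x, A x -> K%:E * h x <= h' x) ->
  \int[nu]_(x in A) h x <= \int[mu]_(x in A) h' x.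
Proof.
move=> mA K0 numu hh'.
have -> : \int[nu]_(x in A) h x = \int[mrestr nu mA]_(x in A) h x.
  by apply: eq_measure_integral => B mB BA; change (nu B = nu (B `&` A)); rewrite setIidl.
apply: (@le_trans _ _ (\int[mscale (NngNum K0) (mrestr mu mA)]_(x in A) h x)).
  apply: ge0_le_measure_integral => // B mB; rewrite /mscale/= /mrestr; apply: numu => //.
  exact: measurableI.
have mhA : measurable_fun A h by exact: measurable_funTS.
have mh'A : measurable_fun A h' by exact: measurable_funTS.
rewrite ge0_integral_mscale//=.
have -> : \int[mrestr mu mA]_(x in A) h x = \int[mu]_(x in A) h x.
  by apply: eq_measure_integral => B mB BA; change (mu (B `&` A) = mu B); rewrite setIidl.
rewrite -ge0_integralZl//; apply: ge0_le_integral => //.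
- by move=> x _; rewrite mule_ge0.
- exact: measurable_funeM.
Qed.

(** [K] may depend on the point, because it bounds the ratio of the measures and is then absorbed by
    the ratio of the integrands. The rational balls on which some [K] works form a countable cover
    of [D]; made disjoint, it reduces the claim to cells with a single [K]. *)
Lemma local_integral_le :
  (forall a, D a -> exists d K : R, [/\ (0 < d)%R, (0 <= K)%R,
    (forall B, measurable B -> B `<=` D `&` [set x | (enorm (x - a) < d)%R] -> nu B <= K%:E * mu B) &
    (forall x, D x -> (enorm (x - a) < d)%R -> K%:E * h x <= h' x)]) ->
  \int[nu]_(x in D) h x <= \int[mu]_(x in D) h' x.
Proof.
move=> loc.
pose U (qj : 'rV[rat]_m * nat) := [set x : 'rV[R]_m | (enorm (x - map_mx ratr qj.1) < qj.2.+1%:R^-1)%R].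
pose good qj := exists K : R, [/\ (0 <= K)%R,
    (forall B, measurable B -> B `<=` D `&` U qj -> nu B <= K%:E * mu B) &
    (forall x, D x -> U qj x -> K%:E * h x <= h' x)].
pose F i := if unpickle i is Some qj then (if asbool (good qj) then D `&` U qj else set0) else set0.
have mU qj : measurable (U qj : set (borelV R m)).
  apply: measurable_lt_fun => //; apply: measurable_enorm; apply: measurable_rowB => //.
have mF i : measurable (F i : set (borelV R m)).
  by rewrite /F; case: unpickle => // qj; case: asboolP => // _; exact: measurableI.
have FD : \bigcup_i F i = D.
  apply/seteqP; split => [x [i _]|x Dx].
    by rewrite /F; case: unpickle => // qj; case: asboolP => // _ [].
  have [d [K [d0 K0 numu hh']]] := loc x Dx.
  have [j jd] : exists j : nat, (j.+1%:R^-1 < d / 2)%R.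
    have [] := @ltr_add_invr R 0%R (d / 2)%R; first by rewrite divr_gt0.
    by move=> j; rewrite add0r; exists j.
  have j0 : (0 < j.+1%:R^-1 :> R)%R by rewrite invr_gt0.
  have [q xq] := rat_row_dense x j0.
  have Ux y : U (q, j) y -> (enorm (y - x) < d)%R.
    move=> /= yq; rewrite (le_lt_trans (ler_enormB _ (map_mx ratr q) _))//.
    rewrite enormBC in xq; rewrite (splitr d) ltrD//; last exact: lt_trans jd.
    exact: lt_trans jd.
  exists (pickle (q, j)) => //; rewrite /F pickleK; case: asboolP => [_|[]]; first by split.
  exists K; split => // [B mB BU|y Dy /Ux]; last exact: hh'.
  by apply: numu => // y /BU[Dy /Ux].
rewrite -FD seqDU_bigcup_eq !ge0_integral_bigcup//; try exact: trivIset_seqDU;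
  try exact: seqDU_measurable; try exact: measurable_funTS.
apply: lee_nneseries => [i _ _|i _]; first by apply: integral_ge0.
have mS := seqDU_measurable mF i.
have := @subset_seqDU _ F i; rewrite {2}/F; case: unpickle => [qj|]; last first.
  by rewrite subset0 => ->; rewrite !integral_set0.
case: asboolP => [gqj|_]; last by rewrite subset0 => ->; rewrite !integral_set0.
move=> SU; have [K [K0 numu hh']] := gqj; apply: (cell_le mS K0) => [B mB BS|x /SU[]].
  by apply: numu => //; exact: subset_trans SU.
exact: hh'.
Qed.

End local_comparison.

Lemma ge0_integral_mrestr d (T : measurableType d) (R : realType)
    (mu : {measure set T -> \bar R}) (D P : set T) (mD : measurable D) (f : T -> \bar R) :
  measurable P -> measurable_fun P f -> (forall x, P x -> 0 <= f x)%E ->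
  (\int[mrestr mu mD]_(x in P) f x = \int[mu]_(x in P `&` D) f x)%E.
Proof.
move=> mP mf f0; rewrite -{1}(setUIDK P D).
have mPD : measurable (P `&` D) by exact: measurableI.
have mPD' : measurable (P `\` D) by exact: measurableD.
rewrite ge0_integral_setU//; last 3 first.
- by rewrite setUIDK.
- by rewrite setUIDK.
- by apply/disj_setPS => x [[_ Dx] [_]].
rewrite [X in (_ + X)%E](_ : _ = 0%E) ?adde0.
  apply: eq_measure_integral => A mA APD; change (mu (A `&` D) = mu A).
  by rewrite setIidl// => x /APD[].
rewrite -(@integral_measure_zero _ T R (P `\` D) f).
apply: eq_measure_integral => A mA APD; change (mu (A `&` D) = 0%E).
rewrite (_ : A `&` D = set0) ?measure0// -subset0 => x [/APD[_ nDx] Dx].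
exact: nDx.
Qed.

Section limit_factor.
Variable R : realType.
Local Open Scope ereal_scope.

(** The base 3 comes from (1 + e)(1 + P e) = 1 + e + P e + P e^2, where P = 3^p is at least 1 and e
    at most 1, so that each of the last three terms is at most P e. *)
Lemma le_expr_factor p (e : R) : (0 <= e <= 1)%R -> ((1 + e) ^+ p <= 1 + 3 ^+ p * e)%R.
Proof.
move=> /andP[e0 e1]; elim: p => [|p ih]; first by rewrite !expr0; lra.
rewrite exprS; apply: (@le_trans _ _ ((1 + e) * (1 + 3 ^+ p * e))%R).
  by rewrite ler_wpM2l//; lra.
rewrite exprS; have : (1 <= 3 ^+ p :> R)%R by rewrite exprn_ege1// ler1n.
move: (3 ^+ p)%R => P P1; have h1 : (e <= P * e)%R by rewrite ler_peMl.
have h2 : (P * e * e <= P * e)%R by rewrite ler_piMr// mulr_ge0//; lra.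
lra.
Qed.

Lemma lee_factor p (x y : \bar R) : 0 <= y ->
  (forall e : R, (0 < e <= 1)%R -> x <= ((1 + e) ^+ p)%:E * y) -> x <= y.
Proof.
move=> y0 xy; have := xy 1%R; rewrite ltr01 lexx => /(_ isT).
move: y y0 xy => [y||] y0 xy; [|by rewrite leey|by move: y0; rewrite leeNy_eq].
move: x xy => [x||] xy xy1; last by rewrite leNye.
- rewrite lee_fin; apply/ler_addgt0Pr => d d0.
  (* Taking [y + 1] instead of [y] keeps the divisor positive when [y = 0]. *)
  pose c : R := (3 ^+ p * (y + 1))%R; rewrite lee_fin in y0.
  have c0 : (0 < c)%R by rewrite mulr_gt0 ?exprn_gt0//; lra.
  pose e := Num.min 1%R (d / c)%R.
  have e0 : (0 < e)%R by rewrite lt_min ltr01 divr_gt0.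
  have e1 : (e <= 1)%R by rewrite ge_min lexx.
  have := xy e; rewrite e0 e1 -EFinM lee_fin => /(_ isT) /le_trans; apply.
  apply: (@le_trans _ _ ((1 + 3 ^+ p * e) * y)%R).
    by rewrite ler_wpM2r// le_expr_factor// (ltW e0).
  have : (e * c <= d)%R by rewrite -ler_pdivlMr// /e ge_min lexx orbT.
  rewrite /c; have : (0 <= 3 ^+ p * e)%R by rewrite mulr_ge0 ?exprn_ge0 ?(ltW e0).
  nra.
- by move: xy1; rewrite -EFinM leye_eq.
Qed.

End limit_factor.

(** * The hemisphere as a graph over the ball *)

Section graph_chart.
Variable R : realType.
Implicit Types n : nat.

Definition snocv n (x : 'rV[R]_n) (w : R) : 'rV[R]_(n + 1) := row_mx x (const_mx w).

Lemma dotv_snocv n (x x' : 'rV[R]_n) w w' :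
  dotv (snocv x w) (snocv x' w') = dotv x x' + w * w'.
Proof.
rewrite /dotv big_split_ord/= big_ord1; congr (_ + _); last by rewrite /snocv !row_mxEr !mxE.
by apply: eq_bigr => i _; rewrite /snocv !row_mxEl.
Qed.

Lemma xlast_snocv n (x : 'rV[R]_n) w : xlast (snocv x w) = w.
Proof. by rewrite /xlast row_mxKr mxE. Qed.

Lemma enorm_snocv0 n (x : 'rV[R]_n) : enorm (snocv x 0) = enorm x.
Proof. by apply: eq_enorm; rewrite dotv_snocv mulr0 addr0. Qed.

Lemma lsubmx_snocv n (x : 'rV[R]_n) w : lsubmx (snocv x w) = x.
Proof. exact: row_mxKl. Qed.

Lemma snocv_eta n (z : 'rV[R]_(n + 1)) : snocv (lsubmx z) (xlast z) = z.
Proof.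
by rewrite -[RHS]hsubmxK; congr row_mx; apply/rowP => i; rewrite !mxE (ord1 i) /xlast mxE.
Qed.

Lemma snocvB n (x x' : 'rV[R]_n) w w' : snocv x w - snocv x' w' = snocv (x - x') (w - w').
Proof.
rewrite /snocv opp_row_mx add_row_mx; congr row_mx.
by apply/rowP => i; rewrite !mxE.
Qed.

Lemma measurable_snocv n d (T : measurableType d) (f : T -> 'rV[R]_n) (g : T -> R) :
  measurable_fun setT (f : T -> borelV R n) -> measurable_fun setT g ->
  measurable_fun setT ((fun t => snocv (f t) (g t)) : T -> borelV R (n + 1)).
Proof.
move=> mf mg; apply: measurable_rowP => i; case: (split_ordP i) => j ->.
  by under eq_fun do rewrite /snocv row_mxEl; exact: measurable_coord_comp.
by under eq_fun do rewrite /snocv row_mxEr mxE.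
Qed.

Lemma measurable_lsubmx n : measurable_fun [set: borelV R (n + 1)]
  ((fun z : 'rV[R]_(n + 1) => lsubmx z) : borelV R (n + 1) -> borelV R n).
Proof.
by apply: measurable_rowP => i; under eq_fun do rewrite mxE; exact: measurable_coord.
Qed.

Lemma measurable_xlast n : measurable_fun [set: borelV R (n + 1)]
  ((fun z : 'rV[R]_(n + 1) => xlast z) : borelV R (n + 1) -> R).
Proof. by rewrite /xlast; under eq_fun do rewrite mxE; exact: measurable_coord. Qed.

Definition oball n : set 'rV[R]_n := [set x | enorm x < 1].

(** Outside the open ball the square root of a nonpositive number is 0, and so is the inverse of
    [height]; both are thus Borel functions on the whole space. *)
Definition height n (x : 'rV[R]_n) : R := Num.sqrt (1 - dotv x x).

Definition lift n (x : 'rV[R]_n) : 'rV[R]_(n + 1) := snocv x (height x).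

Definition upper n : set 'rV[R]_(n + 1) := [set z | enorm z = 1 /\ 0 < xlast z].

Lemma oballP n (x : 'rV[R]_n) : oball x <-> dotv x x < 1.
Proof.
by rewrite /oball/= -sqr_enorm expr_lt1// enorm_ge0.
Qed.

Lemma measurable_oball n : measurable (@oball n : set (borelV R n)).
Proof. by apply: measurable_lt_fun => //; apply: measurable_enorm; exact: measurable_id. Qed.

Lemma measurable_upper n : measurable (@upper n : set (borelV R (n + 1))).
Proof.
apply: (@measurableI _ (borelV R (n + 1)) [set z | enorm z = 1] [set z | 0 < xlast z]).
  by apply: measurable_eq_fun => //; apply: measurable_enorm; exact: measurable_id.
by apply: measurable_lt_fun => //; exact: measurable_xlast.
Qed.

Lemma measurable_height n : measurable_fun [set: borelV R n] (@height n : borelV R n -> R).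
Proof.
apply: (@measurableT_comp _ _ _ _ _ _ (@Num.sqrt R)).
  by apply: continuous_measurable_fun; exact: sqrt_continuous.
by apply: measurable_funB => //; apply: measurable_dotv; exact: measurable_id.
Qed.

Lemma measurable_lift n : measurable_fun [set: borelV R n] (@lift n : borelV R n -> borelV R (n + 1)).
Proof. by apply: measurable_snocv; [exact: measurable_id|exact: measurable_height]. Qed.

Lemma height_ge0 n (x : 'rV[R]_n) : 0 <= height x.
Proof. exact: sqrtr_ge0. Qed.

Lemma height_gt0 n (x : 'rV[R]_n) : oball x -> 0 < height x.
Proof. by move=> /oballP x1; rewrite sqrtr_gt0 subr_gt0. Qed.

Lemma measurable_height_inv n :
  measurable_fun [set: borelV R n] (fun x : 'rV[R]_n => ((height x)^-1)%:E).
Proof.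
apply/measurable_EFinP; rewrite (_ : (fun x => _) = (fun x : 'rV[R]_n => height x `^ (-1))%R).
  exact: (measurableT_comp (@measurable_powR R (-1)%R) (@measurable_height n)).
by apply/funext => x; rewrite powR_inv1// height_ge0.
Qed.

Lemma sqr_height n (x : 'rV[R]_n) : oball x -> height x ^+ 2 = 1 - dotv x x.
Proof. by move=> /oballP x1; rewrite sqr_sqrtr// subr_ge0 ltW. Qed.

Lemma height_le1 n (x : 'rV[R]_n) : height x <= 1.
Proof.
by rewrite -[X in _ <= X](sqrtr1) /height ler_sqrt// lerBlDr lerDl dotvv_ge0.
Qed.

Lemma lift_upper n (x : 'rV[R]_n) : oball x -> upper (lift x).
Proof.
move=> x1; split; last by rewrite xlast_snocv height_gt0.
by apply: enorm_eqP => //; rewrite dotv_snocv -expr2 sqr_height//; ring.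
Qed.

Lemma upper_lift n (z : 'rV[R]_(n + 1)) : upper z -> oball (lsubmx z) /\ lift (lsubmx z) = z.
Proof.
move=> [z1 zl]; have zz : dotv (lsubmx z) (lsubmx z) + xlast z * xlast z = 1.
  by rewrite -dotv_snocv snocv_eta -sqr_enorm z1 expr1n.
split; first by apply/oballP; nra.
rewrite -[RHS]snocv_eta /lift /height (_ : 1 - _ = xlast z ^+ 2); last by rewrite -zz; ring.
by rewrite sqrtr_sqr gtr0_norm.
Qed.

(** Difference of squares: the squared heights differ by |y|^2 - |x|^2 = -(x - y) . (x + y). *)
Lemma heightB n (x y : 'rV[R]_n) : oball x -> oball y ->
  height x - height y = - dotv (x - y) ((height x + height y)^-1 *: (x + y)).
Proof.
move=> x1 y1; have hx := height_gt0 x1; have hy := height_gt0 y1.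
have hxy : height x + height y != 0 by rewrite gt_eqF// addr_gt0.
have ex : dotv x x = 1 - height x ^+ 2 by rewrite sqr_height//; ring.
have ey : dotv y y = 1 - height y ^+ 2 by rewrite sqr_height//; ring.
rewrite dotvZr !(dotvBl, dotvDr) (dotvC y x) ex ey.
by field.
Qed.

Lemma enorm_le_snocv n (v : 'rV[R]_n) w : enorm v <= enorm (snocv v w).
Proof. by apply: ler_wsqrtr; rewrite dotv_snocv lerDl -expr2 sqr_ge0. Qed.

(** Changing the slope by at most [e] moves the end point of the graph vector by at most e |v|, and
    |v| is at most the length of either graph vector. *)
Lemma enorm_snocv_close n (v b b' : 'rV[R]_n) e : enorm (b - b') <= e ->
  enorm (snocv v (dotv v b)) <= (1 + e) * enorm (snocv v (dotv v b')).
Proof.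
move=> be; have -> : snocv v (dotv v b) = snocv v (dotv v b') + snocv 0 (dotv v (b - b')).
  rewrite /snocv add_row_mx addr0; congr row_mx; apply/rowP => i.
  by rewrite !mxE dotvBr addrC subrK.
rewrite (le_trans (ler_enormD _ _))// mulrDl mul1r lerD2l.
have -> : enorm (snocv (0 : 'rV[R]_n) (dotv v (b - b'))) = `|dotv v (b - b')|.
  by apply: enorm_eqP => //; rewrite dotv_snocv dotv0r add0r real_normK ?num_real.
rewrite (le_trans (norm_dotv_le _ _))// mulrC ler_pM ?enorm_ge0//.
exact: enorm_le_snocv.
Qed.

(** Minus the gradient of [height] at [a]; it is also the value of [secant] on the diagonal. *)
Definition slope n (a : 'rV[R]_n) : 'rV[R]_n := (height a)^-1 *: a.

Definition secant n (x y : 'rV[R]_n) : 'rV[R]_n := (height x + height y)^-1 *: (x + y).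

(* lift x - lift y is, up to sign, the graph over x - y of a linear form that tends to
   that of the tangent plane as x and y tend to a. *)
Lemma enorm_liftB n (x y : 'rV[R]_n) : oball x -> oball y ->
  enorm (lift x - lift y) = enorm (snocv (x - y) (dotv (x - y) (secant x y))).
Proof.
move=> x1 y1; apply: eq_enorm; rewrite /lift snocvB !dotv_snocv heightB//.
by rewrite mulrNN.
Qed.

Lemma slope_close n (a : 'rV[R]_n) e : oball a -> 0 < e <= 1 ->
  exists2 d, 0 < d & forall x y, oball x -> oball y -> enorm (x - a) < d -> enorm (y - a) < d ->
   [/\ enorm (secant x y - slope a) <= e, height a <= (1 + e) * height x &
       height x <= (1 + e) * height a].
Proof.
move=> a1 /andP[e0 e1]; have h0 := height_gt0 a1; have h1 := height_le1 a.
(* With this [d], heights vary by at most 2d/h = e h^2/4 near [a]. They stay above 3h/4, so the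
   denominator h (height x + height y) of [secant x y - slope a] is at least (3/2) h^2, while its
   numerator is at most (3/4) e h^2. *)
set h := height a in h0 h1 *; pose d := e * h ^+ 3 / 8.
have d0 : 0 < d by rewrite divr_gt0// mulr_gt0// exprn_gt0.
have hclose x : oball x -> enorm (x - a) < d -> `|height x - h| <= e * h ^+ 2 / 4.
  move=> x1 xd; rewrite heightB// normrN (le_trans (norm_dotv_le _ _))//.
  have hx := height_gt0 x1; have hxh : 0 < height x + h by rewrite addr_gt0.
  rewrite enormZ ger0_norm ?invr_ge0 ?(ltW hxh)//.
  have xa2 : enorm (x + a) <= 2.
    rewrite (le_trans (ler_enormD _ _))//.
    have h2 : enorm x <= 1 by exact: ltW.
    have h3 : enorm a <= 1 by exact: ltW.
    lra.
  rewrite mulrA -/h.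
  apply: (@le_trans _ _ (d / (height x + h) * 2)).
    rewrite ler_pM ?mulr_ge0 ?enorm_ge0 ?invr_ge0 ?(ltW hxh)//.
    by rewrite ler_wpM2r ?invr_ge0 ?(ltW hxh)// ltW.
  have : d / (height x + h) <= d / h by rewrite ler_wpM2l ?(ltW d0)// lef_pV2 ?posrE// lerDr ltW.
  have -> : d / h = e * h ^+ 2 / 8 by rewrite /d; field; rewrite gt_eqF.
  lra.
exists d => // x y x1 y1 xd yd.
have := hclose x x1 xd; have := hclose y y1 yd.
rewrite !ler_norml => /andP[y_l y_u] /andP[x_l x_u].
have hh : h ^+ 2 <= h by rewrite expr2 ler_piMr// ltW.
have ehh : e * h ^+ 2 <= e * h by rewrite ler_wpM2l// ltW.
have ehh1 : e * h <= h by rewrite ler_piMl// ltW.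
have eh0 : 0 <= e * h by rewrite mulr_ge0// ltW.
split; last 2 first.
- have : (1 + e) * (h - e * h / 4) <= (1 + e) * height x by rewrite ler_wpM2l; lra.
  have : e * (e * h) <= e * h by rewrite ler_piMl.
  lra.
- lra.
have hx := height_gt0 x1; have hy := height_gt0 y1.
have hxy : 0 < height x + height y by rewrite addr_gt0.
have -> : secant x y - slope a = (h * (height x + height y))^-1 *:
    (h *: ((x - a) + (y - a)) + ((h - height x) + (h - height y)) *: a).
  rewrite /secant /slope -/h; apply/rowP => i; rewrite !mxE; field.
  by rewrite !gt_eqF.
have hhxy : 0 < h * (height x + height y) by rewrite mulr_gt0.
rewrite enormZ gtr0_norm ?invr_gt0// mulrC ler_pdivrMr//.
apply: (@le_trans _ _ (h * (d + d) + (e * h ^+ 2 / 4 + e * h ^+ 2 / 4))).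
  rewrite (le_trans (ler_enormD _ _))// !enormZ gtr0_norm// lerD//.
    by rewrite ler_wpM2l ?(ltW h0)// (le_trans (ler_enormD _ _))// lerD// ltW.
  rewrite -[X in _ <= X]mulr1 ler_pM ?normr_ge0 ?enorm_ge0 ?(ltW a1)//.
  by rewrite ler_norml; lra.
have : h * (d + d) <= e * h ^+ 2 / 4.
  have -> : h * (d + d) = e * h ^+ 2 / 4 * h ^+ 2 by rewrite /d; field.
  rewrite ler_piMr//; last by rewrite expr_le1// ltW.
  by rewrite !mulr_ge0// ?sqr_ge0// ltW.
have : e * (h * (h * (3 / 2))) <= e * (h * (height x + height y)).
  by rewrite ler_wpM2l ?(ltW e0)// ler_wpM2l ?(ltW h0)//; lra.
have : 0 <= e * h ^+ 2 by rewrite mulr_ge0 ?sqr_ge0// ltW.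
rewrite expr2; lra.
Qed.

(** The default at 0 is an arbitrary unit vector, which makes a = |a| [direction a] true without
    exception, for the tangent map at the centre as well as for the frequency [xi = 0]. *)
Definition direction k (a : 'rV[R]_(1 + k)) : 'rV[R]_(1 + k) :=
  if a == 0 then basis1 R k else (enorm a)^-1 *: a.

Lemma direction_unit k (a : 'rV[R]_(1 + k)) : dotv (direction a) (direction a) = 1.
Proof.
rewrite /direction; case: eqVneq => [_|a0]; first exact: dotv_basis11.
have na : enorm a != 0 by apply: contra_neq a0 => /enorm0_eq0.
by rewrite dotvZl dotvZr -sqr_enorm; field.
Qed.

Lemma direction_eta k (a : 'rV[R]_(1 + k)) : a = enorm a *: direction a.
Proof.
rewrite /direction; case: eqVneq => [->|a0]; first by rewrite enorm0 scale0r.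
have na : enorm a != 0 by apply: contra_neq a0 => /enorm0_eq0.
by rewrite scalerA divff// scale1r.
Qed.

(* Up to a rotation of the target, the differential at a of the chart lift. *)
Definition tangent k (a x : 'rV[R]_(1 + k)) : 'rV[R]_(1 + k) :=
  stretch (height a)^-1 (reflect (basis1 R k - direction a) x).

Lemma stretchB k c (x y : 'rV[R]_(1 + k)) : stretch c x - stretch c y = stretch c (x - y).
Proof.
rewrite /stretch -scaleN1r consvZ consvD; congr consv; first by rewrite !mxE; ring.
by apply/rowP => i; rewrite !mxE; ring.
Qed.

Lemma coord_basis1 k (x : 'rV[R]_(1 + k)) : x ord0 (lshift k ord0) = dotv x (basis1 R k).
Proof. by rewrite -[in RHS](consv_eta x) dotv_basis1. Qed.

(** Orthogonally to [a] both maps preserve lengths; along [a] the graph of the linear form stretches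
    by the square root of 1 + |a|^2 / (1 - |a|^2) = 1 / (1 - |a|^2), which is 1 / [height a]. *)
Lemma enorm_tangentB k (a x y : 'rV[R]_(1 + k)) : oball a ->
  enorm (tangent a x - tangent a y) = enorm (snocv (x - y) (dotv (x - y) (slope a))).
Proof.
move=> a1; have h0 := height_gt0 a1; apply: eq_enorm.
rewrite /tangent stretchB reflectB; set v := x - y; set z := reflect _ v.
have zv : dotv z z = dotv v v by exact: reflect_dotv.
have z1 : z ord0 (lshift k ord0) = dotv v (direction a).
  rewrite coord_basis1 /z -[X in dotv _ X](reflectK (basis1 R k - direction a)) reflect_dotv.
  by rewrite reflect_swap// dotv_basis11 direction_unit.
rewrite dotv_snocv -zv -[in RHS](consv_eta z) /stretch !dotv_consv z1.
have va : dotv v a = enorm a * dotv v (direction a) by rewrite [in LHS](direction_eta a) dotvZr.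
rewrite /slope dotvZr va.
have : height a ^+ 2 = 1 - enorm a ^+ 2 by rewrite sqr_enorm sqr_height.
move: (height a) (enorm a) (dotv v _) (dotv (rsubmx z) _) h0 => h na p q h0 e.
have hn : h != 0 by rewrite gt_eqF.
have -> : (h^-1 * (na * p)) * (h^-1 * (na * p)) = (h^-1) ^+ 2 * p ^+ 2 * (na ^+ 2) by ring.
have -> : na ^+ 2 = 1 - h ^+ 2 by rewrite e; ring.
by field.
Qed.

End graph_chart.

Section area_formula.
Variables (R : realType) (k : nat).
Local Open Scope ereal_scope.
Local Notation d := (1 + k)%N.

Lemma vol_tangent (a : 'rV[R]_d) (A : set (borelV R d)) : oball a -> measurable A ->
  vol (tangent a @` A) = ((height a)^-1)%:E * vol A.
Proof.
move=> a1 mA; have h0 := height_gt0 a1; have hn : height a != 0%R by rewrite gt_eqF.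
have sK (c : R) : (c != 0)%R -> cancel (@stretch R k c) (stretch c^-1).
  by move=> c0 x; rewrite /stretch consv0E row_mxKr mulKf// consv_eta.
have ms (c : R) : measurable_fun [set: borelV R d] (@stretch R k c : _ -> borelV R d).
  exact: measurable_stretch.
pose w := (basis1 R k - direction a)%R.
have -> : tangent a @` A = (fun z => reflect w (stretch (height a) z)) @^-1` A.
  apply/seteqP; split => [_ [x Ax <-]|z Az].
    by rewrite /= /tangent -[X in stretch X (stretch _ _)]invrK sK ?invr_eq0// reflectK.
  by exists (reflect w (stretch (height a) z)) => //; rewrite /tangent reflectK sK.
have mB : measurable ((fun z => reflect w (stretch (height a) z)) @^-1` A : set (borelV R d)).
  rewrite -[X in measurable X]setTI.
  exact: (measurableT_comp (measurable_reflect w) (ms (height a))).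
rewrite (@vol_stretch _ _ (height a)^-1 _ _ mB) ?invr_gt0//; congr (_ * _).
rewrite -[RHS](vol_reflect w); congr vol; apply/seteqP; split => z /=.
  by rewrite -[X in stretch X (stretch _ _)]invrK sK ?invr_eq0.
by rewrite -[X in stretch X (stretch _ _)]invrK sK ?invr_eq0.
Qed.

(* The surface measure of the upper hemisphere, projected to the ball. *)
Definition lift_vol : set (borelV R d) -> \bar R := pushforward
  (mrestr (@hausB R (d + 1) d) (@measurable_upper R d))
  ((fun z : 'rV[R]_(d + 1) => lsubmx z) : borelV R (d + 1) -> borelV R d).

Let lift_vol0 : lift_vol set0 = 0.
Proof. by rewrite /lift_vol /pushforward preimage_set0 measure0. Qed.

Let lift_vol_ge0 A : 0 <= lift_vol A.
Proof. exact: hausdorff_ge0. Qed.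

Let lift_vol_sigma_additive : semi_sigma_additive lift_vol.
Proof.
have := @measure_semi_sigma_additive _ _ _ (pushforward
  (mrestr (@hausB R (d + 1) d) (@measurable_upper R d))
  ((fun z : 'rV[R]_(d + 1) => lsubmx z) : borelV R (d + 1) -> borelV R d)).
by apply; exact: measurable_lsubmx.
Qed.

HB.instance Definition _ := isMeasure.Build _ _ _ lift_vol
  lift_vol0 lift_vol_ge0 lift_vol_sigma_additive.

Lemma lift_volE (A : set 'rV[R]_d) : A `<=` oball (n := d) ->
  lift_vol A = hausdorff d (@lift R d @` A).
Proof.
move=> AB; rewrite /lift_vol /pushforward /mrestr /hausB; congr hausdorff.
apply/seteqP; split => [z [Az uz]|_ [x Ax <-]].
  by have [_ <-] := upper_lift uz; exists (lsubmx z).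
by split; [rewrite /= lsubmx_snocv|apply: lift_upper; exact: AB].
Qed.

Let local (a : 'rV[R]_d) (e : R) : oball a -> (0 < e <= 1)%R ->
  exists2 r : R, (0 < r)%R &
    (forall A, measurable (A : set (borelV R d)) ->
      A `<=` oball (n := d) `&` [set x | (enorm (x - a) < r)%R] ->
      lift_vol A <= ((1 + e) ^+ d * (height a)^-1)%:E * vol A /\
      vol A <= ((1 + e) ^+ d * height a)%:E * lift_vol A) /\
    (forall x, oball x -> (enorm (x - a) < r)%R ->
      (height a <= (1 + e) * height x)%R /\ (height x <= (1 + e) * height a)%R).
Proof.
move=> a1 e01; have [r r0 close] := slope_close a1 e01.
have e1 : (0 < 1 + e)%R by case/andP: e01 => ? _; lra.
have h0 := height_gt0 a1.
exists r => //; split; last by move=> x x1 xr; have [] := close x x x1 x1 xr xr.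
move=> A mA AB; rewrite lift_volE; last by move=> x /AB[].
split; rewrite EFinM -muleA.
  rewrite -vol_tangent//; apply: hausdorff_compare => // x y /AB[x1 xr] /AB[y1 yr].
  rewrite enorm_liftB// enorm_tangentB//; apply: enorm_snocv_close.
  by have [] := close x y x1 y1 xr yr.
apply: (@le_trans _ _ ((height a)%:E * vol (tangent a @` A))).
  by rewrite vol_tangent// muleA -EFinM divff ?gt_eqF// mul1e.
rewrite muleCA lee_wpmul2l ?lee_fin ?(ltW h0)//.
apply: hausdorff_compare => // x y /AB[x1 xr] /AB[y1 yr].
rewrite enorm_liftB// enorm_tangentB//; apply: enorm_snocv_close.
by rewrite enormBC; have [] := close x y x1 y1 xr yr.
Qed.

Let mball := @measurable_oball R d.

Let mJ := @measurable_height_inv R d.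

Let J0 (x : 'rV[R]_d) : 0 <= ((height x)^-1)%:E.
Proof. by rewrite lee_fin invr_ge0 height_ge0. Qed.

Lemma ge0_integral_lift_vol (h : borelV R d -> \bar R) :
  measurable_fun setT h -> (forall x, 0 <= h x) ->
  \int[lift_vol]_(x in oball (n := d)) h x =
  \int[@vol R d]_(x in oball (n := d)) (((height x)^-1)%:E * h x).
Proof.
move=> mh h0.
have mhJ : measurable_fun setT (fun x : borelV R d => ((height x)^-1)%:E * h x).
  exact: (emeasurable_funM mJ mh).
have hJ0 x : 0 <= ((height x)^-1)%:E * h x by rewrite mule_ge0.
(* Of the d + 1 factors 1 + e, d come from comparing d-dimensional measures and one from replacing
   [height x] by [height a] in the density. *)
apply/le_anti/andP; split; apply: (@lee_factor _ (d + 1));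
  try (by apply: integral_ge0); move=> e e01.
- rewrite -ge0_integralZl//; last 2 first.
  + exact: measurable_funTS.
  + by case/andP: e01 => e0 _; rewrite lee_fin exprn_ge0; lra.
  apply: local_integral_le => //.
  + by apply: measurable_funeM.
  + by move=> x; rewrite mule_ge0// lee_fin exprn_ge0//; case/andP: e01 => ? _; lra.
  move=> a a1; have [r r0 [loc hts]] := local a1 e01; have ha := height_gt0 a1.
  exists r, ((1 + e) ^+ d * (height a)^-1)%R; split => //.
  + by rewrite mulr_ge0 ?invr_ge0 ?(ltW ha)// exprn_ge0//; case/andP: e01 => ? _; lra.
  + by move=> B mB BU; have [] := loc B mB BU.
  move=> x x1 xr; have [_ hxa] := hts x x1 xr; have hx := height_gt0 x1.
  rewrite muleA lee_wpmul2r// -EFinM lee_fin addn1 exprSr -mulrA ler_wpM2l//.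
    by rewrite exprn_ge0//; case/andP: e01 => ? _; lra.
  by rewrite -ler_pdivrMr ?invr_gt0// invrK mulrC ler_pdivrMr// mulrC.
rewrite -ge0_integralZl//; last 2 first.
- exact: measurable_funTS.
- by case/andP: e01 => e0 _; rewrite lee_fin exprn_ge0; lra.
apply: local_integral_le => //.
- by apply: measurable_funeM.
- by move=> x; rewrite mule_ge0// lee_fin exprn_ge0//; case/andP: e01 => ? _; lra.
move=> a a1; have [r r0 [loc hts]] := local a1 e01; have ha := height_gt0 a1.
exists r, ((1 + e) ^+ d * height a)%R; split => //.
- by rewrite mulr_ge0 ?(ltW ha)// exprn_ge0//; case/andP: e01 => ? _; lra.
- by move=> B mB BU; have [] := loc B mB BU.
move=> x x1 xr; have [hax _] := hts x x1 xr; have hx := height_gt0 x1.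
rewrite muleA lee_wpmul2r// -EFinM lee_fin addn1 exprSr -mulrA ler_wpM2l//.
  by rewrite exprn_ge0//; case/andP: e01 => ? _; lra.
by rewrite ler_pdivrMr.
Qed.

Lemma ge0_integral_upper (h : borelV R (d + 1) -> \bar R) :
  measurable_fun setT h -> (forall x, 0 <= h x) ->
  \int[hausB (d + 1) d]_(z in upper (n := d)) h z =
  \int[@vol R d]_(x in oball (n := d)) (((height x)^-1)%:E * h (lift x)).
Proof.
move=> mh h0.
have mhl : measurable_fun setT (fun x : borelV R d => h (lift x)).
  exact: (measurableT_comp mh (@measurable_lift R d)).
rewrite -(ge0_integral_lift_vol mhl)//.
rewrite (@ge0_integral_transfer _ _ (borelV R (d + 1)) (borelV R d) R
  (fun z : 'rV[R]_(d + 1) => lsubmx z) (mrestr (@hausB R (d + 1) d) (@measurable_upper R d))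
  lift_vol 1 (oball (n := d)) (@measurable_lsubmx R d))//; last 2 first.
- by move=> A _ _; rewrite mul1e.
- exact: measurable_funTS.
rewrite mul1e; set P := _ @^-1` _.
have mP : measurable (P : set (borelV R (d + 1))).
  by rewrite -[X in measurable X]setTI; exact: measurable_lsubmx.
have uP : upper (n := d) `<=` P by move=> z /upper_lift[].
rewrite ge0_integral_mrestr//; last first.
  by apply: measurable_funTS; exact: (measurableT_comp mhl (@measurable_lsubmx R d)).
rewrite (setIidr uP); apply: eq_integral => z /set_mem /upper_lift[_ zl].
by rewrite zl.
Qed.

End area_formula.

(** * Null sets and slices of the hemisphere *)

Section null_sets.
Variable R : realType.
Local Open Scope ereal_scope.

Lemma hausdorff_subset_null m s (A B : set 'rV[R]_m) : A `<=` B -> hausdorff s B = 0 ->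
  hausdorff s A = 0.
Proof.
move=> AB B0; apply/eqP; rewrite eq_le hausdorff_ge0 andbT -B0.
exact: le_hausdorff.
Qed.

Lemma hausdorff_bigcup_null m s (F : nat -> set 'rV[R]_m) :
  (forall i, hausdorff s (F i) = 0) -> hausdorff s (\bigcup_i F i) = 0.
Proof.
move=> F0; apply/eqP; rewrite eq_le hausdorff_ge0 andbT.
apply: (le_trans (@hausdorff_sigma_subadditive R m s F)).
by rewrite eseries0// => i _ _; exact: F0.
Qed.

Lemma hausdorff_setU_null m s (A B : set 'rV[R]_m) :
  hausdorff s A = 0 -> hausdorff s B = 0 -> hausdorff s (A `|` B) = 0.
Proof.
move=> A0 B0; apply/eqP; rewrite eq_le hausdorff_ge0 andbT.
by have := outer_measureU2 (hausdorff_om R m s) A B; rewrite /= A0 B0 adde0.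
Qed.

Lemma hausdorff_lipschitz_null m m' s (L : R) (g : 'rV[R]_m -> 'rV[R]_m') A : (0 < L)%R ->
  (forall x y, A x -> A y -> (enorm (g x - g y) <= L * enorm (x - y))%R) ->
  hausdorff s A = 0 -> hausdorff s (g @` A) = 0.
Proof.
move=> L0 gL A0; apply/eqP; rewrite eq_le hausdorff_ge0 andbT.
by apply: (le_trans (hausdorff_lipschitz s L0 gL)); rewrite A0 mule0.
Qed.

(** The closed ball is contained in the open one dilated by 1 + e, for every e > 0, so both have the
    same finite measure. *)
Lemma sphere_null m : hausdorff m [set x : 'rV[R]_m | enorm x = 1%R] = 0.
Proof.
pose C := [set x : 'rV[R]_m | (enorm x <= 1)%R].
have mC : measurable (C : set (borelV R m)).
  by apply: measurable_le_fun => //; apply: measurable_enorm; exact: measurable_id.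
have BC : oball (n := m) `<=` C by move=> x /ltW.
have Cfin : hausdorff m C < +oo.
  apply: (@le_lt_trans _ _ (vol (@cube R m 1))); last exact: vol_cube_lty.
  apply: le_hausdorff => x Cx i.
  exact: le_trans (coord_le_enorm x i) Cx.
have CB : hausdorff m C <= hausdorff m (oball (n := m)).
  apply: (@lee_factor _ m); [exact: hausdorff_ge0|move=> e /andP[e0 _]].
  have e1 : (0 < 1 + e)%R by rewrite addr_gt0.
  apply: le_trans (hausdorff_image_scale 0%R _ e1); apply: le_hausdorff => x Cx.
  exists ((1 + e)^-1 *: x)%R; last by rewrite scalerA divff ?gt_eqF// scale1r addr0.
  rewrite /oball/= enormZ gtr0_norm ?invr_gt0// mulrC ltr_pdivrMr// mul1r.
  by rewrite (le_lt_trans Cx)// ltrDl.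
have eqBC : hausdorff m C = hausdorff m (oball (n := m)).
  by apply/le_anti; rewrite CB le_hausdorff.
have fB : @hausdorff R m m (oball (n := m)) \is a fin_num.
  by rewrite -eqBC ge0_fin_numE ?hausdorff_ge0.
have := hausdorff_setD_null (@caratheodory_borel R m m _ (@measurable_oball R m))
  (@caratheodory_borel R m m _ mC) BC fB eqBC.
apply: hausdorff_subset_null => x /= x1; split; first by rewrite /C/= x1.
by rewrite /oball/= x1 ltxx.
Qed.

Definition equator n : set 'rV[R]_(n + 1) := [set x | enorm x = 1%R /\ xlast x = 0%R].

Lemma measurable_equator n : measurable (@equator n : set (borelV R (n + 1))).
Proof.
apply: (@measurableI _ (borelV R (n + 1)) [set z | enorm z = 1%R] [set z | xlast z = 0%R]).
  by apply: measurable_eq_fun => //; apply: measurable_enorm; exact: measurable_id.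
by apply: measurable_eq_fun => //; exact: measurable_xlast.
Qed.

(** The equator is an isometric copy of the unit sphere of R^n. *)
Lemma equator_null n : hausdorff n (@equator n) = 0.
Proof.
have snoc0 (x y : 'rV[R]_n) : (enorm (snocv x 0 - snocv y 0) <= 1 * enorm (x - y))%R.
  by rewrite mul1r snocvB subrr enorm_snocv0.
apply: (@hausdorff_subset_null _ _ _ ((fun x : 'rV[R]_n => snocv x 0%R) @` [set x | enorm x = 1%R])).
  move=> z [z1 z0]; exists (lsubmx z); last by rewrite -z0 snocv_eta.
  by rewrite /= -z1 -[z in RHS]snocv_eta z0 enorm_snocv0.
apply: (@hausdorff_lipschitz_null _ _ _ 1%R) => //.
exact: sphere_null.
Qed.

Lemma hemisphereE n : @hemisphere R n = upper (n := n) `|` @equator n.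
Proof.
apply/seteqP; split => [x [x1]|x [[x1 /ltW]|[x1 x0]]]; last by split; rewrite ?x0.
  by rewrite le_eqVlt => /predU1P[x0|x0]; [right|left].
by move=> x0; split.
Qed.

Lemma measurable_hemisphere n : measurable (@hemisphere R n : set (borelV R (n + 1))).
Proof.
by rewrite hemisphereE; apply: measurableU; [exact: measurable_upper|exact: measurable_equator].
Qed.

Lemma enorm_lsubmx n (z : 'rV[R]_(n + 1)) : (enorm (lsubmx z) <= enorm z)%R.
Proof. by rewrite -[z in leRHS]snocv_eta enorm_le_snocv. Qed.

Lemma enorm_snocv_le n (v : 'rV[R]_n) w : (enorm (snocv v w) <= enorm v + `|w|)%R.
Proof.
have -> : snocv v w = (snocv v 0 + snocv 0 w)%R.
  by rewrite /snocv add_row_mx addr0; congr row_mx; apply/rowP => i; rewrite !mxE add0r.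
rewrite (le_trans (ler_enormD _ _))// enorm_snocv0 lerD2l.
rewrite (_ : enorm _ = `|w|%R)//; apply: enorm_eqP => //.
by rewrite dotv_snocv dotv0r add0r real_normK ?num_real.
Qed.

(** [lift] is not Lipschitz up to the boundary of the ball, which is therefore exhausted by the sets
    where the height is at least 1/(i+1). There the vertical part has Lipschitz constant i + 1, and
    the horizontal part adds 1. *)
Lemma lift_null n s (M : set 'rV[R]_n) : hausdorff s M = 0 ->
  hausdorff s (@lift R n @` (M `&` oball (n := n))) = 0.
Proof.
move=> M0; pose A (i : nat) := M `&` oball (n := n) `&` [set x | (i.+1%:R^-1 <= height x)%R].
have : hausdorff s (\bigcup_i (@lift R n @` A i)) = 0.
  apply: hausdorff_bigcup_null => i; apply: (@hausdorff_lipschitz_null _ _ _ i.+2%:R) => //.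
    move=> x y [[_ x1] hx] [[_ y1] hy]; rewrite /lift snocvB (le_trans (enorm_snocv_le _ _))//.
    rewrite -natr1 addrC mulrDl mul1r lerD2r heightB// normrN (le_trans (norm_dotv_le _ _))//.
    rewrite mulrC ler_wpM2r ?enorm_ge0// enormZ.
    have xy2 : (enorm (x + y) <= 2)%R.
      rewrite (le_trans (ler_enormD _ _))//; have h2 : (enorm x <= 1)%R by exact: ltW.
      by have h3 : (enorm y <= 1)%R by [exact: ltW]; lra.
    move: hx hy; rewrite /=; set p : R := i.+1%:R => hx hy.
    have p0 : (0 < p)%R by rewrite ltr0n.
    have pi0 : (0 < p^-1)%R by rewrite invr_gt0.
    have hxy : (0 < height x + height y)%R by apply: (lt_le_trans (addr_gt0 pi0 pi0)); exact: lerD.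
    rewrite gtr0_norm ?invr_gt0// mulrC ler_pdivrMr// (le_trans xy2)//.
    apply: (@le_trans _ _ (p * (p^-1 + p^-1))%R); last by rewrite ler_wpM2l ?(ltW p0)// lerD.
    by rewrite mulrDr divff ?gt_eqF.
  by apply: hausdorff_subset_null M0 => x [[]].
apply: hausdorff_subset_null => _ [x [Mx x1] <-].
have hx := height_gt0 x1; have [i] := ltr_add_invr hx; rewrite add0r => ih.
by exists i => //; exists x => //; split => //=; exact: ltW.
Qed.

End null_sets.

Section signed_integrals.
Variable R : realType.
Local Open Scope ereal_scope.

Lemma integralZ_gt0 d (T : measurableType d) (mu : {measure set T -> \bar R}) (D : set T)
    (c : R) (g : T -> \bar R) : (0 < c)%R -> measurable D -> measurable_fun D g ->
  \int[mu]_(x in D) (c%:E * g x) = c%:E * \int[mu]_(x in D) g x.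
Proof.
move=> c0 mD mg; rewrite (integralE mu) [in RHS](integralE mu) gt0_muleBr//.
rewrite -!ge0_integralZl ?lee_fin ?(ltW c0)//; last 2 first.
- exact: measurable_funeneg.
- exact: measurable_funepos.
congr (_ - _); apply: eq_integral => x _.
  by rewrite !funeposE maxe_pMr ?mule0 ?lee_fin ?(ltW c0).
by rewrite !funenegE maxe_pMr ?mule0 ?muleN ?lee_fin ?(ltW c0).
Qed.

Lemma integral_upper k (h : borelV R (1 + k + 1) -> \bar R) : measurable_fun setT h ->
  \int[hausB (1 + k + 1) (1 + k)]_(z in upper (n := 1 + k)) h z =
  \int[@vol R (1 + k)]_(x in oball (n := 1 + k)) (((height x)^-1)%:E * h (lift x)).
Proof.
move=> mh; rewrite (integralE (hausB (1 + k + 1) (1 + k))) [in RHS](integralE (@vol R (1 + k))).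
have J0 (x : 'rV[R]_(1 + k)) : 0 <= ((height x)^-1)%:E.
  by rewrite lee_fin invr_ge0 height_ge0.
rewrite !ge0_integral_upper//; [|exact: measurable_funeneg|exact: measurable_funepos].
congr (_ - _); apply: eq_integral => x _.
  by rewrite !funeposE maxe_pMr ?mule0.
by rewrite !funenegE maxe_pMr ?mule0 ?muleN.
Qed.

Lemma integral_hemisphere k (h : borelV R (1 + k + 1) -> \bar R) : measurable_fun setT h ->
  \int[hausB (1 + k + 1) (1 + k)]_(z in @hemisphere R (1 + k)) h z =
  \int[@vol R (1 + k)]_(x in oball (n := 1 + k)) (((height x)^-1)%:E * h (lift x)).
Proof.
move=> mh; rewrite -integral_upper// hemisphereE.
rewrite (integralE (hausB (1 + k + 1) (1 + k))) [in RHS](integralE (hausB (1 + k + 1) (1 + k))).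
have mE := @measurable_equator R (1 + k).
have DE : (upper (n := 1 + k) `|` @equator R (1 + k)) `\` @equator R (1 + k) = upper (n := 1 + k).
  apply/seteqP; split => [x [[//|]]|x xu]; first by [].
  by split; [left|move=> [_ x0]; move: xu => [_]; rewrite x0 ltxx].
have mU : measurable (upper (n := 1 + k) `|` @equator R (1 + k) : set (borelV R (1 + k + 1))).
  by apply: measurableU => //; exact: measurable_upper.
congr (_ - _); rewrite (@ge0_negligible_integral _ (borelV R (1 + k + 1)) R (hausB (1 + k + 1) (1 + k))
  _ (@equator R (1 + k)) _ mE mU) ?DE//.
- by apply: measurable_funTS; exact: measurable_funepos.
- exact: equator_null.
- by apply: measurable_funTS; exact: measurable_funeneg.
- exact: equator_null.
Qed.

Lemma integral_similarity m m' s (a : R) (g : 'rV[R]_m -> 'rV[R]_m') (D : set (borelV R m'))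
    (f : borelV R m' -> \bar R) : (0 < a)%R ->
  (forall x y, enorm (g x - g y) = (a * enorm (x - y))%R) ->
  measurable_fun setT (g : borelV R m -> borelV R m') ->
  measurable D -> D `<=` range g -> measurable_fun D f ->
  \int[hausB m' s]_(y in D) f y = (a ^+ s)%:E * \int[hausB m s]_(x in g @^-1` D) f (g x).
Proof.
move=> a0 ga mg mD Dg mf.
apply: (@integral_transfer _ _ (borelV R m) (borelV R m') R g (hausB m s) (hausB m' s)) => //.
- by rewrite exprn_ge0// ltW.
- move=> A mA AD; rewrite /hausB -(hausdorff_similarity _ _ a0 ga); congr hausdorff.
  apply/seteqP; split => [y Ay|_ [x Ax <-]//].
  by have [x _ xy] := Dg y (AD y Ay); exists x => //=; rewrite xy.
- exact: exprn_gt0.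
Qed.

End signed_integrals.

(** * Coordinates on the slices *)

Section slices.
Variables (R : realType) (k : nat) (theta : 'rV[R]_(1 + k)) (t : R).
Hypotheses (theta1 : enorm theta = 1) (t1 : `|t| < 1).
Local Open Scope ereal_scope.

Let s : R := Num.sqrt (1 - t ^+ 2).

Let t2 : (t ^+ 2 < 1)%R.
Proof. by rewrite -real_normK ?num_real// expr_lt1. Qed.

Let s0 : (0 < s)%R. Proof. by rewrite sqrtr_gt0 subr_gt0. Qed.

Let s2 : (s ^+ 2 = 1 - t ^+ 2)%R. Proof. by rewrite sqr_sqrtr// subr_ge0 ltW. Qed.

(* With s = sqrt (1 - t^2), two similarities of ratio s: disc_chart onto the
   hyperplane x . theta = t, sending the unit ball to the slice of the unit ball,
   and slice_chart above it, sending the unit sphere of R^(k+1) to tau theta t. *)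
Definition disc_chart (z : 'rV[R]_k) : 'rV[R]_(1 + k) := chart theta t (s *: z).

Definition slice_chart (y : 'rV[R]_(k + 1)) : 'rV[R]_(1 + k + 1) :=
  snocv (disc_chart (lsubmx y)) (s * xlast y).

Lemma disc_chartB x y : enorm (disc_chart x - disc_chart y) = (s * enorm (x - y))%R.
Proof.
rewrite /disc_chart chartB subrr -scalerBr; apply: enorm_eqP.
  by rewrite mulr_ge0 ?enorm_ge0// ltW.
by rewrite chart_dotv mul0r add0r dotvZl dotvZr exprMn sqr_enorm; ring.
Qed.

Lemma slice_chartB x y : enorm (slice_chart x - slice_chart y) = (s * enorm (x - y))%R.
Proof.
rewrite /slice_chart snocvB; apply: enorm_eqP; first by rewrite mulr_ge0 ?enorm_ge0// ltW.
rewrite dotv_snocv -sqr_enorm disc_chartB -mulrBr.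
have -> : (lsubmx x - lsubmx y = lsubmx (x - y))%R by apply/rowP => i; rewrite !mxE.
have -> : (xlast x - xlast y = xlast (x - y))%R by rewrite /xlast !mxE.
rewrite !exprMn -[X in _ = (_ * enorm X ^+ 2)%R]snocv_eta !sqr_enorm dotv_snocv; ring.
Qed.

Lemma dotv_disc_chart z : dotv (disc_chart z) (disc_chart z) = (t ^+ 2 + s ^+ 2 * dotv z z)%R.
Proof. by rewrite /disc_chart chart_dotv dotvZl dotvZr; ring. Qed.

Lemma disc_chart_oball z : oball (disc_chart z) <-> oball z.
Proof.
split => /oballP h; apply/oballP; move: h; rewrite dotv_disc_chart s2.
  by move: (dotv z z) => w h; rewrite -(ltr_pM2l (_ : 0 < 1 - t ^+ 2)%R) ?subr_gt0//; lra.
by move: (dotv z z) => w h; rewrite -(ltr_pM2l (_ : 0 < 1 - t ^+ 2)%R) ?subr_gt0// in h; lra.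
Qed.

Lemma height_disc_chart z : height (disc_chart z) = (s * height z)%R.
Proof.
rewrite /height dotv_disc_chart (_ : (1 - _ = s ^+ 2 * (1 - dotv z z))%R); last by rewrite s2; ring.
by rewrite sqrtrM ?sqr_ge0// sqrtr_sqr gtr0_norm.
Qed.

Lemma lift_disc_chart z : lift (disc_chart z) = slice_chart (lift z).
Proof. by rewrite /lift height_disc_chart /slice_chart lsubmx_snocv xlast_snocv. Qed.

Lemma slice_chart_hemisphere y :
  slice_chart y \in @hemisphere R (1 + k) `&` tau theta t <-> @hemisphere R k y.
Proof.
have dd : dotv (slice_chart y) (slice_chart y) = (t ^+ 2 + s ^+ 2 * dotv y y)%R.
  by rewrite /slice_chart -[y in RHS]snocv_eta !dotv_snocv dotv_disc_chart; ring.
have ss : (0 < 1 - t ^+ 2)%R by rewrite subr_gt0.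
rewrite inE; split => [[[/enorm1P + y0] _]|[/enorm1P y1 y0]].
  rewrite dd s2 => h; split.
    by apply/enorm1P; apply: (mulfI (lt0r_neq0 ss)); move: h; lra.
  by move: y0; rewrite /slice_chart xlast_snocv pmulr_rge0.
have y1' : enorm (slice_chart y) = 1%R by apply/enorm1P; rewrite dd y1 s2; lra.
split; split => //; first by rewrite /slice_chart xlast_snocv mulr_ge0// ltW.
by rewrite /slice_chart lsubmx_snocv /disc_chart chart_theta.
Qed.

Lemma measurable_disc_chart :
  measurable_fun [set: borelV R k] (disc_chart : borelV R k -> borelV R (1 + k)).
Proof.
apply: (measurableT_comp (measurable_chart2 theta t)).
by apply: measurable_rowZ => //; exact: measurable_id.
Qed.

Lemma measurable_slice_chart : measurable_fun [set: borelV R (k + 1)]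
  (slice_chart : borelV R (k + 1) -> borelV R (1 + k + 1)).
Proof.
apply: measurable_snocv; last by apply: measurable_funM => //; exact: measurable_xlast.
exact: (measurableT_comp measurable_disc_chart (@measurable_lsubmx R k)).
Qed.

Lemma hyperplane_disc_chart : hyperplane theta t `<=` range disc_chart.
Proof.
move=> x xt; have [y ->] := chart_surj x theta1; exists (s^-1 *: y)%R => //.
by rewrite /disc_chart scalerA divff ?gt_eqF// scale1r xt.
Qed.

Lemma tau_slice_chart : tau theta t `<=` range slice_chart.
Proof.
move=> x [_ /hyperplane_disc_chart[z _ zx]]; exists (snocv z (s^-1 * xlast x)%R) => //.
rewrite /slice_chart lsubmx_snocv xlast_snocv zx mulrA divff ?gt_eqF// mul1r.
exact: snocv_eta.
Qed.

Lemma measurable_hemisphere_tau :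
  measurable (@hemisphere R (1 + k) `&` tau theta t : set (borelV R (1 + k + 1))).
Proof.
rewrite (_ : _ `&` _ = @hemisphere R (1 + k) `&` [set x | dotv (lsubmx x) theta = t]).
  apply: measurableI; first exact: measurable_hemisphere.
  apply: measurable_eq_fun => //; apply: measurable_dotv => //; exact: measurable_lsubmx.
by apply/seteqP; split => x [[? ?]]; [case=> _|] => ?; split.
Qed.

Lemma measurable_hyperplane : measurable (hyperplane theta t : set (borelV R (1 + k))).
Proof.
by apply: measurable_eq_fun => //; apply: measurable_dotv => //; exact: measurable_id.
Qed.

Lemma slice_radon (g : borelV R (1 + k) -> \bar R) : measurable_fun setT g ->
  \int[HM (1 + k) k]_(x in hyperplane theta t) g x =
  (s ^+ k)%:E * \int[@vol R k]_z g (disc_chart z).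
Proof.
move=> mg; have mH := measurable_hyperplane.
rewrite integral_HM//; last exact: measurable_funTS.
rewrite (integral_similarity _ s0 disc_chartB measurable_disc_chart mH hyperplane_disc_chart);
  last exact: measurable_funTS.
congr (_ * _); rewrite (_ : disc_chart @^-1` _ = setT)//; apply/seteqP; split => z // _.
by rewrite /hyperplane/= /disc_chart chart_theta.
Qed.

Lemma slice_tau (g : borelV R (1 + k + 1) -> \bar R) : measurable_fun setT g ->
  \int[HM (1 + k + 1) k]_(x in @hemisphere R (1 + k) `&` tau theta t) g x =
  (s ^+ k)%:E * \int[hausB (k + 1) k]_(y in @hemisphere R k) g (slice_chart y).
Proof.
move=> mg; have mH := measurable_hemisphere_tau.
rewrite integral_HM//; last exact: measurable_funTS.
rewrite (integral_similarity _ s0 slice_chartB measurable_slice_chart mH); last 2 first.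
- by move=> x [_]; exact: tau_slice_chart.
- exact: measurable_funTS.
congr (_ * _); rewrite (_ : slice_chart @^-1` _ = @hemisphere R k)//.
apply/seteqP; split => y; first by move=> h; apply/slice_chart_hemisphere; rewrite inE.
by move=> /slice_chart_hemisphere; rewrite inE.
Qed.

(** In the coordinates of [slice_chart], the part of the slice lying over a null set of the
    hyperplane is the lift of a null set of the ball, up to the equator. This shows which slices are
    insensitive to a change of [f] on [N]. *)
Lemma hemisphere_tau_null (N : set 'rV[R]_(1 + k + 1)) (M : set 'rV[R]_(1 + k)) :
  (forall x, N x -> M (lsubmx x)) ->
  hausdorff k [set y | M (chart theta t y)] = 0 ->
  hausdorff k (@hemisphere R (1 + k) `&` tau theta t `&` N) = 0.
Proof.
move=> NM M0.
have M'0 : hausdorff k [set z | M (disc_chart z)] = 0.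
  apply: (@hausdorff_subset_null _ _ _ _ ((fun z => s^-1 *: z)%R @` [set y | M (chart theta t y)])).
    by move=> z Mz; exists (s *: z)%R => //; rewrite scalerA mulVf ?gt_eqF// scale1r.
  apply: (@hausdorff_lipschitz_null _ _ _ _ s^-1) => //; first by rewrite invr_gt0.
  by move=> x y _ _; rewrite -scalerBr enormZ gtr0_norm ?invr_gt0.
apply: (@hausdorff_subset_null _ _ _ _
  (slice_chart @` (@equator R k `|` @lift R k @` ([set z | M (disc_chart z)] `&` oball (n := k))))).
  move=> x [xD Nx]; have [y _ yx] := tau_slice_chart xD.2; exists y => //.
  have : @hemisphere R k y by apply/slice_chart_hemisphere; rewrite inE yx.
  rewrite hemisphereE => -[/upper_lift[y1 ly]|]; [right|by left].
  exists (lsubmx y) => //; split => //=; have := NM _ Nx.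
  by rewrite -yx /slice_chart lsubmx_snocv.
apply: (@hausdorff_lipschitz_null _ _ _ _ s) => //.
  by move=> x y _ _; rewrite slice_chartB.
apply: hausdorff_setU_null; first exact: equator_null.
exact: lift_null.
Qed.

End slices.

Section slice_identity.
Variable R : realType.
Local Open Scope ereal_scope.

(* The function psi of the theorem: f(x) / x_(n+1) at the point x above x'. *)
Definition flatten n (F : 'rV[R]_(n + 1) -> R) (x : 'rV[R]_n) : R :=
  (\1_(oball (n := n)) x * ((height x)^-1 * F (lift x)))%R.

Lemma measurable_flatten n (F : borelV R (n + 1) -> R) : measurable_fun setT F ->
  measurable_fun [set: borelV R n] (flatten F : borelV R n -> R).
Proof.
move=> mF; apply: measurable_funM.
  by apply: measurable_indic; exact: measurable_oball.
apply: measurable_funM; last exact: (measurableT_comp mF (@measurable_lift R n)).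
by apply/measurable_EFinP; exact: measurable_height_inv.
Qed.

Lemma flatten_out n (F : 'rV[R]_(n + 1) -> R) x : ~ oball x -> flatten F x = 0%R.
Proof. by move=> x1; rewrite /flatten indicE memNset// mul0r. Qed.

Lemma flatten_in n (F : 'rV[R]_(n + 1) -> R) x : oball x ->
  flatten F x = ((height x)^-1 * F (lift x))%R.
Proof. by move=> x1; rewrite /flatten indicE mem_set// mul1r. Qed.

(** Both sides become integrals over the unit ball of R^(1+k) with the same factor s^k. The
    prefactor of [Phi] is the 1/s hidden in [height (disc_chart z) = s * height z]. The ambient
    dimension 1 + (1 + k) leaves a slice to which the area formula still applies. *)
Lemma Phi_radon_flatten k (F : borelV R (1 + (1 + k) + 1) -> R) theta t :
  measurable_fun setT F -> enorm theta = 1%R -> Phi F theta t = radon (flatten F) theta t.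
Proof.
move=> mF theta1; rewrite /Phi; case: ifPn => [t1|].
  rewrite /Vplus /radon slice_tau//; last exact/measurable_EFinP.
  rewrite slice_radon//; last by apply/measurable_EFinP; exact: measurable_flatten.
  have s0 : (0 < Num.sqrt (1 - t ^+ 2))%R.
    by rewrite sqrtr_gt0 subr_gt0 -real_normK ?num_real// expr_lt1.
  have mFs : measurable_fun [set: borelV R (1 + k + 1)] (fun y => (F (slice_chart theta t y))%:E).
    by apply/measurable_EFinP; exact: (measurableT_comp mF (measurable_slice_chart theta t)).
  rewrite muleCA integral_hemisphere//; congr (_ * _).
  have mI : measurable_fun (oball (n := 1 + k) : set (borelV R (1 + k)))
      (fun x => ((height x)^-1)%:E * (F (slice_chart theta t (lift x)))%:E).
    apply: emeasurable_funM; first by apply: measurable_funTS; exact: measurable_height_inv.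
    by apply: measurable_funTS; exact: (measurableT_comp mFs (@measurable_lift R (1 + k))).
  rewrite -integralZ_gt0 ?invr_gt0//; last exact: measurable_oball.
  rewrite integral_mkcond; apply: eq_integral => z _; rewrite patchE.
  case: ifPn => [/set_mem z1|/negP z1].
    rewrite flatten_in ?disc_chart_oball// lift_disc_chart// height_disc_chart//.
    by rewrite -!EFinM invfM mulrA.
  by rewrite flatten_out// disc_chart_oball// => z1'; apply: z1; rewrite inE.
(* For |t| >= 1 the hyperplane misses the open ball, by Cauchy-Schwarz. *)
rewrite -leNgt => t1; rewrite /radon integral0_eq// => x xt; rewrite flatten_out// => x1.
move: t1; rewrite leNgt => /negP; apply; rewrite -xt.
by rewrite (le_lt_trans (norm_dotv_le _ _))// theta1 mulr1.
Qed.

End slice_identity.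

(** * Injectivity of the Radon transform *)

Section laplace_injective.
Variables (R : realType) (m : nat).
Local Open Scope ereal_scope.
Local Notation V := (borelV R m).
Local Notation B := (@oball R m).
Variable g : V -> R.
Hypotheses (mg : measurable_fun setT g) (ig : (@vol R m).-integrable (B : set V) (EFin \o g)).

Let mB : measurable (B : set V). Proof. exact: measurable_oball. Qed.

Let pairing (u : V -> R) (xi : 'rV[R]_m) :=
  \int[@vol R m]_(x in (B : set V)) (g x * u x * expR (dotv x xi))%:E.

(** Vanishing is required at every frequency: multiplying [u] by an exponential then merely shifts
    [xi], so the class is stable under it. The bound on the ball is what dominated convergence
    uses. *)
Let test (u : V -> R) := [/\ measurable_fun setT u,
  (exists M : R, forall x, B x -> (`|u x| <= M)%R) & forall xi, pairing u xi = 0].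

Let mexp (xi : 'rV[R]_m) : measurable_fun [set: V] (fun x : V => expR (dotv x xi)).
Proof.
apply: measurableT_comp => //; apply: measurable_dotv => //; exact: measurable_id.
Qed.

Let exp_le (x xi : 'rV[R]_m) : B x -> (expR (dotv x xi) <= expR (enorm xi))%R.
Proof.
move=> Bx; rewrite ler_expR (le_trans (dotv_le _ _))// ler_piMl ?enorm_ge0//.
exact: ltW.
Qed.

Let integrand_measurable u xi : measurable_fun setT u ->
  measurable_fun (B : set V) (fun x => (g x * u x * expR (dotv x xi))%:E).
Proof.
move=> mu; apply/measurable_EFinP; apply: measurable_funTS; apply: measurable_funM => //.
exact: measurable_funM.
Qed.

Let integrand_integrable (u : V -> R) xi (M : R) : measurable_fun setT u ->
  (forall x, B x -> (`|u x| <= M)%R) ->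
  (@vol R m).-integrable (B : set V) (fun x => (g x * u x * expR (dotv x xi))%:E).
Proof.
move=> mu uM.
have ib : (@vol R m).-integrable (B : set V)
    (fun x => (M * expR (enorm xi))%:E * (EFin \o g) x) by exact: integrableZl.
apply: le_integrable ib => //; first exact: integrand_measurable.
move=> x Bx /=; rewrite lee_fin !normrM.
rewrite [leRHS]mulrC -mulrA ler_wpM2l//.
have M0 : (0 <= M)%R by rewrite (le_trans _ (uM x Bx)).
rewrite (ger0_norm M0) !(ger0_norm (expR_ge0 _)).
by rewrite ler_pM ?expR_ge0 ?uM ?exp_le.
Qed.

Let test_lim (u_ : nat -> V -> R) (u : V -> R) (M : R) :
  (forall n, test (u_ n)) -> (forall n x, B x -> (`|u_ n x| <= M)%R) ->
  measurable_fun setT u -> (forall x, B x -> u_ n x @[n --> \oo] --> u x) -> test u.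
Proof.
move=> tu uM mu uu; split => //.
  exists M => x Bx; have cv : `|u_ n x|%R @[n --> \oo] --> `|u x|%R by apply: cvg_norm; exact: uu.
  rewrite -(cvg_lim _ cv)//; apply: limr_le; first by apply/cvg_ex; exists `|u x|%R.
  by apply: nearW => n; exact: uM.
move=> xi.
have mu_ n : measurable_fun setT (u_ n) by case: (tu n).
have ib : (@vol R m).-integrable (B : set V)
    (fun x => (M * expR (enorm xi))%:E * `|(EFin \o g) x|).
  by apply: integrableZl => //; exact: integrable_abse.
have acv : {ae @vol R m, forall x, (B : set V) x -> (g x * u_ n x * expR (dotv x xi))%:E @[n --> \oo] -->
    (g x * u x * expR (dotv x xi))%:E}.
  apply: aeW => x Bx; apply: cvg_EFin; first exact: nearW.
  by apply: cvgM; [apply: cvgM; [exact: cvg_cst|exact: uu]|exact: cvg_cst].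
have adom : {ae @vol R m, forall x n, (B : set V) x ->
    `|(g x * u_ n x * expR (dotv x xi))%:E| <= (M * expR (enorm xi))%:E * `|(EFin \o g) x|}.
  apply: aeW => x n Bx; rewrite /= lee_fin !normrM [leRHS]mulrC -mulrA ler_wpM2l//.
  by rewrite (ger0_norm (expR_ge0 _)) ler_pM ?expR_ge0 ?uM ?exp_le.
have [_ _] := @dominated_convergence _ V R (@vol R m) B mB
  (fun n x => (g x * u_ n x * expR (dotv x xi))%:E) (fun x => (g x * u x * expR (dotv x xi))%:E)
  (fun x => (M * expR (enorm xi))%:E * `|(EFin \o g) x|)
  (fun n => @integrand_measurable _ xi (mu_ n)) (@integrand_measurable _ xi mu)
  acv ib adom.
rewrite (_ : [sequence _]_n = cst 0); last first.
  by apply/funext => n /=; case: (tu n) => _ _; apply.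
by move=> h; rewrite /pairing -(cvg_lim _ h)// lim_cst.
Qed.

Let testB u v : test u -> test v -> test (fun x => u x - v x)%R.
Proof.
move=> [mu [M uM] tu] [mv [M' vM'] tv]; split.
- exact: measurable_funB.
- by exists (M + M')%R => x Bx; rewrite (le_trans (ler_normB _ _))// lerD ?uM ?vM'.
move=> xi; rewrite /pairing; under eq_integral do rewrite mulrBr mulrBl EFinB.
rewrite integralB//; last 2 first.
- exact: integrand_integrable uM.
- exact: integrand_integrable vM'.
by have := tu xi; have := tv xi; rewrite /pairing => -> ->; rewrite sube0.
Qed.

Let test_exp u eta c : test u -> test (fun x => u x * (c * expR (dotv x eta)))%R.
Proof.
move=> [mu [M uM] tu]; split.
- by apply: measurable_funM => //; apply: measurable_funM => //; exact: mexp.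
- exists (M * (`|c| * expR (enorm eta)))%R => x Bx; rewrite !normrM (ger0_norm (expR_ge0 _)).
  by rewrite ler_pM ?uM ?mulr_ge0 ?expR_ge0// ler_wpM2l ?exp_le.
move=> xi; rewrite /pairing.
under eq_integral => x _.
  rewrite (_ : (g x * (u x * (c * expR (dotv x eta))) * expR (dotv x xi))%:E =
    c%:E * (g x * u x * expR (dotv x (eta + xi)))%:E); last first.
    by rewrite -EFinM dotvDr expRD; congr EFin; ring.
  over.
rewrite integralZl//; last exact: integrand_integrable uM.
by have := tu (eta + xi)%R; rewrite /pairing => ->; rewrite mule0.
Qed.

Let test_pow u eta c K : test u ->
  test (fun x => u x * (1 - c * expR (dotv x eta)) ^+ K)%R.
Proof.
move=> tu; elim: K => [|K ih].
  by under eq_fun do rewrite expr0 mulr1.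
rewrite (_ : (fun x => _) = (fun x => u x * (1 - c * expR (dotv x eta)) ^+ K -
  u x * (1 - c * expR (dotv x eta)) ^+ K * (c * expR (dotv x eta)))%R).
  by apply: testB => //; exact: test_exp.
by apply/funext => x; rewrite exprS; ring.
Qed.

Let bernoulli (y : R) K : (0 <= y <= 1)%R -> (1 - K%:R * y <= (1 - y) ^+ K)%R.
Proof.
move=> /andP[y0 y1]; elim: K => [|K ih]; first by rewrite mul0r subr0 expr0.
have [h|h] := leP 0%R (1 - K%:R * y)%R.
  rewrite exprS; apply: (@le_trans _ _ ((1 - y) * (1 - K%:R * y))%R).
    rewrite -natr1; have : (0 <= K%:R * y * y)%R by rewrite !mulr_ge0.
    by lra.
  by rewrite ler_wpM2l//; lra.
rewrite (@le_trans _ _ 0%R)// ?exprn_ge0//; last by lra.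
by rewrite -natr1 mulrDl; lra.
Qed.

Let expRM_ge (z : R) : (0 <= z)%R -> (z ^+ 2 / 4 <= expR z)%R.
Proof.
move=> z0; have h : (0 <= z / 2 <= expR (z / 2))%R.
  apply/andP; split; first lra.
  by have := expR_ge1Dx (z / 2); lra.
have -> : expR z = (expR (z / 2) * expR (z / 2))%R by rewrite -expRD; congr expR; lra.
have -> : (z ^+ 2 / 4 = (z / 2) * (z / 2))%R by field.
by case/andP: h => h1 h2; rewrite ler_pM.
Qed.

(* (1 - exp (M (z - 1))) ^ K with K about M exp (M (1 - a)), which tends to
   the indicator function of z < a as M goes to infinity. *)
Let K_ (a : R) (n : nat) : nat := (Num.truncn (n.+1%:R * expR (n.+1%:R * (1 - a)))).+1.

Let cutoff (a : R) (n : nat) (z : R) : R :=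
  ((1 - expR (n.+1%:R * (z - 1))) ^+ K_ a n)%R.

Let cutoff01 a n z : (z <= 1)%R -> (0 <= cutoff a n z <= 1)%R.
Proof.
move=> z1; have h : (expR (n.+1%:R * (z - 1)) <= 1)%R.
  by rewrite -[leRHS]expR0 ler_expR pmulr_rle0//; lra.
rewrite /cutoff exprn_ge0 ?exprn_ile1//=; have := expR_ge0 (n.+1%:R * (z - 1))%R; lra.
Qed.

Let K_bounds a n : (n.+1%:R * expR (n.+1%:R * (1 - a)) <= (K_ a n)%:R <=
  n.+1%:R * expR (n.+1%:R * (1 - a)) + 1)%R.
Proof.
have h : (0 <= n.+1%:R * expR (n.+1%:R * (1 - a)))%R by rewrite mulr_ge0 ?expR_ge0.
have /andP[h1 h2] := truncn_itv h.
by rewrite /K_ (ltW h2)/= -natr1 lerD2r.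
Qed.

Let cvg_harmonic_bound (w : nat -> R) (l C : R) :
  (forall n, `|w n - l| <= C * n.+1%:R^-1)%R -> w n @[n --> \oo] --> l.
Proof.
move=> h; apply/subr_cvg0/norm_cvg0P.
apply: (@squeeze_cvgr _ _ _ _ (cst 0%R) (fun n => C * harmonic n)%R).
- by apply: nearW => n /=; rewrite normr_ge0 h.
- exact: cvg_cst.
- by rewrite -(mulr0 C); apply: cvgMr; exact: cvg_harmonic.
Qed.

(** By Bernoulli, 1 - (1 - y)^K is at most K y, hence at most N exp (N (z - a)) + y, the last term
    being due to rounding [K] up. Both terms are O(1/N), the first because exp w >= w^2/4. *)
Let cutoff_lt (a z : R) : (z < 1)%R -> (z < a)%R -> cutoff a n z @[n --> \oo] --> (1%R : R).
Proof.
move=> z1 za; have d0 : (0 < a - z)%R by rewrite subr_gt0.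
have d'0 : (0 < 1 - z)%R by rewrite subr_gt0.
apply: (@cvg_harmonic_bound _ _ (4 / (a - z) ^+ 2 + (1 - z)^-1)%R) => n.
have /andP[c0 c1] := cutoff01 a n (ltW z1).
rewrite distrC ger0_norm ?subr_ge0//; set N : R := n.+1%:R.
have N0 : (0 < N)%R by rewrite ltr0n.
set y := expR (N * (z - 1))%R.
have y0 : (0 <= y)%R by exact: expR_ge0.
have y1 : (y <= 1)%R by rewrite -[leRHS]expR0 ler_expR pmulr_rle0//; lra.
have yb : (y <= (1 - z)^-1 * N^-1)%R.
  have -> : y = (expR (N * (1 - z)))^-1%R by rewrite -expRN; congr expR; ring.
  rewrite -invfM lef_pV2 ?posrE ?expR_gt0 ?mulr_gt0//.
  by have := expR_ge1Dx (N * (1 - z))%R; lra.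
have zb : (N * expR (N * (z - a)) <= 4 / (a - z) ^+ 2 * N^-1)%R.
  have -> : (expR (N * (z - a)) = (expR (N * (a - z)))^-1)%R by rewrite -expRN; congr expR; ring.
  have -> : (4 / (a - z) ^+ 2 * N^-1 = N * ((N * (a - z)) ^+ 2 / 4)^-1)%R.
    by field; rewrite !gt_eqF.
  rewrite ler_pM2l// lef_pV2 ?posrE ?expR_gt0//.
    by apply: expRM_ge; rewrite mulr_ge0// ltW.
  by rewrite divr_gt0// exprn_gt0// mulr_gt0.
have /andP[_ kb] := K_bounds a n.
have Ky : ((K_ a n)%:R * y <= N * expR (N * (z - a)) + y)%R.
  apply: (le_trans (ler_wpM2r y0 kb)); rewrite mulrDl mul1r -/N -mulrA /y -expRD lerD2r.
  by rewrite ler_wpM2l ?(ltW N0)// ler_expR; lra.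
have := @bernoulli y (K_ a n); rewrite y0 y1 => /(_ isT); rewrite -/(cutoff a n z) => bb.
rewrite mulrDl; apply: (le_trans _ (lerD zb yb)); apply: (le_trans _ Ky).
by rewrite lerBlDr addrC -lerBlDr.
Qed.

(** The factor N in [K_] gives K y >= N even at z = a, so the limit there is 0 and the strict
    inequality is obtained exactly. Then (1 - y)^K <= exp (- K y) <= 1/N. *)
Let cutoff_ge (a z : R) : (z < 1)%R -> (a <= z)%R -> cutoff a n z @[n --> \oo] --> (0%R : R).
Proof.
move=> z1 az; apply: (@cvg_harmonic_bound _ _ 1%R) => n.
have /andP[c0 c1] := cutoff01 a n (ltW z1).
rewrite subr0 ger0_norm// mul1r; set N : R := n.+1%:R.
have N0 : (0 < N)%R by rewrite ltr0n.
set y := expR (N * (z - 1))%R.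
have y1 : (y <= 1)%R by rewrite -[leRHS]expR0 ler_expR pmulr_rle0//; lra.
have /andP[kb _] := K_bounds a n.
have Ky : (N <= (K_ a n)%:R * y)%R.
  apply: (@le_trans _ _ (N * expR (N * (1 - a)) * y)%R); last by rewrite ler_wpM2r// expR_ge0.
  rewrite -mulrA /y -expRD ler_peMr ?(ltW N0)//.
  rewrite -[leLHS]expR0 ler_expR -mulrDr mulr_ge0 ?(ltW N0)//; lra.
apply: (@le_trans _ _ (expR (- y) ^+ K_ a n)%R).
  rewrite /cutoff -/N -/y ler_pXn2r ?nnegrE ?expR_ge0//; last by lra.
  by have := expR_ge1Dx (- y)%R; lra.
rewrite -expRM_natl mulrN expRN lef_pV2 ?posrE ?expR_gt0//.
by have := expR_ge1Dx ((K_ a n)%:R * y)%R; lra.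
Qed.

Let dotv_delta (x : 'rV[R]_m) i : dotv x (delta_mx ord0 i) = x ord0 i.
Proof.
rewrite /dotv (bigD1 i)//= mxE !eqxx mulr1 big1 ?addr0// => j ji.
by rewrite mxE (negbTE ji) andbF mulr0.
Qed.

Let test_halfspace (u : V -> R) i a : test u ->
  test (fun x => u x * \1_[set x : V | (x ord0 i < a)%R] x)%R.
Proof.
move=> tu; have [mu [M uM] _] := tu.
have x1 x : B x -> (x ord0 i < 1)%R.
  by move=> Bx; rewrite (le_lt_trans (ler_norm _))// (le_lt_trans (coord_le_enorm _ _)).
apply: (@test_lim (fun n x => u x * cutoff a n (x ord0 i))%R _ M).
(* The cutoff is a power of 1 - c exp (x . eta) with c = exp (-N) and eta = N e_i, the form handled
   by [test_pow]. The shift by 1 in its exponent suits the unit ball, where x_i < 1 keeps it between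
   0 and 1. *)
- move=> n; rewrite (_ : (fun x => _) = (fun x => u x * (1 - expR (- n.+1%:R) *
    expR (dotv x (n.+1%:R *: delta_mx ord0 i))) ^+ K_ a n)%R); first exact: test_pow.
  apply/funext => x; rewrite /cutoff dotvZr dotv_delta -expRD; congr (_ * (1 - expR _) ^+ _)%R.
  by ring.
- move=> n x Bx; have /andP[c0 c1] := cutoff01 a n (ltW (x1 x Bx)).
  by rewrite normrM (ger0_norm c0) (le_trans _ (uM x Bx))// ler_piMr.
- apply: measurable_funM => //; apply: measurable_indic.
  by apply: sub_sigma_algebra; exists i, a.
move=> x Bx; apply: cvgMr; rewrite indicE.
have [xa|ax] := ltP (x ord0 i) a.
  by rewrite mem_set//; apply: cutoff_lt => //; exact: x1.
rewrite memNset; last by apply/negP; rewrite -leNgt.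
by apply: cutoff_ge => //; exact: x1.
Qed.

(* Stable under complements and increasing limits by testB and test_lim. *)
Let good (A : set V) := measurable A /\ forall u, test u -> test (fun x => u x * \1_A x)%R.

Let good_setC A : good A -> good (~` A).
Proof.
move=> [mA tA]; split; first exact: measurableC.
move=> u tu; rewrite (_ : (fun x => _) = (fun x => u x - u x * \1_A x)%R).
  by apply: testB => //; exact: tA.
by apply/funext => x; rewrite !indicE in_setC; case: (x \in A); rewrite /=; ring.
Qed.

Let good_sigma_algebra : sigma_algebra setT good.
Proof.
split.
- split; first exact: measurable0.
  move=> u tu; rewrite (_ : (fun x => _) = (fun x => u x - u x)%R); first exact: testB.
  by apply/funext => x; rewrite indic0 mulr0 subrr.
- by move=> A gA; rewrite setTD; exact: good_setC.
(* The complement of a finite union has a product of indicators as its indicator, so it is reached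
   by successive multiplications; the complement of the whole union is then a decreasing limit, with
   no disjointness to arrange. *)
move=> A gA; rewrite -[X in good X]setCK; apply: good_setC.
have mC n : measurable (~` \bigcup_(i < n) A i).
  by apply: measurableC; apply: bigcup_measurable => i _; case: (gA i).
split; first by apply/measurableC/bigcup_measurable => i _; case: (gA i).
move=> u tu; have [mu [M uM] _] := tu.
apply: (@test_lim (fun n x => u x * \1_(~` \bigcup_(i < n) A i) x)%R _ M).
- elim=> [|n ih].
    rewrite (_ : (fun x => _) = u)//; apply/funext => x.
    by rewrite indicE mem_set ?mulr1// => -[].
  have [_ /(_ _ ih)] := good_setC (gA n); congr test; apply/funext => x.
  rewrite -mulrA; congr (_ * _)%R.
  rewrite !indicE -natrM mulnb -in_setI -setCU; congr (_ (_ \in ~` _))%:R.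
  by rewrite 2!bigcup_mkord big_ord_recr.
- move=> n x Bx; rewrite normrM (le_trans _ (uM x Bx))// ler_piMr//.
  by rewrite indicE; case: (_ \in _); rewrite ?normr1 ?normr0.
- apply: measurable_funM => //; apply: measurable_indic.
  by apply/measurableC/bigcup_measurable => i _; case: (gA i).
move=> x Bx; apply: cvgMr.
have [[k _ Ak]|nA] := pselect ((\bigcup_i A i) x).
  rewrite (_ : \1_(~` \bigcup_i A i) x = 0%R); last first.
    by rewrite indicE memNset//; apply; exists k.
  apply: cvg_near_cst; exists k.+1 => // n /= kn.
  by rewrite indicE memNset//; apply; exists k.
rewrite (_ : \1_(~` \bigcup_i A i) x = 1%R); last by rewrite indicE mem_set.
apply: cvg_near_cst; apply: nearW => n.
by rewrite indicE mem_set// => -[i _ Ai]; apply: nA; exists i.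
Qed.

Lemma laplace_transform_inj :
  (forall xi, \int[@vol R m]_(x in (B : set V)) (g x * expR (dotv x xi))%:E = 0) ->
  ae_eq (@vol R m) (B : set V) (EFin \o g) (cst 0).
Proof.
move=> g0; have t1 : test (cst 1%R).
  split; [exact: measurable_cst|by exists 1%R => x _; rewrite normr1|].
  by move=> xi; rewrite /pairing -[RHS](g0 xi); apply: eq_integral => x _; rewrite mulr1.
apply: integral_ae_eq => // A AB mA.
(* Starting from the constant 1, the frequency 0 yields that the integral of [g] over [A] is 0. *)
have [_ /(_ _ t1)[_ _ /(_ 0%R)]] : good A.
  suff : <<s @halfspaces R m >> `<=` good by apply.
  apply: smallest_sub; first exact: good_sigma_algebra.
  move=> _ [i [a ->]]; split; first by apply: sub_sigma_algebra; exists i, a.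
  by move=> u; exact: test_halfspace.
rewrite /pairing => tA; rewrite [RHS]integral0_eq// -tA -{1}(setIidr AB) integral_mkcondr.
apply: eq_integral => x _; rewrite patchE indicE dotv0r expR0 mulr1 mul1r.
by case: (x \in A); rewrite /= ?mulr1 ?mulr0.
Qed.

End laplace_injective.

#[local] Instance ae_lebesgue_filter (R : realType) :
  Filter (nbhs (almost_everywhere (@lebesgue_measure R))).
Proof. exact: ae_filter_ringOfSetsType. Qed.

(** * Functions known up to a Hausdorff null set *)

Section almost_everywhere_HM.
Variables (R : realType) (m s : nat).
Local Open Scope ereal_scope.
Local Notation mT := (caratheodory_type (hausdorff_om R m s)).

(** Negligibility asks for a measurable null superset, which the Borel hull provides. *)
Lemma ae_HM (P : 'rV[R]_m -> Prop) :
  {ae HM m s, forall x, P x} <-> hausdorff s [set x | ~ P x] = 0.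
Proof.
split=> [[A [_ A0 PA]]|P0]; first exact: hausdorff_subset_null A0.
have [B [mB PB B0]] := borel_hull s [set x | ~ P x].
by exists B; split => //; [exact: caratheodory_borel|rewrite -P0 -B0].
Qed.

Variables (D : set (borelV R m)) (f : 'rV[R]_m -> R) (F : borelV R m -> R).
Hypotheses (mD : measurable D) (mF : measurable_fun setT F).
Hypothesis fF : hausdorff s (D `&` [set x | f x <> F x]) = 0.

Let mDc : measurable (D : set mT). Proof. exact: caratheodory_borel. Qed.

Let mFc : measurable_fun (D : set mT) (EFin \o F : mT -> \bar R).
Proof. by apply: measurable_fun_cara => //; apply/measurable_EFinP; exact: measurable_funTS. Qed.

Let Ff : ae_eq (HM m s) (D : set mT) (EFin \o F) (EFin \o f).
Proof.
apply/ae_HM; apply: hausdorff_subset_null fF => x /= /not_implyP[Dx Ffx]; split => // fFx.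
by apply: Ffx; rewrite fFx.
Qed.

Let mfc : measurable_fun (D : set mT) (EFin \o f : mT -> \bar R).
Proof. exact: (ae_measurable_fun (@measure_is_complete_caratheodory R _ _) Ff). Qed.

(** [f] inherits measurability from [F] because the Caratheodory measure is complete. This is needed
    on slices, where nothing is known a priori about the restriction of an integrable function. *)
Lemma integral_HM_modification : \int[HM m s]_(x in D) (f x)%:E = \int[HM m s]_(x in D) (F x)%:E.
Proof. by apply/esym; exact: (@ae_eq_integral _ mT R (HM m s) D _ _ mDc mFc mfc Ff). Qed.

Lemma integrable_HM_modification : (HM m s).-integrable (D : set mT) (EFin \o f) ->
  (hausB m s).-integrable D (EFin \o F).
Proof.
move=> /integrableP[_ fi].
have mFD : measurable_fun D (EFin \o F) by apply/measurable_EFinP; exact: measurable_funTS.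
apply: (iffLR (integrable_HM s mD mFD)); apply/integrableP; split; first exact: mFc.
have mfa : measurable_fun (D : set mT) (fun x : mT => `|(f x)%:E|) by exact: measurableT_comp mfc.
have mFa : measurable_fun (D : set mT) (fun x : mT => `|(F x)%:E|) by exact: measurableT_comp mFc.
apply: le_lt_trans fi; rewrite le_eqVlt; apply/orP; left; apply/eqP.
apply: (@ae_eq_integral _ mT R (HM m s) D _ _ mDc mFa mfa).
by apply: filterS Ff => x h Dx; have [->] := h Dx.
Qed.

End almost_everywhere_HM.

(** * Injectivity from the slices *)

Section radon_slices.
Variables (R : realType) (k : nat).
Local Open Scope ereal_scope.

Lemma enorm_chartB theta t (x y : 'rV[R]_k) :
  enorm (chart theta t x - chart theta t y) = (1 * enorm (x - y))%R.
Proof.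
by rewrite chartB subrr mul1r; apply: eq_enorm; rewrite chart_dotv mul0r add0r.
Qed.

Lemma radon_chart (g : borelV R (1 + k) -> R) theta t : enorm theta = 1%R ->
  measurable_fun setT g -> radon g theta t = \int[@vol R k]_y (g (chart theta t y))%:E.
Proof.
move=> theta1 mg; have mH := measurable_hyperplane theta t.
have mgE : measurable_fun (hyperplane theta t : set (borelV R (1 + k))) (EFin \o g).
  by apply/measurable_EFinP; exact: measurable_funTS.
rewrite /radon integral_HM//.
rewrite (integral_similarity _ ltr01 (enorm_chartB theta t) (measurable_chart2 theta t) mH _ mgE).
  rewrite expr1n mul1e (_ : _ @^-1` _ = setT)//; apply/seteqP; split => y // _.
  by rewrite /hyperplane/= chart_theta.
by move=> x xt; have [y ->] := chart_surj x theta1; exists y => //; rewrite xt.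
Qed.

Lemma ae_radon_modification (f : 'rV[R]_(1 + k) -> R) (F : borelV R (1 + k) -> R) theta :
  enorm theta = 1%R -> measurable_fun setT F -> hausdorff (1 + k) [set x | f x <> F x] = 0 ->
  {ae @lebesgue_measure R, forall t, radon f theta t = radon F theta t}.
Proof.
move=> theta1 mF /(ae_slice_null theta); apply: filterS => t N0.
apply: integral_HM_modification => //; first exact: measurable_hyperplane.
apply: (@hausdorff_subset_null _ _ _ _
  (chart theta t @` [set y | f (chart theta t y) <> F (chart theta t y)])).
  move=> x [xt fFx]; have [y xy] := chart_surj x theta1; exists y; last by rewrite xy xt.
  by move: fFx; rewrite /= {1 2}xy xt.
apply: (@hausdorff_lipschitz_null _ _ _ _ 1%R) => // x y _ _.
by rewrite enorm_chartB.
Qed.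

Section compact_support.
Variable g : borelV R (1 + k) -> R.
Hypotheses (mg : measurable_fun setT g) (ig : (@vol R (1 + k)).-integrable setT (EFin \o g)).
Hypothesis g0 : forall x, ~ oball x -> g x = 0%R.
Variable xi : 'rV[R]_(1 + k).

Let h (x : borelV R (1 + k)) := (g x * expR (dotv x xi))%:E.

Let mh : measurable_fun setT h.
Proof.
apply/measurable_EFinP; apply: measurable_funM => //; apply: measurableT_comp => //.
by apply: measurable_dotv => //; exact: measurable_id.
Qed.

Lemma integrable_laplace : (@vol R (1 + k)).-integrable setT h.
Proof.
have ib : (@vol R (1 + k)).-integrable setT (fun x => (expR (enorm xi))%:E * (EFin \o g) x).
  exact: integrableZl.
apply: le_integrable ib => // x _ /=; rewrite lee_fin !normrM mulrC.
have [x1|x1] := pselect (oball x); last by rewrite g0// normr0 !mulr0.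
rewrite ler_wpM2r// !ger0_norm ?expR_ge0// ler_expR (le_trans (dotv_le _ _))//.
by rewrite ler_piMl ?enorm_ge0// ltW.
Qed.

Let chartE theta t y : xi = (enorm xi *: theta)%R -> enorm theta = 1%R ->
  h (chart theta t y) = (expR (enorm xi * t))%:E * (g (chart theta t y))%:E.
Proof.
move=> xiE theta1; rewrite /h {1}xiE dotvZr chart_theta// -EFinM mulrC.
by [].
Qed.

Let directionE : xi = (enorm xi *: direction xi)%R. Proof. exact: direction_eta. Qed.

Let direction1 : enorm (direction xi) = 1%R.
Proof. by apply: enorm_eqP => //; rewrite direction_unit expr1n. Qed.

Let inner t : \int[@vol R k]_y h (chart (direction xi) t y) =
  (expR (enorm xi * t))%:E * radon g (direction xi) t.
Proof.
rewrite radon_chart// -integralZ_gt0 ?expR_gt0//.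
  by apply: eq_integral => y _; rewrite chartE.
by apply/measurable_EFinP; exact: (measurableT_comp mg (measurable_chart2 (direction xi) t)).
Qed.

Lemma measurable_laplace_radon : measurable_fun setT
  (fun t : R => (expR (enorm xi * t))%:E * radon g (direction xi) t).
Proof.
have := measurable_fubini_F (integrable_chart (direction xi) mh integrable_laplace).
by rewrite /fubini_F; under eq_fun do rewrite inner.
Qed.

(** The exponential is constant on each hyperplane orthogonal to [xi], so it leaves the inner
    integral. *)
Lemma laplace_radon : \int[@vol R (1 + k)]_x h x = (slice_const R k)%:E *
  \int[@lebesgue_measure R]_t ((expR (enorm xi * t))%:E * radon g (direction xi) t).
Proof.
rewrite (integral_chart (direction xi) mh integrable_laplace); congr (_ * _).
by apply: eq_integral => t _; exact: inner.
Qed.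

End compact_support.

(** Stated for two functions because [radon] need not be additive on slices where the integrals are
    infinite. The subtraction is performed on the full Laplace integrals, which are finite. *)
Lemma radon_inj (g g' : borelV R (1 + k) -> R) :
  measurable_fun setT g -> measurable_fun setT g' ->
  (@vol R (1 + k)).-integrable setT (EFin \o g) -> (@vol R (1 + k)).-integrable setT (EFin \o g') ->
  (forall x, ~ oball x -> g x = 0%R) -> (forall x, ~ oball x -> g' x = 0%R) ->
  (forall theta, enorm theta = 1%R ->
     {ae @lebesgue_measure R, forall t, radon g theta t = radon g' theta t}) ->
  vol [set x | g x <> g' x] = 0.
Proof.
move=> mg mg' ig ig' g0 g'0 gg'.
have mB := @measurable_oball R (1 + k).
have sub0 : ae_eq (@vol R (1 + k)) (oball (n := 1 + k)) (EFin \o (g \- g')%R) (cst 0).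
  apply: laplace_transform_inj; first exact: measurable_funB.
    rewrite (_ : EFin \o _ = (EFin \o g) \- (EFin \o g'))//.
    by apply: integrableB => //; exact: integrableS ig || exact: integrableS ig'.
  move=> xi; have ih := integrable_laplace mg ig g0 xi; have ih' := integrable_laplace mg' ig' g'0 xi.
  rewrite integral_mkcond.
  rewrite (eq_integral (fun x => (g x * expR (dotv x xi))%:E - (g' x * expR (dotv x xi))%:E)); last first.
    move=> x _; rewrite patchE; case: ifPn => [_|/negP x1]; first by rewrite -EFinB mulrBl.
    by rewrite g0 ?g'0 ?mul0r ?sube0// => x1'; apply: x1; rewrite inE.
  rewrite integralB// (laplace_radon mg ig g0) (laplace_radon mg' ig' g'0).
  have d1 : enorm (direction xi) = 1%R by apply: enorm_eqP => //; rewrite direction_unit expr1n.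
  rewrite (@ae_eq_integral _ (measurableTypeR R) R (@lebesgue_measure R) setT
    (fun t => (expR (enorm xi * t))%:E * radon g' (direction xi) t)
    (fun t => (expR (enorm xi * t))%:E * radon g (direction xi) t))//.
  - by rewrite subee// -laplace_radon//; exact: integrable_fin_num.
  - exact: measurable_laplace_radon.
  - exact: measurable_laplace_radon.
  by have := gg' _ d1; apply: filterS => t -> _.
have [A [mA A0 gA]] := sub0.
apply: hausdorff_subset_null A0 => x /= gx; apply: gA => /= h; apply: gx.
have [x1|x1] := pselect (oball x); last by rewrite g0// g'0.
by have [/eqP] := h x1; rewrite subr_eq0 => /eqP.
Qed.

End radon_slices.

(** * Inversion formula and uniqueness *)

Section inversion.
Variables (R : realType) (j : nat).
Local Notation n := (1 + (1 + j))%N.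
Variable f : 'rV[R]_(n + 1) -> R.
Hypothesis hf : (HM (n + 1) n).-integrable (hemisphere n) (EFin \o f).
Local Open Scope ereal_scope.

Variables (F : borelV R (n + 1) -> R) (N : set (borelV R (n + 1))).
Hypotheses (mF : measurable_fun setT F) (mN : measurable N) (N0 : hausdorff n N = 0).
Hypothesis Ff : forall x, hemisphere n x -> ~ N x -> F x = f x.

Lemma integrable_flatten : (@vol R n).-integrable setT (EFin \o flatten F : borelV R n -> \bar R).
Proof.
have mfl : measurable_fun setT (flatten F : borelV R n -> R) by exact: measurable_flatten.
have iF : (hausB (n + 1) n).-integrable (@hemisphere R n) (EFin \o F).
  apply: integrable_HM_modification hf => //; first exact: measurable_hemisphere.
  apply: hausdorff_subset_null N0 => x [Dx /= fFx]; apply: contrapT => Nx.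
  by apply: fFx; rewrite Ff.
apply/integrableP; split; first exact/measurable_EFinP.
have /integrableP[_] := iF; apply: le_lt_trans.
have mFa : measurable_fun setT (fun z : borelV R (n + 1) => `|(F z)%:E|).
  by apply: measurableT_comp => //; exact/measurable_EFinP.
apply: (@le_trans _ _ (\int[hausB (n + 1) n]_(z in upper (n := n)) `|(F z)%:E|)).
  rewrite ge0_integral_upper// [leRHS]integral_mkcond le_eqVlt; apply/orP; left; apply/eqP.
  apply: eq_integral => x _; rewrite patchE; case: ifPn => [/set_mem x1|/negP x1] /=.
    by rewrite flatten_in// -EFinM normrM ger0_norm// invr_ge0 height_ge0.
  by rewrite flatten_out ?normr0// => x1'; apply: x1; rewrite inE.
apply: ge0_subset_integral => //.
- exact: measurable_upper.
- exact: measurable_hemisphere.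
- exact: measurable_funTS.
- by move=> x [x1 x0]; split => //; exact: ltW.
Qed.

Lemma ae_Phi_radon theta : enorm theta = 1%R ->
  {ae @lebesgue_measure R, forall t, Phi f theta t = radon (flatten F) theta t}.
Proof.
move=> theta1; pose M := (fun z : 'rV[R]_(n + 1) => lsubmx z) @` N.
have M0 : hausdorff n M = 0.
  apply: (@hausdorff_lipschitz_null _ _ _ _ 1%R) => // x y _ _; rewrite mul1r.
  have -> : (lsubmx x - lsubmx y = lsubmx (x - y))%R by apply/rowP => i; rewrite !mxE.
  exact: enorm_lsubmx.
have := ae_slice_null theta M0; apply: filterS => t Mt0.
rewrite -Phi_radon_flatten// /Phi; case: ifPn => // t1; congr (_ * _).
apply: integral_HM_modification => //; first exact: measurable_hemisphere_tau.
have NM x : N x -> M (lsubmx x) by exists x.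
apply: hausdorff_subset_null (hemisphere_tau_null theta1 t1 NM Mt0) => x [Dx fFx].
split => //; apply: contrapT => Nx; apply: fFx; rewrite Ff//.
by case: Dx.
Qed.

Lemma ae_flattenK :
  {ae HM (n + 1) n, forall x, hemisphere n x -> f x = (xlast x * flatten F (lsubmx x))%R}.
Proof.
apply/ae_HM; apply: (@hausdorff_subset_null _ _ _ _ (N `|` @equator R n)); last first.
  by apply: hausdorff_setU_null => //; exact: equator_null.
move=> x /= /not_implyP[Dx fx]; apply: contrapT => /not_orP[Nx Ex]; apply: fx.
have := Dx; rewrite {1}hemisphereE => -[ux|//].
have [x1 lx] := upper_lift ux; rewrite flatten_in// lx -Ff//.
have -> : height (lsubmx x) = xlast x by rewrite -[in RHS]lx /lift xlast_snocv.
by rewrite mulrA divff ?mul1r// gt_eqF// ux.2.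
Qed.

Lemma flatten_unique (psi' : 'rV[R]_n -> R) :
  (HM n n).-integrable setT (EFin \o psi') ->
  {ae HM n n, forall x, ~ unit_ball x -> psi' x = 0%R} ->
  (forall theta : 'rV[R]_n, enorm theta = 1%R ->
    {ae @lebesgue_measure R, forall t, Phi f theta t = radon psi' theta t}) ->
  {ae HM n n, forall x, psi' x = flatten F x}.
Proof.
move=> ipsi /ae_HM psi0 Rpsi.
have [G [N' [mG mN' N'0 Gpsi]]] := borel_modification (@measurableT _ _) ipsi.
(* Cutting off by the open ball enforces the support condition at every point; the change is null
   because [psi'] vanishes almost everywhere off the closed ball and the sphere is null. *)
pose g (x : borelV R n) := (\1_(oball (n := n)) x * G x)%R.
have mg : measurable_fun setT g.
  by apply: measurable_funM => //; apply: measurable_indic; exact: measurable_oball.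
have psig : hausdorff n [set x | psi' x <> g x] = 0.
  apply: (@hausdorff_subset_null _ _ _ _ (N' `|` ([set x | ~ (~ unit_ball x -> psi' x = 0%R)]
    `|` [set x | enorm x = 1%R]))); last first.
    by do 2!apply: hausdorff_setU_null => //; exact: sphere_null.
  move=> x /= psix; apply: contrapT => /not_orP[Nx /not_orP[/contrapT Ux Sx]]; apply: psix.
  rewrite /g indicE; have [x1|x1] := pselect (oball x).
    by rewrite mem_set// mul1r Gpsi.
  rewrite memNset// mul0r Ux// => x1'; apply: Sx; apply/le_anti; rewrite x1'/=.
  by rewrite leNgt; apply/negP.
have ig : (@vol R n).-integrable setT (EFin \o g).
  by apply: integrable_HM_modification ipsi => //; rewrite setTI.
apply/ae_HM; apply: (@hausdorff_subset_null _ _ _ _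
    ([set x | psi' x <> g x] `|` [set x | g x <> flatten F x])).
  move=> x /= psix; apply: contrapT => /not_orP[/contrapT h /contrapT h'].
  by apply: psix; rewrite h.
apply: hausdorff_setU_null => //; apply: radon_inj => //.
- exact: measurable_flatten.
- exact: integrable_flatten.
- by move=> x x1; rewrite /g indicE memNset// mul0r.
- exact: flatten_out.
move=> theta theta1; have := ae_radon_modification theta1 mg psig.
move=> h; apply: filterS3 h (Rpsi _ theta1) (ae_Phi_radon theta1) => t <- <-.
by [].
Qed.

End inversion.

Theorem theorem2p1 (R : realType) (n : nat) (hn : (2 <= n)%N)
  (f : 'rV[R]_(n + 1) -> R)
  (hf : (HM (n + 1) n).-integrable (hemisphere n) (EFin \o f)) :
  exists psi : 'rV[R]_n -> R,
    [/\ (HM n n).-integrable setT (EFin \o psi),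
        {ae HM n n, forall x, ~ unit_ball x -> psi x = 0},
        (forall theta : 'rV[R]_n, enorm theta = 1 ->
           {ae (@lebesgue_measure R), forall t, Phi f theta t = radon psi theta t}),
        (forall psi' : 'rV[R]_n -> R,
           (HM n n).-integrable setT (EFin \o psi') ->
           {ae HM n n, forall x, ~ unit_ball x -> psi' x = 0} ->
           (forall theta : 'rV[R]_n, enorm theta = 1 ->
              {ae (@lebesgue_measure R), forall t, Phi f theta t = radon psi' theta t}) ->
           {ae HM n n, forall x, psi' x = psi x}) &
        {ae HM (n + 1) n, forall x, hemisphere n x ->
           f x = xlast x * psi (lsubmx x)}].
Proof.
(* [j.+2] is convertible to [1 + (1 + j)], the form that allows one coordinate to be split off
   twice. *)
case: n hn f hf => [|[|j]]// _ f hf.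
have [F [N [mF mN N0 Ff]]] :=
  borel_modification (caratheodory_borel _ (@measurable_hemisphere R (1 + (1 + j)))) hf.
exists (@flatten R (1 + (1 + j)) F); split.
- have mfl : measurable_fun [set: borelV R (1 + (1 + j))] (EFin \o @flatten R (1 + (1 + j)) F).
    by apply/measurable_EFinP; exact: measurable_flatten.
  exact: (iffRL (@integrable_HM R _ (1 + (1 + j)) setT _ measurableT mfl)
    (integrable_flatten hf mF N0 Ff)).
- by apply: aeW => x x1; apply: flatten_out => /ltW.
- exact: ae_Phi_radon mF N0 Ff.
- by move=> psi'; exact: (flatten_unique hf mF N0 Ff).
- exact: ae_flattenK N0 Ff.
Qed.
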